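(* Let $d_1,d_2$ be positive integers, let $F=(f,g)\in\Omega_2(d_1,d_2)$ be proper, and assume that $\{a,b\}$ is a generalized node of $F$ with $F(a)=F(b)=c$. Then $\{a,b\}$ is a node of $F$ if and only if $\nu(a,b)=1$.
   Context: $\Omega_2(d_1,d_2)$ is the set of polynomial mappings $(f,g):\mathbb{C}^2\to\mathbb{C}^2$ with $\deg f\le d_1$, $\deg g\le d_2$. $J(F)=f_xg_y-f_yg_x$, $C(F)=\{J(F)=0\}$. For proper $F$, a generalized node is an unordered pair $a,b\in C(F)$ with $F(a)=F(b)$ such that $(a,b)$ is an isolated zero of $C(F)\times C(F)\ni(x,y)\mapsto F(x)-F(y)\in\mathbb{C}^2$; $\nu(a,b)=\dim_{\mathbb{C}}\mathcal{O}_{(a,b)}/(J(F)(x),J(F)(y),f(x)-f(y),g(x)-g(y))$. A node is an unordered pair $\{a,b\}$ of distinct points with $F(a)=F(b)$ such that the bi-germ of $F$ at $\{a,b\}$ is biholomorphically equivalent to the bi-germ of two transversal folds $(x_1,y_1)\mapsto(x_1^2,y_1)$, $(x_2,y_2)\mapsto(x_2,y_2^2)$. *)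

(* Defs.v *)
(* C = Coquelicot's complex numbers (over Stdlib R),
   C^2 = C * C and C^4 = (C * C) * (C * C), all NormedModules over C_AbsRing,
   so that "differentiable" below means complex (Frechet) differentiable. *)
From Stdlib Require Import Reals List.
From Coquelicot Require Import Coquelicot.
Import ListNotations.
Open Scope C_scope.

Definition C2 := (C * C)%type.
Definition C4 := (C2 * C2)%type.

Definition sumC (l : list C) : C := fold_right Cplus 0 l.
Definition sum_lt (n : nat) (a : nat -> C) : C := sumC (map a (seq 0 n)).

(* A polynomial is given by its coefficient array c (c i j = coeff of x^i y^j). *)
Definition deg_le (d : nat) (c : nat -> nat -> C) : Prop :=
  forall i j, (d < i + j)%nat -> c i j = 0.

Definition peval (d : nat) (c : nat -> nat -> C) (z : C2) : C :=
  sum_lt (S d) (fun i => sum_lt (S d) (fun j =>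
     c i j * pow_n (fst z) i * pow_n (snd z) j)).

(* formal partial derivatives (they again have degree <= d) *)
Definition pdx (c : nat -> nat -> C) : nat -> nat -> C :=
  fun i j => RtoC (INR (S i)) * c (S i) j.
Definition pdy (c : nat -> nat -> C) : nat -> nat -> C :=
  fun i j => RtoC (INR (S j)) * c i (S j).

Definition pmap (d1 d2 : nat) (cf cg : nat -> nat -> C) (z : C2) : C2 :=
  (peval d1 cf z, peval d2 cg z).

Definition jac (d1 d2 : nat) (cf cg : nat -> nat -> C) (z : C2) : C :=
  peval d1 (pdx cf) z * peval d2 (pdy cg) z
  - peval d1 (pdy cf) z * peval d2 (pdx cg) z.

Definition crit (d1 d2 : nat) (cf cg : nat -> nat -> C) (z : C2) : Prop :=
  jac d1 d2 cf cg z = 0.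

Definition compact_set {T : UniformSpace} (K : T -> Prop) : Prop :=
  forall (I : Type) (O : I -> T -> Prop),
    (forall i, open (O i)) ->
    (forall x, K x -> exists i, O i x) ->
    exists l : list I, forall x, K x -> exists i, In i l /\ O i x.

Definition proper_map (F : C2 -> C2) : Prop :=
  forall K : C2 -> Prop, compact_set K -> compact_set (fun x => K (F x)).

Definition holo_near {U V : NormedModule C_AbsRing} (f : U -> V) (p : U) : Prop :=
  locally p (fun z => ex_filterdiff f (locally z)).

Definition germ_eq {U V : UniformSpace} (f g : U -> V) (p : U) : Prop :=
  locally p (fun z => f z = g z).

Definition biholo_germ {U V : NormedModule C_AbsRing} (phi : U -> V) (p : U) (q : V)
  : Prop :=
  phi p = q /\ holo_near phi p /\
  exists psi : V -> U, psi q = p /\ holo_near psi q /\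
    germ_eq (fun z => psi (phi z)) (fun z => z) p /\
    germ_eq (fun w => phi (psi w)) (fun w => w) q.

Definition in_ideal {U : NormedModule C_AbsRing} (p : U) (hs : list (U -> C))
  (phi : U -> C) : Prop :=
  exists as_ : list (U -> C),
    length as_ = length hs /\ List.Forall (fun a : U -> C => @holo_near U C_NormedModule a p) as_ /\
    germ_eq phi (fun z => sumC (map (fun ah => fst ah z * snd ah z)
                                        (combine as_ hs))) p.

Definition quot_dim {U : NormedModule C_AbsRing} (p : U) (hs : list (U -> C))
  (n : nat) : Prop :=
  exists e : nat -> (U -> C),
    (forall k, (k < n)%nat -> holo_near (e k) p) /\
    (forall phi : U -> C, holo_near phi p ->
       exists c : nat -> C,
         in_ideal p hs (fun z => phi z - sum_lt n (fun k => c k * e k z))) /\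
    (forall c : nat -> C,
       in_ideal p hs (fun z => sum_lt n (fun k => c k * e k z)) ->
       forall k, (k < n)%nat -> c k = 0).

Section Nodes.
Variables (d1 d2 : nat) (cf cg : nat -> nat -> C).
Let F := pmap d1 d2 cf cg.
Let J := jac d1 d2 cf cg.

(* {a,b} is a generalized node: a, b in C(F), F a = F b, and (a,b) is an
   isolated zero of C(F) x C(F) -> C^2, (x,y) |-> F x - F y. *)
Definition generalized_node (a b : C2) : Prop :=
  crit d1 d2 cf cg a /\ crit d1 d2 cf cg b /\ F a = F b /\
  locally ((a, b) : C4) (fun xy : C4 =>
     crit d1 d2 cf cg (fst xy) -> crit d1 d2 cf cg (snd xy) ->
     F (fst xy) = F (snd xy) -> xy = (a, b)).

Definition node_ideal : list (C4 -> C) :=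
  [ (fun xy : C4 => J (fst xy));
    (fun xy : C4 => J (snd xy));
    (fun xy : C4 => fst (F (fst xy)) - fst (F (snd xy)));
    (fun xy : C4 => snd (F (fst xy)) - snd (F (snd xy))) ].

Definition nu_eq (a b : C2) (n : nat) : Prop :=
  quot_dim ((a, b) : C4) node_ideal n.

End Nodes.

Definition fold1 (z : C2) : C2 := (fst z * fst z, snd z).
Definition fold2 (z : C2) : C2 := (fst z, snd z * snd z).
Definition origin : C2 := (RtoC 0, RtoC 0).

Definition bigerm_folds (F : C2 -> C2) (a b : C2) : Prop :=
  exists (phi1 phi2 psi : C2 -> C2),
    biholo_germ phi1 a origin /\ biholo_germ phi2 b origin /\
    biholo_germ psi (F a) origin /\
    germ_eq (fun z => psi (F z)) (fun z => fold1 (phi1 z)) a /\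
    germ_eq (fun z => psi (F z)) (fun z => fold2 (phi2 z)) b.

(* node: unordered pair {a,b} of distinct points with F a = F b whose
   bi-germ is equivalent to two transversal folds *)
Definition is_node (F : C2 -> C2) (a b : C2) : Prop :=
  a <> b /\ F a = F b /\ (bigerm_folds F a b \/ bigerm_folds F b a).

(* Main.v *)
(* The generators of the node ideal vanish at (a,b), so nu(a,b) = 1 means that
   they generate the maximal ideal, i.e. that their differentials there are
   independent: no nonzero (v,w) satisfies dJ(a)v = 0, dJ(b)w = 0 and
   dF(a)v = dF(b)w.

   If nu = 1, this forces a <> b, a fold at each of a and b, and transversal
   images of dF(a) and dF(b).  Choose linear target coordinates (f,g) with
   df(a) = 0 and dg(b) = 0.  Near a, (J,g) are coordinates (s,t); writing
   f = al(t) + h(s,t) with h(0,t) = 0, the identity dh/ds = const * s * unit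
   gives h = s^2 r with r(a) <> 0, so f - al(g) = (J sqrt r)^2.  Symmetrically
   g - be(f) is a square near b, and (f - al(g), g - be(f)) is the target
   coordinate change.

   If {a,b} is a node with source coordinates X, Y, the chain rule for
   determinants shows that J(x) and J(y) are units times X1 and Y2.  The ideal
   thus contains X1, Y2 and, by a two-point Hadamard lemma, X1^2 - Y1 and
   X2 - Y2^2, hence all four coordinates, hence the maximal ideal.

   Since "holomorphic" only means complex differentiable near a point, both
   directions rest on Goursat's theorem: it yields Cauchy's formula, Cauchy
   estimates, the division of a holomorphic function by a linear form on whose
   zero set it vanishes, and the inverse function theorem. *)
Require Import Defs.
From Stdlib Require Import Reals List Lra Lia Psatz ClassicalEpsilon.
From Coquelicot Require Import Coquelicot.
Import ListNotations.
Open Scope C_scope.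

(** * First-order approximation of complex-valued functions *)

(** The obstacle is that complex differentiability near a point says nothing about continuity of the
    derivative in the base point. Two substitutes carry the proof. Cauchy's formula on complex lines
    bounds derivatives and quadratic remainders by a bound for the function; this yields strict
    differentiability, which is all that Newton's iteration asks for. And where a determinant has to
    be nonzero, it is bounded from below near the point: mutually inverse germs have bounded
    derivatives whose determinants have product 1, so both determinants are bounded away from 0. The
    units in both directions are recognised by such estimates at nearby points, not by evaluating a
    derivative at the centre.

    Goursat's theorem is proved for real closed forms on a rectangle, because Cauchy's formula then
    follows from a homotopy of circles parametrized by that rectangle. Estimates and division are
    stated over arbitrary normed modules, so that one proof serves for functions of one point, on
    C^2, and of a pair of points, on C^4. *)

Notation CN := C_NormedModule.
Notation diffC f z l := (filterdiff (V := C_NormedModule) f (locally z) l) (only parsing).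

(** Frechet differentiability in epsilon-delta form. Only boundedness of [l] is recorded, not
    linearity, and [K] is arbitrary, so that the same product and chain rules serve for the real
    parameters of circles and homotopies and for complex variables. *)
Definition approx_linear {K : AbsRing} {U : NormedModule K} (f : U -> C) (z : U) (l : U -> C) : Prop :=
  (exists M : R, (0 < M)%R /\ forall v, (Cmod (l v) <= M * norm v)%R) /\
  forall eps : R, (0 < eps)%R -> exists delta : R, (0 < delta)%R /\
    forall v, (norm v < delta)%R ->
      (Cmod (f (plus z v) - f z - l v) <= eps * norm v)%R.

Lemma Cmod_minus_le (x y : C) : (Cmod (x - y) <= Cmod x + Cmod y)%R.
Proof.
  unfold Cminus. rewrite <- (Cmod_opp y). apply Cmod_triangle.
Qed.

Lemma Cmod_minus_sym (x y : C) : Cmod (x - y) = Cmod (y - x).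
Proof. rewrite <- Cmod_opp. f_equal; ring. Qed.

Lemma Cmod_minus_ge (x y : C) : (Cmod x - Cmod y <= Cmod (x - y))%R.
Proof.
  pose proof (Cmod_triangle (x - y) y) as H.
  replace (x - y + y) with x in H by ring. lra.
Qed.

Lemma plus_minus_r_group {G : AbelianGroup} (x y : G) : plus x (minus y x) = y.
Proof.
  unfold minus. rewrite (plus_comm y), plus_assoc, (plus_opp_r (G := G) x).
  apply plus_zero_l.
Qed.

Lemma minus_plus_l_group {G : AbelianGroup} (x y : G) : minus (plus x y) x = y.
Proof.
  unfold minus. rewrite (plus_comm x y), <- (plus_assoc y), (plus_opp_r (G := G) x).
  apply plus_zero_r.
Qed.

Lemma plus_minus_r {K : AbsRing} {V : NormedModule K} (x y : V) : plus x (minus y x) = y.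
Proof. exact (plus_minus_r_group (G := NormedModule.AbelianGroup K V) x y). Qed.

Lemma minus_plus_l {K : AbsRing} {V : NormedModule K} (x y : V) : minus (plus x y) x = y.
Proof. exact (minus_plus_l_group (G := NormedModule.AbelianGroup K V) x y). Qed.

Lemma lt_Rmin (x a b : R) : (x < Rmin a b -> x < a /\ x < b)%R.
Proof. intros H; split; eapply Rlt_le_trans; [exact H|apply Rmin_l|exact H|apply Rmin_r]. Qed.

Ltac split_Rmin :=
  repeat match goal with H : (_ < Rmin _ _)%R |- _ => apply lt_Rmin in H; destruct H end.

Section Approx.
Context {K : AbsRing} {U : NormedModule K}.
Implicit Types (f g : U -> C) (z v : U) (l : U -> C).

Lemma approx_lipschitz f z l : approx_linear f z l ->
  exists L delta : R, (0 < L)%R /\ (0 < delta)%R /\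
    forall v, (norm v < delta)%R -> (Cmod (f (plus z v) - f z) <= L * norm v)%R.
Proof.
  intros [[M [HM Hl]] H]. destruct (H 1%R Rlt_0_1) as [d [Hd Hf]].
  exists (1 + M)%R, d. repeat split; try lra. intros v Hv.
  replace (f (plus z v) - f z) with ((f (plus z v) - f z - l v) + l v) by ring.
  eapply Rle_trans; [apply Cmod_triangle|].
  specialize (Hf v Hv). specialize (Hl v). lra.
Qed.

Lemma approx_continuous_eps f z l : approx_linear f z l ->
  forall eps : R, (0 < eps)%R -> exists delta : R, (0 < delta)%R /\
    forall v, (norm v < delta)%R -> (Cmod (f (plus z v) - f z) < eps)%R.
Proof.
  intros H eps Heps. destruct (approx_lipschitz _ _ _ H) as [L [d [HL [Hd Hf]]]].
  exists (Rmin d (eps / L)). split.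
  - apply Rmin_pos; auto. now apply Rdiv_lt_0_compat.
  - intros v Hv. assert (Hv1 : (norm v < d)%R) by (eapply Rlt_le_trans; [exact Hv| apply Rmin_l]).
    assert (Hv2 : (norm v < eps / L)%R) by (eapply Rlt_le_trans; [exact Hv| apply Rmin_r]).
    eapply Rle_lt_trans; [apply Hf, Hv1|].
    apply (Rmult_lt_compat_l L) in Hv2; auto.
    replace (L * (eps / L))%R with eps in Hv2 by (field; lra). exact Hv2.
Qed.

Lemma approx_continuous f z l : approx_linear f z l -> continuous f z.
Proof.
  intros H. unfold continuous. apply (filterlim_locally_ball_norm (U := CN) f (f z)). intros eps.
  destruct (approx_continuous_eps _ _ _ H eps (cond_pos eps)) as [d [Hd Hf]].
  apply locally_le_locally_norm. exists (mkposreal d Hd). intros y Hy.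
  unfold ball_norm in *. simpl in Hy.
  specialize (Hf (minus y z) Hy).
  replace (plus z (minus y z)) with y in Hf; [exact Hf|].
  symmetry; apply plus_minus_r.
Qed.

Lemma approx_ext_lin f z l1 l2 : (forall v, l1 v = l2 v) ->
  approx_linear f z l1 -> approx_linear f z l2.
Proof.
  intros E [[M [HM Hl]] H]. split.
  - exists M; split; auto. intros v; rewrite <- E; auto.
  - intros eps He. destruct (H eps He) as [d [Hd Hf]]. exists d; split; auto.
    intros v Hv. rewrite <- E. auto.
Qed.

Lemma approx_ext f g z l : (forall y, f y = g y) ->
  approx_linear f z l -> approx_linear g z l.
Proof.
  intros E [Hb H]. split; auto.
  intros eps He. destruct (H eps He) as [d [Hd Hf]]. exists d; split; auto.
  intros v Hv. rewrite <- !E. auto.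
Qed.

Lemma approx_const (c : C) z : approx_linear (fun _ => c) z (fun _ => 0).
Proof.
  split.
  - exists 1%R. split; [lra|]. intros v. rewrite Cmod_0. pose proof (norm_ge_0 v); lra.
  - intros eps He. exists 1%R. split; [lra|]. intros v _.
    replace (c - c - 0) with (RtoC 0) by ring. rewrite Cmod_0.
    pose proof (norm_ge_0 v). apply Rmult_le_pos; lra.
Qed.

Lemma approx_plus f g z lf lg : approx_linear f z lf -> approx_linear g z lg ->
  approx_linear (fun y => f y + g y) z (fun v => lf v + lg v).
Proof.
  intros [[M1 [HM1 Hl1]] H1] [[M2 [HM2 Hl2]] H2]. split.
  - exists (M1 + M2)%R. split; [lra|]. intros v. eapply Rle_trans; [apply Cmod_triangle|].
    specialize (Hl1 v); specialize (Hl2 v). lra.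
  - intros eps He.
    destruct (H1 (eps/2)%R) as [d1 [Hd1 Hf1]]; [lra|].
    destruct (H2 (eps/2)%R) as [d2 [Hd2 Hf2]]; [lra|].
    exists (Rmin d1 d2). split; [now apply Rmin_pos|]. intros v Hv.
    specialize (Hf1 v (Rlt_le_trans _ _ _ Hv (Rmin_l _ _))).
    specialize (Hf2 v (Rlt_le_trans _ _ _ Hv (Rmin_r _ _))).
    replace (f (plus z v) + g (plus z v) - (f z + g z) - (lf v + lg v))
      with ((f (plus z v) - f z - lf v) + (g (plus z v) - g z - lg v)) by ring.
    eapply Rle_trans; [apply Cmod_triangle|]. lra.
Qed.

Lemma approx_mult f g z lf lg : approx_linear f z lf -> approx_linear g z lg ->
  approx_linear (fun y => f y * g y) z (fun v => lf v * g z + f z * lg v).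
Proof.
  intros Hf Hg. pose proof (approx_lipschitz _ _ _ Hf) as [L1 [e1 [HL1 [He1 HL1']]]].
  pose proof (approx_lipschitz _ _ _ Hg) as [L2 [e2 [HL2 [He2 HL2']]]].
  destruct Hf as [[M1 [HM1 Hl1]] H1]. destruct Hg as [[M2 [HM2 Hl2]] H2].
  pose proof (Cmod_ge_0 (f z)) as Pf. pose proof (Cmod_ge_0 (g z)) as Pg. split.
  - exists (M1 * (Cmod (g z)) + Cmod (f z) * M2 + 1)%R. split.
    { assert (0 <= M1 * Cmod (g z))%R by (apply Rmult_le_pos; lra).
      assert (0 <= Cmod (f z) * M2)%R by (apply Rmult_le_pos; lra). lra. }
    intros v. eapply Rle_trans; [apply Cmod_triangle|]. rewrite !Cmod_mult.
    specialize (Hl1 v); specialize (Hl2 v). pose proof (norm_ge_0 v).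
    apply (Rmult_le_compat_r (Cmod (g z))) in Hl1; auto.
    apply (Rmult_le_compat_l (Cmod (f z))) in Hl2; auto. nra.
  - intros eps He.
    (* The error terms carry the factors |g z|, |f z| and, from the product of the increments, L1 L2
       |v| with |v| < eps / A. [A] adds up the constants; the 1 makes it positive. *)
    set (A := (Cmod (g z) + Cmod (f z) + L1 * L2 + 1)%R).
    assert (HLL : (0 < L1 * L2)%R) by (apply Rmult_lt_0_compat; lra).
    assert (HA : (0 < A)%R) by (unfold A; lra).
    assert (Hea : (0 < eps / A)%R) by now apply Rdiv_lt_0_compat.
    destruct (H1 _ Hea) as [d1 [Hd1 Hf1]].
    destruct (H2 _ Hea) as [d2 [Hd2 Hf2]].
    exists (Rmin (Rmin d1 d2) (Rmin (Rmin e1 e2) (eps / A))).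
    split; [repeat apply Rmin_pos; auto|]. intros v Hv.
    assert (Hv5 : (norm v < d1 /\ norm v < d2 /\ norm v < e1 /\ norm v < e2 /\ norm v < eps / A)%R).
    { split_Rmin. repeat split; lra. }
    destruct Hv5 as [V1 [V2 [V3 [V4 V5]]]].
    specialize (Hf1 v V1). specialize (Hf2 v V2). specialize (HL1' v V3). specialize (HL2' v V4).
    replace (f (plus z v) * g (plus z v) - f z * g z - (lf v * g z + f z * lg v))
      with ((f (plus z v) - f z - lf v) * g z + (f z * (g (plus z v) - g z - lg v)
            + (f (plus z v) - f z) * (g (plus z v) - g z))) by ring.
    eapply Rle_trans; [apply Cmod_triangle|].
    eapply Rle_trans; [apply Rplus_le_compat_l, Cmod_triangle|].
    rewrite !Cmod_mult. pose proof (norm_ge_0 v) as Pv.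
    apply (Rmult_le_compat_r (Cmod (g z))) in Hf1; auto.
    apply (Rmult_le_compat_l (Cmod (f z))) in Hf2; auto.
    assert (H3 : (Cmod (f (plus z v) - f z) * Cmod (g (plus z v) - g z) <= (L1 * norm v) * (L2 * norm v))%R)
      by (apply Rmult_le_compat; auto using Cmod_ge_0).
    assert (H4 : (L1 * norm v * (L2 * norm v) <= (L1 * L2) * (eps / A) * norm v)%R).
    { replace (L1 * norm v * (L2 * norm v))%R with ((L1 * L2) * (norm v * norm v))%R by ring.
      rewrite (Rmult_assoc (L1 * L2)). apply Rmult_le_compat_l; [lra|]. apply Rmult_le_compat_r; lra. }
    assert (H5 : (eps * norm v = eps / A * norm v * A)%R) by (field; lra).
    rewrite H5. unfold A at 2. assert (0 <= eps / A * norm v)%R by (apply Rmult_le_pos; lra). nra.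
Qed.

Lemma approx_comp f (g : C -> C) z lf (a : C) : approx_linear f z lf ->
  approx_linear g (f z) (fun w => a * w) ->
  approx_linear (fun y => g (f y)) z (fun v => a * lf v).
Proof.
  intros Hf Hg. pose proof (approx_lipschitz _ _ _ Hf) as [L1 [e1 [HL1 [He1 HL1']]]].
  destruct Hf as [[M1 [HM1 Hl1]] H1]. destruct Hg as [_ H2].
  pose proof (Cmod_ge_0 a) as Pa. split.
  - exists (Cmod a * M1 + 1)%R. split.
    { assert (0 <= Cmod a * M1)%R by (apply Rmult_le_pos; lra). lra. }
    intros v. rewrite Cmod_mult. specialize (Hl1 v). pose proof (norm_ge_0 v).
    apply (Rmult_le_compat_l (Cmod a)) in Hl1; auto. nra.
  - intros eps He.
    (* Half of [eps] goes to the remainder of [g], where |w| <= L1 |v|, and half to that of [f],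
       which is multiplied by [a]; the 1 in [Cmod a + 1] covers a = 0. *)
    destruct (H2 (eps / 2 / L1)%R) as [d2 [Hd2 Hg2]]; [apply Rdiv_lt_0_compat; lra|].
    destruct (H1 (eps / 2 / (Cmod a + 1))%R) as [d1 [Hd1 Hf1]]; [apply Rdiv_lt_0_compat; lra|].
    exists (Rmin d1 (Rmin e1 (d2 / L1))).
    split; [repeat apply Rmin_pos; auto; now apply Rdiv_lt_0_compat|]. intros v Hv.
    assert (Hv5 : (norm v < d1 /\ norm v < e1 /\ norm v < d2 / L1)%R).
    { split_Rmin. repeat split; lra. }
    destruct Hv5 as [V1 [V2 V3]].
    specialize (Hf1 v V1). specialize (HL1' v V2).
    pose proof (norm_ge_0 v) as Pv.
    set (w := f (plus z v) - f z) in *.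
    assert (Hw : (Cmod w < d2)%R).
    { eapply Rle_lt_trans; [apply HL1'|]. apply (Rmult_lt_compat_l L1) in V3; auto.
      replace (L1 * (d2 / L1))%R with d2 in V3 by (field; lra). exact V3. }
    specialize (Hg2 w Hw). change (plus (f z) w) with (f z + w) in Hg2.
    change (norm w) with (Cmod w) in Hg2.
    replace (f z + w) with (f (plus z v)) in Hg2 by (unfold w; ring).
    replace (g (f (plus z v)) - g (f z) - a * lf v)
      with ((g (f (plus z v)) - g (f z) - a * w) + a * (w - lf v)) by ring.
    eapply Rle_trans; [apply Cmod_triangle|]. rewrite Cmod_mult.
    assert (A1 : (eps / 2 / L1 * Cmod w <= eps / 2 * norm v)%R).
    { replace (eps / 2 * norm v)%R with (eps / 2 / L1 * (L1 * norm v))%R by (field; lra).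
      apply Rmult_le_compat_l; auto. left; apply Rdiv_lt_0_compat; lra. }
    assert (A2 : (Cmod a * Cmod (w - lf v) <= eps / 2 * norm v)%R).
    { eapply Rle_trans; [apply Rmult_le_compat_l; [auto|apply Hf1]|].
      replace (eps / 2 * norm v)%R with ((Cmod a + 1) * (eps / 2 / (Cmod a + 1) * norm v))%R by (field; lra).
      apply Rmult_le_compat_r; [|lra]. apply Rmult_le_pos; auto. left; apply Rdiv_lt_0_compat; lra. }
    lra.
Qed.
End Approx.

Lemma approx_inv (w : C) : w <> 0 -> approx_linear Cinv w (fun v => - (/ w * / w) * v).
Proof.
  intros Hw. assert (Pw : (0 < Cmod w)%R) by now apply Cmod_gt_0. split.
  - exists (Cmod (- (/ w * / w)) + 1)%R. split; [pose proof (Cmod_ge_0 (- (/ w * / w))); lra|].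
    intros v. rewrite Cmod_mult. change (norm v) with (Cmod v). pose proof (Cmod_ge_0 v). nra.
  - intros eps He.
    (* The remainder is v^2 / (w^2 (w + v)), and [B] bounds this denominator from below because |w +
       v| >= |w| / 2. *)
    set (B := (Cmod w * Cmod w * Cmod w / 2)%R).
    assert (HB : (0 < B)%R) by (unfold B; apply Rdiv_lt_0_compat; [|lra]; repeat apply Rmult_lt_0_compat; auto).
    exists (Rmin (Cmod w / 2) (eps * B)). split.
    { apply Rmin_pos; [lra|]. now apply Rmult_lt_0_compat. }
    intros v Hv. change (norm v) with (Cmod v) in *. change (plus w v) with (w + v).
    assert (V1 : (Cmod v < Cmod w / 2)%R) by (eapply Rlt_le_trans; [exact Hv|apply Rmin_l]).
    assert (V2 : (Cmod v < eps * B)%R) by (eapply Rlt_le_trans; [exact Hv|apply Rmin_r]).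
    assert (Hwv : (Cmod w / 2 <= Cmod (w + v))%R).
    { pose proof (Cmod_minus_ge w (- v)). rewrite Cmod_opp in H.
      replace (w - - v) with (w + v) in H by ring. lra. }
    assert (Hwv0 : w + v <> 0) by (apply Cmod_gt_0; lra).
    replace (/ (w + v) - / w - - (/ w * / w) * v) with (v * v * / (w * w * (w + v))) by (field; auto).
    rewrite !Cmod_mult, Cmod_inv by (repeat apply Cmult_neq_0; auto). rewrite !Cmod_mult.
    pose proof (Cmod_ge_0 v).
    assert (Hi : (/ (Cmod w * Cmod w * Cmod (w + v)) <= / B)%R).
    { apply Rinv_le_contravar; auto. unfold B.
      replace (Cmod w * Cmod w * Cmod w / 2)%R with (Cmod w * Cmod w * (Cmod w / 2))%R by field.
      apply Rmult_le_compat_l; [|auto]. apply Rmult_le_pos; lra. }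
    eapply Rle_trans; [apply Rmult_le_compat_l; [|apply Hi]; apply Rmult_le_pos; lra|].
    replace (eps * Cmod v)%R with (Cmod v * (eps * B) * / B)%R by (field; lra).
    apply Rmult_le_compat_r; [left; now apply Rinv_0_lt_compat|].
    apply Rmult_le_compat_l; lra.
Qed.

(** * Goursat's theorem *)

Local Open Scope R_scope.

(** Total differentiability at a single point, with nothing said about continuity of the partial
    derivatives [A] and [B]: the generality that Goursat's subdivision argument allows. *)
Definition diff2_at (P : R -> R -> R) (t s A B : R) : Prop :=
  forall eps, 0 < eps -> exists d, 0 < d /\ forall t' s', Rabs (t' - t) < d -> Rabs (s' - s) < d ->
    Rabs (P t' s' - P t s - A * (t' - t) - B * (s' - s)) <= eps * (Rabs (t' - t) + Rabs (s' - s)).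

Lemma diff2_at_continuous (P : R -> R -> R) t s A B : diff2_at P t s A B ->
  forall eps, 0 < eps -> exists d, 0 < d /\ forall t' s', Rabs (t' - t) < d -> Rabs (s' - s) < d ->
    Rabs (P t' s' - P t s) < eps.
Proof.
  intros H eps He. destruct (H 1 Rlt_0_1) as [d [Hd Hf]].
  set (M := Rabs A + Rabs B + 2). assert (HM : 0 < M) by (unfold M; pose proof (Rabs_pos A); pose proof (Rabs_pos B); lra).
  exists (Rmin d (eps / 2 / M)). split; [apply Rmin_pos; auto; apply Rdiv_lt_0_compat; lra|].
  intros t' s' Ht Hs. split_Rmin. specialize (Hf t' s' ltac:(lra) ltac:(lra)).
  set (x := t' - t) in *. set (y := s' - s) in *.
  assert (Rabs (P t' s' - P t s) <= Rabs (P t' s' - P t s - A * x - B * y) + (Rabs A * Rabs x + Rabs B * Rabs y)).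
  { rewrite <- !Rabs_mult. replace (P t' s' - P t s) with ((P t' s' - P t s - A * x - B * y) + (A * x + B * y)) at 1 by ring.
    eapply Rle_trans; [apply Rabs_triang|]. pose proof (Rabs_triang (A * x) (B * y)). lra. }
  assert (E : eps / 2 = M * (eps / 2 / M)) by (field; lra).
  pose proof (Rabs_pos x). pose proof (Rabs_pos y). pose proof (Rabs_pos A). pose proof (Rabs_pos B).
  set (q := eps / 2 / M) in *. unfold M in E. nra.
Qed.

Lemma continuous_eps (f : R -> R) x :
  (forall eps, 0 < eps -> exists d, 0 < d /\ forall y, Rabs (y - x) < d -> Rabs (f y - f x) < eps) ->
  continuous f x.
Proof.
  intros H. apply filterlim_locally. intros eps. destruct (H eps (cond_pos eps)) as [d [Hd Hf]].
  exists (mkposreal d Hd). intros y Hy. apply Hf. exact Hy.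
Qed.

Lemma pow2_div_lt (x e : R) : 0 < e -> exists n, x / 2 ^ n < e.
Proof.
  intros He. destruct (Rle_dec x 0) as [Hx|Hx].
  - exists 0%nat. simpl. lra.
  - destruct (pow_lt_1_zero (/ 2) ltac:(rewrite Rabs_pos_eq; lra) (e / x) ltac:(apply Rdiv_lt_0_compat; lra)) as [N HN].
    exists N. specialize (HN N (Nat.le_refl _)).
    rewrite Rabs_pos_eq in HN by (apply pow_le; lra). rewrite pow_inv in HN.
    apply (Rmult_lt_compat_l x) in HN; [|lra]. replace (x * (e / x)) with e in HN by (field; lra). exact HN.
Qed.

Lemma is_lim_div_pow2 (x : R) : is_lim_seq (fun n => x / 2 ^ n) 0.
Proof.
  apply is_lim_seq_ext with (fun n => x * (/ 2) ^ n).
  { intros n. unfold Rdiv. f_equal. apply pow_inv. }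
  replace (Finite 0) with (Rbar_mult x (Finite 0)) by (simpl; f_equal; ring).
  apply is_lim_seq_scal_l. apply is_lim_seq_geom. rewrite Rabs_pos_eq; lra.
Qed.

(** The intervals [X n, X n + v n] are nested; the left ends increase, the right ends decrease and
    the widths tend to 0, so both ends have the same limit. It locates the limit of the bad boxes
    and, later, the limits of geometric sequences. *)
Lemma nested_limit (X v : nat -> R) (x : R) : (forall n, v n = x / 2 ^ n)%R -> (0 <= x)%R ->
  (forall n, X n <= X (S n))%R -> (forall n, X (S n) + v (S n) <= X n + v n)%R ->
  exists l : R, forall n, (X n <= l <= X n + v n)%R.
Proof.
  intros Hv Hx H1 H2.
  assert (Pv : forall n, (0 <= v n)%R) by (intros n; rewrite Hv; apply Rdiv_le_0_compat; [lra|apply pow_lt; lra]).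
  assert (Hm : forall n, (X n <= X 0%nat + v 0%nat)%R).
  { assert (forall n, (X n + v n <= X 0%nat + v 0%nat)%R) by (induction n; [lra|specialize (H2 n); lra]).
    intros n. specialize (H n). specialize (Pv n). lra. }
  destruct (ex_finite_lim_seq_incr X _ H1 Hm) as [l Hl]. exists l. intros n. split.
  - apply (is_lim_seq_incr_compare X l Hl H1).
  - apply (is_lim_seq_decr_compare (fun n => X n + v n)%R l); auto.
    replace (Finite l) with (Rbar_plus l 0) by (simpl; f_equal; ring).
    apply is_lim_seq_plus'; auto. apply is_lim_seq_ext with (fun n => x / 2 ^ n)%R; auto. apply is_lim_div_pow2.
Qed.

(** For comparing opposite sides of a box: an increment that is nearly the constant [K] integrates
    to nearly [K] times the length. *)
Lemma RInt_diff_approx (g1 g0 : R -> R) (x0 x1 K e : R) : x0 <= x1 ->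
  ex_RInt g1 x0 x1 -> ex_RInt g0 x0 x1 ->
  (forall x, x0 <= x <= x1 -> Rabs (g1 x - g0 x - K) <= e) ->
  Rabs (RInt g1 x0 x1 - RInt g0 x0 x1 - K * (x1 - x0)) <= (x1 - x0) * e.
Proof.
  intros Hx E1 E0 H.
  pose proof (ex_RInt_minus (V := R_NormedModule) _ _ _ _ E1 E0) as E.
  pose proof (ex_RInt_const (V := R_NormedModule) x0 x1 K) as EK.
  replace (RInt g1 x0 x1 - RInt g0 x0 x1 - K * (x1 - x0))
    with (RInt (fun x => minus (minus (g1 x) (g0 x)) K) x0 x1).
  - apply abs_RInt_le_const; auto. exact (ex_RInt_minus (V := R_NormedModule) _ _ _ _ E EK).
  - etransitivity; [exact (RInt_minus (V := R_CompleteNormedModule) _ _ _ _ E EK)|].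
    etransitivity; [exact (f_equal2 Rminus (RInt_minus (V := R_CompleteNormedModule) _ _ _ _ E1 E0)
      (RInt_const (V := R_CompleteNormedModule) x0 x1 K))|].
    change (RInt g1 x0 x1 - RInt g0 x0 x1 - (x1 - x0) * K = RInt g1 x0 x1 - RInt g0 x0 x1 - K * (x1 - x0)). ring.
Qed.

(* The integral of [P ds + Q dt] over the boundary of the box. *)
Definition box_int (P Q : R -> R -> R) (t0 t1 s0 s1 : R) : R :=
  RInt (P t1) s0 s1 - RInt (P t0) s0 s1
  - RInt (fun t => Q t s1) t0 t1 + RInt (fun t => Q t s0) t0 t1.

Section Goursat.
Variables (P Q : R -> R -> R) (a b c d : R).
(** The shared [A] expresses that P ds + Q dt is closed: the t-derivative of [P] equals the
    s-derivative of [Q]. *)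
Hypothesis closed_form : forall t s, a <= t <= b -> c <= s <= d ->
  exists A B E, diff2_at P t s A B /\ diff2_at Q t s E A.

Lemma continuous_P t s : a <= t <= b -> c <= s <= d -> continuous (P t) s.
Proof.
  intros Ht Hs. destruct (closed_form t s Ht Hs) as [A [B [E [HP _]]]].
  apply continuous_eps. intros eps He. destruct (diff2_at_continuous _ _ _ _ _ HP eps He) as [e [He' Hf]].
  exists e; split; auto. intros y Hy. apply Hf; auto. rewrite Rminus_eq_0, Rabs_R0; auto.
Qed.

Lemma continuous_Q t s : a <= t <= b -> c <= s <= d -> continuous (fun t => Q t s) t.
Proof.
  intros Ht Hs. destruct (closed_form t s Ht Hs) as [A [B [E [_ HQ]]]].
  apply continuous_eps. intros eps He. destruct (diff2_at_continuous _ _ _ _ _ HQ eps He) as [e [He' Hf]].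
  exists e; split; auto. intros y Hy. apply Hf; auto. rewrite Rminus_eq_0, Rabs_R0; auto.
Qed.

Lemma ex_RInt_P t s0 s1 : a <= t <= b -> c <= s0 -> s0 <= s1 -> s1 <= d -> ex_RInt (P t) s0 s1.
Proof.
  intros. apply (ex_RInt_continuous (V := R_CompleteNormedModule)). intros z. rewrite Rmin_left, Rmax_right by lra. intros.
  apply continuous_P; lra.
Qed.

Lemma ex_RInt_Q s t0 t1 : c <= s <= d -> a <= t0 -> t0 <= t1 -> t1 <= b -> ex_RInt (fun t => Q t s) t0 t1.
Proof.
  intros. apply (ex_RInt_continuous (V := R_CompleteNormedModule)). intros z. rewrite Rmin_left, Rmax_right by lra. intros.
  apply continuous_Q; lra.
Qed.

Lemma box_int_split t0 tm t1 s0 sm s1 : a <= t0 -> t0 <= tm -> tm <= t1 -> t1 <= b ->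
  c <= s0 -> s0 <= sm -> sm <= s1 -> s1 <= d ->
  box_int P Q t0 t1 s0 s1 = box_int P Q t0 tm s0 sm + box_int P Q tm t1 s0 sm
    + box_int P Q t0 tm sm s1 + box_int P Q tm t1 sm s1.
Proof.
  intros Ha Ht0 Ht1 Hb Hc Hs0 Hs1 Hd. unfold box_int.
  assert (CP : forall t, a <= t <= b -> RInt (P t) s0 s1 = RInt (P t) s0 sm + RInt (P t) sm s1).
  { intros t Ht. symmetry. apply (RInt_Chasles (V := R_CompleteNormedModule)); apply ex_RInt_P; lra. }
  assert (CQ : forall s, c <= s <= d ->
    RInt (fun t => Q t s) t0 t1 = RInt (fun t => Q t s) t0 tm + RInt (fun t => Q t s) tm t1).
  { intros s Hs. symmetry. apply (RInt_Chasles (V := R_CompleteNormedModule)); apply ex_RInt_Q; lra. }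
  rewrite (CP t1), (CP t0), (CQ s1), (CQ s0) by lra. ring.
Qed.

(** Near (t, s) each pair of opposite sides contributes [A] times the area, and the two
    contributions cancel because [P] and [Q] share [A]. What is left are the remainders,
    [eps * (w + h)] per unit length, hence [eps * (w + h) ^ 2] in total. *)
Lemma box_int_small t s eps : a <= t <= b -> c <= s <= d -> 0 < eps ->
  exists dl, 0 < dl /\ forall t0 t1 s0 s1, a <= t0 -> t0 <= t <= t1 -> t1 <= b ->
   c <= s0 -> s0 <= s <= s1 -> s1 <= d -> t1 - t0 < dl -> s1 - s0 < dl ->
   Rabs (box_int P Q t0 t1 s0 s1) <= eps * ((t1 - t0) + (s1 - s0)) ^ 2.
Proof.
  intros Ht Hs He. destruct (closed_form t s Ht Hs) as [A [B [E [HP HQ]]]].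
  destruct (HP (eps / 2) ltac:(lra)) as [d1 [Hd1 HP']].
  destruct (HQ (eps / 2) ltac:(lra)) as [d2 [Hd2 HQ']].
  exists (Rmin d1 d2). split; [now apply Rmin_pos|].
  intros t0 t1 s0 s1 Ha Htt Hb Hc Hss Hd Hw Hh. split_Rmin.
  set (w := t1 - t0) in *. set (h := s1 - s0) in *.
  assert (exP : forall x, a <= x <= b -> ex_RInt (P x) s0 s1) by (intros; apply ex_RInt_P; lra).
  assert (exQ : forall x, c <= x <= d -> ex_RInt (fun t => Q t x) t0 t1) by (intros; apply ex_RInt_Q; lra).
  assert (E1 : Rabs (RInt (P t1) s0 s1 - RInt (P t0) s0 s1 - A * w * h) <= h * (eps * (w + h))).
  { apply RInt_diff_approx; try (apply exP; lra); [lra|]. intros x Hx.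
    pose proof (HP' t1 x ltac:(apply Rabs_def1; unfold w, h in *; lra) ltac:(apply Rabs_def1; unfold w, h in *; lra)) as K1.
    pose proof (HP' t0 x ltac:(apply Rabs_def1; unfold w, h in *; lra) ltac:(apply Rabs_def1; unfold w, h in *; lra)) as K2.
    assert (Rabs (x - s) <= h) by (apply Rabs_le; unfold h; lra).
    rewrite (Rabs_pos_eq (t1 - t)) in K1 by lra. rewrite (Rabs_left1 (t0 - t)) in K2 by lra.
    apply Rabs_le_between in K1, K2. apply Rabs_le. unfold w, h in *. nra. }
  assert (E2 : Rabs (RInt (fun t => Q t s1) t0 t1 - RInt (fun t => Q t s0) t0 t1 - A * h * w) <= w * (eps * (w + h))).
  { apply (RInt_diff_approx (fun t => Q t s1) (fun t => Q t s0)); try (apply exQ; lra); [lra|]. intros x Hx.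
    pose proof (HQ' x s1 ltac:(apply Rabs_def1; unfold w, h in *; lra) ltac:(apply Rabs_def1; unfold w, h in *; lra)) as K1.
    pose proof (HQ' x s0 ltac:(apply Rabs_def1; unfold w, h in *; lra) ltac:(apply Rabs_def1; unfold w, h in *; lra)) as K2.
    assert (Rabs (x - t) <= w) by (apply Rabs_le; unfold w; lra).
    rewrite (Rabs_pos_eq (s1 - s)) in K1 by lra. rewrite (Rabs_left1 (s0 - s)) in K2 by lra.
    apply Rabs_le_between in K1, K2. apply Rabs_le. unfold w, h in *. nra. }
  unfold box_int.
  match goal with |- Rabs ?X <= _ => replace X with
    ((RInt (P t1) s0 s1 - RInt (P t0) s0 s1 - A * w * h)
     - (RInt (fun t => Q t s1) t0 t1 - RInt (fun t => Q t s0) t0 t1 - A * h * w)) by ring end.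
  unfold Rminus at 1. eapply Rle_trans; [apply Rabs_triang|]. rewrite Rabs_Ropp.
  replace (eps * (w + h) ^ 2) with (h * (eps * (w + h)) + w * (eps * (w + h))) by ring. lra.
Qed.

Let w n := (b - a) / 2 ^ n.
Let h n := (d - c) / 2 ^ n.

(** [p] is the lower left corner of a box of the n-th dyadic subdivision. The threshold is quadratic
    in the side lengths, so that it is divided by 4 when both sides are halved. *)
Definition bad_box (eps : R) (n : nat) (p : R * R) : Prop :=
  a <= fst p /\ fst p + w n <= b /\ c <= snd p /\ snd p + h n <= d /\
  eps * (w n + h n) ^ 2 < Rabs (box_int P Q (fst p) (fst p + w n) (snd p) (snd p + h n)).

(** The boundary integral is the sum over the four quarters, and the thresholds of the quarters add
    up to that of the box; if no quarter were bad, the box would not be bad either. *)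
Lemma bad_box_quarter eps n p : a <= b -> c <= d -> bad_box eps n p ->
  exists p', bad_box eps (S n) p' /\ fst p <= fst p' /\ fst p' + w (S n) <= fst p + w n
    /\ snd p <= snd p' /\ snd p' + h (S n) <= snd p + h n.
Proof.
  intros Hab Hcd. destruct p as [t s]. unfold bad_box. simpl fst; simpl snd. intros [H1 [H2 [H3 [H4 H5]]]].
  assert (Hw : w n = w (S n) + w (S n)) by (unfold w; simpl; field; apply pow_nonzero; lra).
  assert (Hh : h n = h (S n) + h (S n)) by (unfold h; simpl; field; apply pow_nonzero; lra).
  assert (Pw : 0 <= w (S n)) by (unfold w; apply Rdiv_le_0_compat; [lra|apply pow_lt; lra]).
  assert (Ph : 0 <= h (S n)) by (unfold h; apply Rdiv_le_0_compat; [lra|apply pow_lt; lra]).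
  set (w' := w (S n)) in *. set (h' := h (S n)) in *. rewrite Hw, Hh in *.
  rewrite (box_int_split t (t + w') (t + (w' + w')) s (s + h') (s + (h' + h'))) in H5 by lra.
  set (B := eps * (w' + h') ^ 2).
  replace (eps * (w' + w' + (h' + h')) ^ 2) with (4 * B) in H5 by (unfold B; ring).
  replace (t + (w' + w')) with (t + w' + w') in H5 by ring.
  replace (s + (h' + h')) with (s + h' + h') in H5 by ring.
  destruct (Rlt_dec B (Rabs (box_int P Q t (t + w') s (s + h')))) as [K1|K1];
    [exists (t, s); simpl; repeat split; try lra; exact K1|].
  destruct (Rlt_dec B (Rabs (box_int P Q (t + w') (t + w' + w') s (s + h')))) as [K2|K2];
    [exists (t + w', s); simpl; repeat split; try lra; exact K2|].
  destruct (Rlt_dec B (Rabs (box_int P Q t (t + w') (s + h') (s + h' + h')))) as [K3|K3];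
    [exists (t, s + h'); simpl; repeat split; try lra; exact K3|].
  destruct (Rlt_dec B (Rabs (box_int P Q (t + w') (t + w' + w') (s + h') (s + h' + h')))) as [K4|K4];
    [exists (t + w', s + h'); simpl; repeat split; try lra; exact K4|].
  exfalso.
  match type of H5 with _ < Rabs (?x + ?y + ?z + ?u) =>
    pose proof (Rabs_triang (x + y + z) u); pose proof (Rabs_triang (x + y) z); pose proof (Rabs_triang x y) end.
  lra.
Qed.

Theorem goursat_box : a <= b -> c <= d -> box_int P Q a b c d = 0.
Proof.
  intros Hab Hcd. destruct (Req_dec (box_int P Q a b c d) 0) as [|Hn]; auto. exfalso.
  (* A box shrunk to a point has integral 0; otherwise its size is positive and may be divided
     by. *)
  assert (HS : 0 < (b - a + (d - c)) ^ 2).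
  { destruct (Req_dec (b - a + (d - c)) 0) as [H0|H0].
    - exfalso. apply Hn. unfold box_int. assert (b = a) by lra. assert (d = c) by lra. subst.
      rewrite !RInt_point. unfold zero; simpl. ring.
    - apply pow2_gt_0; auto. }
  (* With this [eps] the threshold of the whole box is half of its integral in absolute value, which
     makes it bad at level 0. *)
  set (eps := Rabs (box_int P Q a b c d) / 2 / (b - a + (d - c)) ^ 2).
  assert (He : 0 < eps).
  { unfold eps. apply Rdiv_lt_0_compat; auto. apply Rdiv_lt_0_compat; [|lra]. now apply Rabs_pos_lt. }
  assert (B0 : bad_box eps 0 (a, c)).
  { unfold bad_box, w, h; simpl fst; simpl snd; simpl pow. rewrite !Rdiv_1_r. repeat split; try lra.
    replace (a + (b - a)) with b by ring. replace (c + (d - c)) with d by ring.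
    unfold eps. simpl pow. field_simplify; [|nra]. pose proof (Rabs_pos_lt _ Hn). lra. }
  (* The proof of badness is carried along in the sequence, since a next box is only available for a
     bad one. *)
  pose (next := fun n (p : {p | bad_box eps n p}) =>
    constructive_indefinite_description _ (bad_box_quarter eps n (proj1_sig p) Hab Hcd (proj2_sig p))).
  pose (u := fix u n : {p | bad_box eps n p} := match n with
     | O => exist _ (a, c) B0
     | S m => exist _ (proj1_sig (next m (u m))) (proj1 (proj2_sig (next m (u m)))) end).
  pose (T := fun n => fst (proj1_sig (u n))). pose (S' := fun n => snd (proj1_sig (u n))).
  assert (HT : forall n, T n <= T (S n) /\ T (S n) + w (S n) <= T n + w n /\ S' n <= S' (S n) /\ S' (S n) + h (S n) <= S' n + h n).
  { intros n. unfold T, S'. simpl u. simpl proj1_sig. destruct (proj2_sig (next n (u n))) as [_ HH]. repeat split; apply HH. }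
  assert (Pw : forall n, 0 <= w n) by (intros; unfold w; apply Rdiv_le_0_compat; [lra|apply pow_lt; lra]).
  assert (Ph : forall n, 0 <= h n) by (intros; unfold h; apply Rdiv_le_0_compat; [lra|apply pow_lt; lra]).
  assert (HB : forall n, bad_box eps n (T n, S' n)).
  { intros n. pose proof (proj2_sig (u n)) as HH. unfold T, S'. destruct (proj1_sig (u n)); exact HH. }
  destruct (nested_limit T w (b - a)) as [t Ht]; try (intros n; apply HT); try lra; auto.
  destruct (nested_limit S' h (d - c)) as [s Hs]; try (intros n; apply HT); try lra; auto.
  clearbody T S'. clear u next.
  assert (Ht0 : a <= t <= b).
  { specialize (Ht 0%nat). destruct (HB 0%nat) as [H1 [H2 _]]. simpl in *. lra. }
  assert (Hs0 : c <= s <= d).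
  { specialize (Hs 0%nat). destruct (HB 0%nat) as [_ [_ [H1 [H2 _]]]]. simpl in *. lra. }
  (* The boxes shrink to (t, s), where differentiability gives the estimate that contradicts
     badness. *)
  destruct (box_int_small t s eps Ht0 Hs0 He) as [dl [Hdl HH]].
  destruct (pow2_div_lt (b - a + (d - c)) dl Hdl) as [n Hn'].
  assert (Ew : w n + h n < dl) by (unfold w, h; rewrite <- Rdiv_plus_distr; exact Hn').
  specialize (Ht n). specialize (Hs n). destruct (HB n) as [H1 [H2 [H3 [H4 H5]]]]. simpl in H1, H2, H3, H4, H5.
  specialize (Pw n). specialize (Ph n).
  specialize (HH (T n) (T n + w n) (S' n) (S' n + h n) H1 Ht H2 H3 Hs H4 ltac:(lra) ltac:(lra)).
  replace (T n + w n - T n + (S' n + h n - S' n)) with (w n + h n) in HH by ring.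
  simpl in HH. lra.
Qed.
End Goursat.

Local Open Scope C_scope.

(** * Cauchy's formula *)

(** A plain integral over the angle, taken componentwise. The differential of a contour integral, i
    w dx on w = r e^(ix), has to be written into the integrand. *)
Definition circ_int (h : R -> C) : C :=
  (RInt (fun x => fst (h x)) 0 (2 * PI), RInt (fun x => snd (h x)) 0 (2 * PI)).

Definition circ_continuous (h : R -> C) : Prop := forall x : R, (0 <= x <= 2 * PI)%R -> continuous h x.

Lemma two_PI_pos : (0 < 2 * PI)%R.
Proof. pose proof PI_RGT_0. lra. Qed.

Lemma continuous_C_fst (h : R -> C) x : continuous h x -> continuous (fun y => fst (h y)) x.
Proof.
  intros H. apply (continuous_comp (V := prod_UniformSpace R_UniformSpace R_UniformSpace) h fst); auto.
  apply continuous_fst.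
Qed.

Lemma continuous_C_snd (h : R -> C) x : continuous h x -> continuous (fun y => snd (h y)) x.
Proof.
  intros H. apply (continuous_comp (V := prod_UniformSpace R_UniformSpace R_UniformSpace) h snd); auto.
  apply continuous_snd.
Qed.

Lemma circ_continuous_scal (c : C) h : circ_continuous h -> circ_continuous (fun x => c * h x).
Proof. intros Hh x Hx. apply (continuous_scal_r (K := C_AbsRing) (V := CN) c); auto. Qed.

Lemma circ_continuous_plus h1 h2 : circ_continuous h1 -> circ_continuous h2 ->
  circ_continuous (fun x => h1 x + h2 x).
Proof. intros H1 H2 x Hx. apply (continuous_plus (K := C_AbsRing) (V := CN)); auto. Qed.

#[local] Hint Resolve circ_continuous_scal circ_continuous_plus : core.

Lemma ex_RInt_circ_fst h : circ_continuous h -> ex_RInt (fun x => fst (h x)) 0 (2 * PI).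
Proof.
  intros H. pose proof two_PI_pos. apply (ex_RInt_continuous (V := R_CompleteNormedModule)).
  intros x. rewrite Rmin_left, Rmax_right by lra. intros Hx. apply continuous_C_fst; auto.
Qed.

Lemma ex_RInt_circ_snd h : circ_continuous h -> ex_RInt (fun x => snd (h x)) 0 (2 * PI).
Proof.
  intros H. pose proof two_PI_pos. apply (ex_RInt_continuous (V := R_CompleteNormedModule)).
  intros x. rewrite Rmin_left, Rmax_right by lra. intros Hx. apply continuous_C_snd; auto.
Qed.

Lemma circ_int_ext (h1 h2 : R -> C) : (forall x : R, (0 <= x <= 2 * PI)%R -> h1 x = h2 x) ->
  circ_int h1 = circ_int h2.
Proof.
  intros H. pose proof two_PI_pos. unfold circ_int.
  f_equal; apply RInt_ext; intros x; rewrite Rmin_left, Rmax_right by lra; intros Hx; rewrite H; auto; lra.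
Qed.

Lemma circ_int_const (c : C) : circ_int (fun _ => c) = RtoC (2 * PI) * c.
Proof.
  unfold circ_int. rewrite !RInt_const. unfold scal; simpl; unfold mult; simpl.
  apply injective_projections; simpl; ring.
Qed.

Lemma circ_int_plus h1 h2 : circ_continuous h1 -> circ_continuous h2 ->
  circ_int (fun x => h1 x + h2 x) = circ_int h1 + circ_int h2.
Proof.
  intros H1 H2. apply injective_projections; simpl.
  - exact (RInt_plus (V := R_CompleteNormedModule) _ _ _ _ (ex_RInt_circ_fst _ H1) (ex_RInt_circ_fst _ H2)).
  - exact (RInt_plus (V := R_CompleteNormedModule) _ _ _ _ (ex_RInt_circ_snd _ H1) (ex_RInt_circ_snd _ H2)).
Qed.

Lemma circ_int_scal (c : C) h : circ_continuous h ->
  circ_int (fun x => c * h x) = c * circ_int h.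
Proof.
  intros H. pose proof (ex_RInt_circ_fst _ H) as E1. pose proof (ex_RInt_circ_snd _ H) as E2.
  destruct c as [u v].
  pose proof (fun l => ex_RInt_scal (V := R_NormedModule) _ _ _ l E1) as S1.
  pose proof (fun l => ex_RInt_scal (V := R_NormedModule) _ _ _ l E2) as S2.
  apply injective_projections; unfold circ_int; simpl.
  - etransitivity; [exact (RInt_minus (V := R_CompleteNormedModule) _ _ _ _ (S1 u) (S2 v))|].
    exact (f_equal2 Rminus (RInt_scal (V := R_CompleteNormedModule) _ _ _ u E1)
      (RInt_scal (V := R_CompleteNormedModule) _ _ _ v E2)).
  - etransitivity; [exact (RInt_plus (V := R_CompleteNormedModule) _ _ _ _ (S2 u) (S1 v))|].
    exact (f_equal2 Rplus (RInt_scal (V := R_CompleteNormedModule) _ _ _ u E2)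
      (RInt_scal (V := R_CompleteNormedModule) _ _ _ v E1)).
Qed.

Lemma Cmod_le_parts (x : C) : (Cmod x <= Rabs (fst x) + Rabs (snd x))%R.
Proof.
  unfold Cmod. rewrite <- (sqrt_Rsqr (Rabs (fst x) + Rabs (snd x))).
  - apply sqrt_le_1_alt. unfold Rsqr. rewrite <- (pow2_abs (fst x)), <- (pow2_abs (snd x)).
    pose proof (Rabs_pos (fst x)). pose proof (Rabs_pos (snd x)). nra.
  - pose proof (Rabs_pos (fst x)). pose proof (Rabs_pos (snd x)). lra.
Qed.

Lemma Rabs_fst_le_Cmod (x : C) : (Rabs (fst x) <= Cmod x)%R.
Proof. eapply Rle_trans; [apply Rmax_l|apply Rmax_Cmod]. Qed.

Lemma Rabs_snd_le_Cmod (x : C) : (Rabs (snd x) <= Cmod x)%R.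
Proof. eapply Rle_trans; [apply Rmax_r|apply Rmax_Cmod]. Qed.

(** The constant is 4 PI and not 2 PI because real and imaginary parts are bounded separately; this
    accounts for the additional factors 2 in the Cauchy estimates. *)
Lemma circ_int_bound h (M : R) : circ_continuous h ->
  (forall x : R, (0 <= x <= 2 * PI)%R -> (Cmod (h x) <= M)%R) ->
  (Cmod (circ_int h) <= 4 * PI * M)%R.
Proof.
  intros H HM. pose proof two_PI_pos as HP. eapply Rle_trans; [apply Cmod_le_parts|]. simpl.
  assert (E1 : (Rabs (RInt (fun x => fst (h x)) 0 (2 * PI)) <= (2 * PI - 0) * M)%R).
  { apply abs_RInt_le_const; [lra|now apply ex_RInt_circ_fst|].
    intros t Ht. eapply Rle_trans; [apply Rabs_fst_le_Cmod|auto]. }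
  assert (E2 : (Rabs (RInt (fun x => snd (h x)) 0 (2 * PI)) <= (2 * PI - 0) * M)%R).
  { apply abs_RInt_le_const; [lra|now apply ex_RInt_circ_snd|].
    intros t Ht. eapply Rle_trans; [apply Rabs_snd_le_Cmod|auto]. }
  lra.
Qed.

Lemma approx_id (w : C) : approx_linear (U := CN) (fun y : C => y) w (fun v => 1 * v).
Proof.
  split.
  - exists 1%R; split; [lra|]. intros v. rewrite Cmod_mult, Cmod_1. change (norm v) with (Cmod v). lra.
  - intros eps Heps. exists 1%R. split; [lra|]. intros v _. change (plus w v) with (w + v).
    replace (w + v - w - 1 * v) with (RtoC 0) by ring.
    rewrite Cmod_0. apply Rmult_le_pos; [lra|apply norm_ge_0].
Qed.

Definition cis (x : R) : C := (cos x, sin x).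

Lemma Cmod_cis x : Cmod (cis x) = 1%R.
Proof.
  unfold Cmod, cis; simpl fst; simpl snd.
  replace (cos x ^ 2 + sin x ^ 2)%R with 1%R; [apply sqrt_1|].
  pose proof (sin2_cos2 x). unfold Rsqr in H. lra.
Qed.

Lemma cis_neq_0 x : cis x <> 0.
Proof. apply Cmod_gt_0. rewrite Cmod_cis. lra. Qed.

Lemma cis_2PI : cis (2 * PI) = cis 0.
Proof. unfold cis. now rewrite cos_2PI, sin_2PI, cos_0, sin_0. Qed.

Lemma is_derive_eps (f : R -> R) x l : is_derive f x l ->
  forall eps : R, (0 < eps)%R -> exists d : R, (0 < d)%R /\ forall y : R, (Rabs y < d)%R ->
   (Rabs (f (x + y) - f x - l * y) <= eps * Rabs y)%R.
Proof.
  intros [_ H] eps He. destruct (H x (fun P H => H) (mkposreal eps He)) as [d Hd].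
  exists d. split; [apply cond_pos|]. intros y Hy. specialize (Hd (x + y)%R).
  unfold minus, plus, opp, scal, norm, abs, ball in Hd; simpl in Hd. unfold AbsRing_ball, abs, minus, plus, opp, mult in Hd; simpl in Hd.
  replace (x + y + - x)%R with y in Hd by ring.
  specialize (Hd Hy). replace (f (x + y) - f x - l * y)%R with (f (x + y) + - f x + - (y * l))%R by ring. exact Hd.
Qed.

Section Plane.
Let V := prod_NormedModule R_AbsRing R_NormedModule R_NormedModule.

Lemma norm_plane_fst (v : V) : (Rabs (fst v) <= norm v)%R.
Proof. exact (norm_le_prod_norm_1 (K := R_AbsRing) (U := R_NormedModule) (V := R_NormedModule) v). Qed.

Lemma norm_plane_snd (v : V) : (Rabs (snd v) <= norm v)%R.
Proof. exact (norm_le_prod_norm_2 (K := R_AbsRing) (U := R_NormedModule) (V := R_NormedModule) v). Qed.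

Lemma norm_plane_le (v : V) : (norm v <= Rabs (fst v) + Rabs (snd v))%R.
Proof.
  change (sqrt (Rabs (fst v) ^ 2 + Rabs (snd v) ^ 2) <= Rabs (fst v) + Rabs (snd v))%R.
  pose proof (Rabs_pos (fst v)). pose proof (Rabs_pos (snd v)).
  rewrite <- (sqrt_Rsqr (Rabs (fst v) + Rabs (snd v))) by lra.
  apply sqrt_le_1_alt. unfold Rsqr. nra.
Qed.

Lemma approx_plane_fst (p : V) : approx_linear (fun q : V => RtoC (fst q)) p (fun v => RtoC (fst v)).
Proof.
  split.
  - exists 1%R. split; [lra|]. intros v. rewrite Cmod_R. pose proof (norm_plane_fst v). lra.
  - intros eps He. exists 1%R. split; [lra|]. intros v _.
    change (fst (plus p v)) with (fst p + fst v)%R. rewrite RtoC_plus.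
    match goal with |- (Cmod ?X <= _)%R => replace X with (RtoC 0) by ring end.
    rewrite Cmod_0. apply Rmult_le_pos; [lra|apply norm_ge_0].
Qed.

Lemma approx_plane_cis (p : V) :
  approx_linear (fun q : V => cis (snd q)) p (fun v => Ci * cis (snd p) * RtoC (snd v)).
Proof.
  split.
  - exists 1%R. split; [lra|]. intros v. rewrite !Cmod_mult, Cmod_Ci, Cmod_cis, Cmod_R.
    pose proof (norm_plane_snd v). lra.
  - intros eps He. pose (s := snd p : R). change (snd p) with s.
    destruct (is_derive_eps cos s (- sin s)%R (is_derive_cos s) (eps / 2)%R) as [d1 [Hd1 H1]]; [lra|].
    destruct (is_derive_eps sin s (cos s) (is_derive_sin s) (eps / 2)%R) as [d2 [Hd2 H2]]; [lra|].
    exists (Rmin d1 d2). split; [now apply Rmin_pos|]. intros v Hv. split_Rmin.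
    pose proof (norm_plane_snd v) as Hn.
    destruct v as [x y]. change (Rabs y <= norm ((x, y) : V))%R in Hn.
    specialize (H1 y ltac:(lra)). specialize (H2 y ltac:(lra)).
    change (snd (plus p ((x, y) : V))) with (s + y)%R. change (snd (x, y)) with y.
    eapply Rle_trans; [apply Cmod_le_parts|]. unfold cis, Ci; simpl.
    
    match goal with |- (Rabs ?X + Rabs ?Y <= _)%R =>
      replace X with (cos (s + y) - cos s - - sin s * y)%R by ring;
      replace Y with (sin (s + y) - sin s - cos s * y)%R by ring end.
    apply (Rmult_le_compat_l eps) in Hn; [|lra]. eapply Rle_trans; [|exact Hn]. lra.
Qed.

Lemma approx_plane_diff2 (P : R -> R -> C) t s (A B : C) :
  approx_linear (fun q : V => P (fst q) (snd q)) (t, s) (fun v => A * RtoC (fst v) + B * RtoC (snd v)) ->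
  diff2_at (fun t s => fst (P t s)) t s (fst A) (fst B) /\
  diff2_at (fun t s => snd (P t s)) t s (snd A) (snd B).
Proof.
  intros [_ H].
  assert (K : forall eps : R, (0 < eps)%R -> exists d : R, (0 < d)%R /\ forall t' s' : R,
     (Rabs (t' - t) < d)%R -> (Rabs (s' - s) < d)%R ->
     (Cmod (P t' s' - P t s - (A * RtoC (t' - t) + B * RtoC (s' - s)))
         <= eps * (Rabs (t' - t) + Rabs (s' - s)))%R).
  (* The plane carries the Euclidean norm, which is at most the sum of the two distances; hence the
     halved radius. *)
  { intros eps He. destruct (H eps He) as [d [Hd Hf]]. exists (d / 2)%R. split; [lra|]. intros t' s' H1 H2.
    pose proof (norm_plane_le ((t' - t, s' - s)%R : V)) as Hn. simpl fst in Hn; simpl snd in Hn.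
    specialize (Hf (t' - t, s' - s)%R ltac:(lra)).
    change (fst (plus (t, s) ((t' - t)%R, (s' - s)%R))) with (t + (t' - t))%R in Hf.
    change (snd (plus (t, s) ((t' - t)%R, (s' - s)%R))) with (s + (s' - s))%R in Hf.
    simpl fst in Hf; simpl snd in Hf.
    replace (t + (t' - t))%R with t' in Hf by ring. replace (s + (s' - s))%R with s' in Hf by ring.
    eapply Rle_trans; [exact Hf|]. apply Rmult_le_compat_l; lra. }
  split; intros eps He; destruct (K eps He) as [d [Hd Hf]]; exists d; split; auto; intros t' s' H1 H2;
    specialize (Hf t' s' H1 H2).
  - eapply Rle_trans; [|exact Hf]. eapply Rle_trans; [|apply Rabs_fst_le_Cmod]. right; f_equal. simpl. ring.
  - eapply Rle_trans; [|exact Hf]. eapply Rle_trans; [|apply Rabs_snd_le_Cmod]. right; f_equal. simpl. ring.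
Qed.

(** The sides s = 0 and s = 2 PI carry Q dt and cancel by periodicity, so the integrals of [P] over
    t = 0 and t = 1 agree. *)
Lemma goursat_periodic (P Q : R -> R -> C) :
  (forall t s : R, (0 <= t <= 1)%R -> (0 <= s <= 2 * PI)%R -> exists A B E : C,
     approx_linear (fun q : V => P (fst q) (snd q)) (t, s) (fun v => A * RtoC (fst v) + B * RtoC (snd v)) /\
     approx_linear (fun q : V => Q (fst q) (snd q)) (t, s) (fun v => E * RtoC (fst v) + A * RtoC (snd v))) ->
  (forall t, Q t (2 * PI)%R = Q t 0%R) ->
  circ_int (P 1%R) = circ_int (P 0%R).
Proof.
  intros H Hper. pose proof two_PI_pos as HP.
  assert (G1 : box_int (fun t s => fst (P t s)) (fun t s => fst (Q t s)) 0 1 0 (2 * PI) = 0%R).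
  { apply goursat_box; try lra. intros t s Ht Hs. destruct (H t s Ht Hs) as [A [B [E [H1 H2]]]].
    exists (fst A), (fst B), (fst E). split; [apply (approx_plane_diff2 P)|apply (approx_plane_diff2 Q)]; auto. }
  assert (G2 : box_int (fun t s => snd (P t s)) (fun t s => snd (Q t s)) 0 1 0 (2 * PI) = 0%R).
  { apply goursat_box; try lra. intros t s Ht Hs. destruct (H t s Ht Hs) as [A [B [E [H1 H2]]]].
    exists (snd A), (snd B), (snd E). split; [apply (approx_plane_diff2 P)|apply (approx_plane_diff2 Q)]; auto. }
  unfold box_int in G1, G2.
  rewrite (RInt_ext (fun t => fst (Q t (2 * PI)%R)) (fun t => fst (Q t 0%R))) in G1 by (intros; now rewrite Hper).
  rewrite (RInt_ext (fun t => snd (Q t (2 * PI)%R)) (fun t => snd (Q t 0%R))) in G2 by (intros; now rewrite Hper).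
  unfold circ_int. f_equal; lra.
Qed.

(* The circle of radius [e] about [z] is moved affinely to the circle of radius
   [r] about the origin, staying in the closed disc and avoiding [z]. *)
Lemma cauchy_homotopy (f : C -> C) (r e : R) (z : C) :
  (0 < e)%R -> (Cmod z + e <= r)%R ->
  (forall w, (Cmod w <= r)%R -> exists a, approx_linear (U := CN) f w (fun v => a * v)) ->
  circ_int (fun x => Ci * (f (r * cis x) * (r * cis x) * / (r * cis x - z)))
  = circ_int (fun x => Ci * f (z + e * cis x)).
Proof.
  intros He Hr Hf. pose proof (Cmod_ge_0 z) as Pz.
  (* [ct] and [cs] are the partial derivatives of [cc]. The pullback of g dw is closed because the
     t-derivative of [g (cc t s) * cs t s] and the s-derivative of [g (cc t s) * ct t s] contain the
     same mixed derivative of [cc]. *)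
  pose (cc := fun t s : R => (1 - t) * z + (e + t * (r - e)) * cis s).
  pose (ct := fun t s : R => (r - e) * cis s - z).
  pose (cs := fun t s : R => Ci * ((e + t * (r - e)) * cis s)).
  pose (g := fun w => f w * / (w - z)).
  assert (Hin : forall t s : R, (0 <= t <= 1)%R -> (Cmod (cc t s) <= r)%R).
  { intros t s Ht. unfold cc. eapply Rle_trans; [apply Cmod_triangle|].
    rewrite !Cmod_mult, Cmod_cis. rewrite <- !RtoC_minus, <- RtoC_mult, <- RtoC_plus, !Cmod_R.
    rewrite !Rabs_pos_eq by nra. nra. }
  (* The modulus is at least e + t (r - e) - t |z| = (1 - t) e + t (r - |z|), and r - |z| >= e. *)
  assert (Hne : forall t s : R, (0 <= t <= 1)%R -> cc t s - z <> 0).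
  { intros t s Ht. unfold cc.
    replace ((1 - t) * z + (e + t * (r - e)) * cis s - z) with ((e + t * (r - e)) * cis s - t * z) by ring.
    apply Cmod_gt_0. eapply Rlt_le_trans; [|apply Cmod_minus_ge]. rewrite !Cmod_mult, Cmod_cis.
    rewrite <- RtoC_minus, <- RtoC_mult, <- RtoC_plus, !Cmod_R. rewrite !Rabs_pos_eq by nra.
    destruct (Rle_dec t (1/2)); nra. }
  assert (Hg : forall t s : R, (0 <= t <= 1)%R -> exists a, approx_linear (U := CN) g (cc t s) (fun v => a * v)).
  { intros t s Ht. destruct (Hf (cc t s) (Hin t s Ht)) as [a Ha].
    pose proof (approx_plus (U := CN) _ _ _ _ _ (approx_id (cc t s))
      (approx_const (U := CN) (- z) (cc t s))) as I1.
    pose proof (approx_comp (U := CN) _ Cinv _ _ _ I1 (approx_inv _ (Hne t s Ht))) as I2.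
    pose proof (approx_mult (U := CN) _ _ _ _ _ Ha I2) as I3.
    eexists. eapply approx_ext_lin; [|exact I3]. intros v. cbv beta. 
    instantiate (1 := a * / (cc t s - z) + f (cc t s) * (- (/ (cc t s - z) * / (cc t s - z)))).
    unfold Cminus. ring. }
  assert (Acc : forall t s : R, approx_linear (fun q : V => cc (fst q) (snd q)) (t, s)
     (fun v => ct t s * RtoC (fst v) + cs t s * RtoC (snd v))).
  { intros t s. pose proof (approx_plane_fst (t, s)) as A1. pose proof (approx_plane_cis (t, s)) as A2.
    pose proof (approx_plus _ _ _ _ _ (approx_const (U := V) (RtoC e) (t,s)) (approx_mult _ _ _ _ _ A1 (approx_const (U := V) (r - e) (t,s)))) as A3.
    pose proof (approx_mult _ _ _ _ _ A3 A2) as A4.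
    pose proof (approx_plus _ _ _ _ _ (approx_const (U := V) (RtoC 1) (t,s)) (approx_mult _ _ _ _ _ (approx_const (U := V) (Copp (RtoC 1)) (t,s)) A1)) as A5.
    pose proof (approx_plus _ _ _ _ _ (approx_mult _ _ _ _ _ A5 (approx_const (U := V) z (t,s))) A4) as A6.
    eapply approx_ext_lin; [|eapply approx_ext; [|exact A6]].
    - intros [x y]. unfold ct, cs. cbn [fst snd]. ring.
    - intros q. unfold cc. ring. }
  assert (Act : forall t s : R, approx_linear (fun q : V => ct (fst q) (snd q)) (t, s)
     (fun v => 0 * RtoC (fst v) + (Ci * ((r - e) * cis s)) * RtoC (snd v))).
  { intros t s. pose proof (approx_plane_cis (t, s)) as A2.
    pose proof (approx_plus _ _ _ _ _ (approx_mult _ _ _ _ _ (approx_const (U := V) (r - e) (t,s)) A2) (approx_const (U := V) (- z) (t,s))) as A3.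
    eapply approx_ext_lin; [|eapply approx_ext; [|exact A3]].
    - intros [x y]. cbn [fst snd]. ring.
    - intros q. unfold ct. ring. }
  assert (Acs : forall t s : R, approx_linear (fun q : V => cs (fst q) (snd q)) (t, s)
     (fun v => (Ci * ((r - e) * cis s)) * RtoC (fst v) + (Ci * cs t s) * RtoC (snd v))).
  { intros t s. pose proof (approx_plane_fst (t, s)) as A1. pose proof (approx_plane_cis (t, s)) as A2.
    pose proof (approx_plus _ _ _ _ _ (approx_const (U := V) (RtoC e) (t,s)) (approx_mult _ _ _ _ _ A1 (approx_const (U := V) (r - e) (t,s)))) as A3.
    pose proof (approx_mult _ _ _ _ _ (approx_const (U := V) Ci (t,s)) (approx_mult _ _ _ _ _ A3 A2)) as A4.
    eapply approx_ext_lin; [|eapply approx_ext; [|exact A4]].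
    - intros [x y]. unfold cs. cbn [fst snd]. ring.
    - intros q. reflexivity. }
  pose proof (goursat_periodic (fun t s => g (cc t s) * cs t s) (fun t s => g (cc t s) * ct t s)) as GP.
  transitivity (circ_int (fun s => g (cc 1%R s) * cs 1%R s)); [|transitivity (circ_int (fun s => g (cc 0%R s) * cs 0%R s))].
  - apply circ_int_ext. intros x _. unfold g, cc, cs.
    replace ((1 - 1) * z + (e + 1 * (r - e)) * cis x) with (r * cis x) by ring.
    replace (e + 1 * (r - e)) with (RtoC r) by ring. ring.
  - apply GP.
    + intros t s Ht _. destruct (Hg t s Ht) as [a Ha].
      pose proof (approx_comp (fun q : V => cc (fst q) (snd q)) g (t, s) _ _ (Acc t s) Ha) as B1.
      pose proof (approx_mult _ _ _ _ _ B1 (Acs t s)) as B2.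
      pose proof (approx_mult _ _ _ _ _ B1 (Act t s)) as B3.
      exists (a * ct t s * cs t s + g (cc t s) * (Ci * ((r - e) * cis s))),
             (a * cs t s * cs t s + g (cc t s) * (Ci * cs t s)),
             (a * ct t s * ct t s).
      split; [eapply approx_ext_lin; [|exact B2]|eapply approx_ext_lin; [|exact B3]];
        intros [x y]; cbn [fst snd]; ring.
    + intros t. unfold cc, ct. now rewrite cis_2PI.
  - apply circ_int_ext. intros x _. unfold g.
    assert (E : cc 0%R x = z + e * cis x) by (unfold cc; ring). 
    assert (E2 : cc 0%R x - z = e * cis x) by (unfold cc; ring). rewrite E2, E.
    unfold cs. field. split; [apply cis_neq_0|]. intros E0. apply RtoC_inj in E0. lra.
Qed.
End Plane.

Lemma approx_cis (x : R) :
  approx_linear (U := R_NormedModule) cis x (fun v => Ci * cis x * RtoC v).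
Proof.
  split.
  - exists 1%R. split; [lra|]. intros v. rewrite !Cmod_mult, Cmod_Ci, Cmod_cis, Cmod_R.
    change (norm v) with (Rabs v). lra.
  - intros eps He.
    destruct (proj2 (approx_plane_cis (0%R, x)) eps He) as [d [Hd H]]. exists d. split; auto.
    intros v Hv. change (norm v) with (Rabs v) in *.
    assert (Hn : (norm ((0%R, v) : prod_NormedModule R_AbsRing R_NormedModule R_NormedModule) <= Rabs v)%R).
    { eapply Rle_trans; [apply norm_plane_le|]. simpl. rewrite Rabs_R0. lra. }
    specialize (H (0%R, v) ltac:(lra)).
    eapply Rle_trans; [exact H|]. apply Rmult_le_compat_l; lra.
Qed.

Lemma approx_circ_comp (f : C -> C) (r : R) (z : C) x a :
  approx_linear (U := CN) f (z + r * cis x) (fun v => a * v) ->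
  exists l, approx_linear (U := R_NormedModule) (fun x => f (z + r * cis x)) x l.
Proof.
  intros Ha.
  pose proof (approx_plus (U := R_NormedModule) _ _ _ _ _ (approx_const z x) (approx_mult (U := R_NormedModule) _ _ _ _ _ (approx_const (RtoC r) x) (approx_cis x))) as A1.
  eexists. exact (approx_comp _ _ _ _ _ A1 Ha).
Qed.

Lemma circ_continuous_comp (f : C -> C) (r : R) (z : C) :
  (forall x : R, (0 <= x <= 2 * PI)%R -> exists a, approx_linear (U := CN) f (z + r * cis x) (fun v => a * v)) ->
  circ_continuous (fun x => f (z + r * cis x)).
Proof.
  intros H x Hx. destruct (H x Hx) as [a Ha]. destruct (approx_circ_comp _ _ _ _ _ Ha) as [l Hl].
  exact (approx_continuous (U := R_NormedModule) _ _ _ Hl).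
Qed.

Lemma circ_continuous_const (c : C) : circ_continuous (fun _ => c).
Proof. intros x _. apply continuous_const. Qed.

(** With dw = i w dx the integrand is f(w) dw / (w - z). The homotopy replaces the circle by a small
    one about [z], on which [f] is within [eps] of [f z]; so the two sides differ by at most 4 PI
    eps for every positive [eps]. *)
Theorem cauchy_formula (f : C -> C) (r : R) (z : C) :
  (Cmod z < r)%R ->
  (forall w, (Cmod w <= r)%R -> exists a, approx_linear (U := CN) f w (fun v => a * v)) ->
  circ_int (fun x => Ci * (f (r * cis x) * (r * cis x) * / (r * cis x - z))) = Ci * (RtoC (2 * PI) * f z).
Proof.
  intros Hz Hf. set (I := circ_int _).
  assert (K : forall eps : R, (0 < eps)%R -> (Cmod (I - Ci * (RtoC (2 * PI) * f z)) <= 4 * PI * eps)%R).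
  { intros eps He. destruct (Hf z ltac:(lra)) as [a Ha].
    destruct (approx_continuous_eps (U := CN) _ _ _ Ha eps He) as [d [Hd Hfd]].
    set (e := Rmin (d / 2) (r - Cmod z)).
    assert (He0 : (0 < e)%R) by (apply Rmin_pos; lra).
    assert (He1 : (e <= d / 2)%R) by apply Rmin_l.
    assert (He2 : (e <= r - Cmod z)%R) by apply Rmin_r.
    unfold I. rewrite (cauchy_homotopy f r e z He0 ltac:(lra) Hf).
    replace (Ci * (RtoC (2 * PI) * f z)) with (circ_int (fun _ => Ci * f z)) by (rewrite circ_int_const; ring).
    assert (Hc : circ_continuous (fun x => Ci * f (z + e * cis x))).
    { apply (circ_continuous_comp (fun w => Ci * f w) e z). intros x _.
      destruct (Hf (z + e * cis x)) as [b Hb].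
      { eapply Rle_trans; [apply Cmod_triangle|]. rewrite Cmod_mult, Cmod_cis, Cmod_R, Rabs_pos_eq by lra. lra. }
      exists (Ci * b). eapply approx_ext_lin; [|exact (approx_mult (U := CN) _ _ _ _ _ (approx_const Ci _) Hb)].
      intros v. simpl. ring. }
    replace (circ_int (fun x => Ci * f (z + e * cis x)) - circ_int (fun _ => Ci * f z))
      with (circ_int (fun x => Ci * f (z + e * cis x)) + circ_int (fun _ => - (Ci * f z))) by (rewrite !circ_int_const; ring).
    rewrite <- circ_int_plus by (auto using circ_continuous_const).
    apply circ_int_bound.
    - intros x Hx. apply (continuous_plus (K := C_AbsRing) (V := CN)); [apply Hc; auto|apply continuous_const].
    - intros x Hx. replace (Ci * f (z + e * cis x) + - (Ci * f z)) with (Ci * (f (z + e * cis x) - f z)) by ring.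
      rewrite Cmod_mult, Cmod_Ci, Rmult_1_l. left. apply (Hfd (e * cis x)).
      change (Cmod (e * cis x) < d)%R. rewrite Cmod_mult, Cmod_cis, Cmod_R, Rabs_pos_eq by lra. lra. }
  set (X := I - Ci * (RtoC (2 * PI) * f z)) in *.
  assert (HX : X = 0).
  { apply Cmod_eq_0. destruct (Rle_lt_or_eq_dec 0 (Cmod X) (Cmod_ge_0 X)) as [H|H]; auto.
    pose proof PI_RGT_0. specialize (K (Cmod X / (8 * PI))%R ltac:(apply Rdiv_lt_0_compat; lra)).
    replace (4 * PI * (Cmod X / (8 * PI)))%R with (Cmod X / 2)%R in K by (field; lra). lra. }
  unfold X in HX. replace I with (X + Ci * (RtoC (2 * PI) * f z)) by (unfold X; ring). unfold X; rewrite HX. ring.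
Qed.

Definition cdiff (g : C -> C) (w : C) : Prop :=
  exists a, approx_linear (U := CN) g w (fun v => a * v).

Lemma cdiff_const c w : cdiff (fun _ => c) w.
Proof.
  exists 0. eapply approx_ext_lin; [|apply (approx_const (U := CN))].
  intros v; cbv beta. ring.
Qed.

Lemma cdiff_id w : cdiff (fun y => y) w.
Proof. exists 1. apply approx_id. Qed.

Lemma cdiff_plus f g w : cdiff f w -> cdiff g w -> cdiff (fun y => f y + g y) w.
Proof.
  intros [a Ha] [b Hb]. exists (a + b).
  eapply approx_ext_lin; [|exact (approx_plus (U := CN) _ _ _ _ _ Ha Hb)].
  intros v; cbv beta. ring.
Qed.

Lemma cdiff_mult f g w : cdiff f w -> cdiff g w -> cdiff (fun y => f y * g y) w.
Proof.
  intros [a Ha] [b Hb]. exists (a * g w + f w * b).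
  eapply approx_ext_lin; [|exact (approx_mult (U := CN) _ _ _ _ _ Ha Hb)].
  intros v; cbv beta. ring.
Qed.

Lemma cdiff_ext f g w : (forall y, f y = g y) -> cdiff f w -> cdiff g w.
Proof. intros E [a Ha]. exists a. exact (approx_ext (U := CN) _ _ _ _ E Ha). Qed.

Lemma cdiff_minus f g w : cdiff f w -> cdiff g w -> cdiff (fun y => f y - g y) w.
Proof.
  intros Hf Hg. eapply cdiff_ext; [|exact (cdiff_plus _ _ _ Hf (cdiff_mult _ _ _ (cdiff_const (- (1)) w) Hg))].
  intros y; cbv beta; ring.
Qed.

Lemma cdiff_inv (f : C -> C) (w : C) : f w <> 0 -> cdiff f w -> cdiff (fun y => / f y) w.
Proof.
  intros H0 [a Ha]. exists (- (/ f w * / f w) * a).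
  eapply approx_ext_lin; [|exact (approx_comp (U := CN) _ _ _ _ _ Ha (approx_inv _ H0))].
  intros v; cbv beta; ring.
Qed.

Lemma circ_continuous_cdiff (k : C -> C) (r : R) :
  (forall x, cdiff k (r * cis x)) -> circ_continuous (fun x => k (r * cis x)).
Proof.
  intros H. pose proof (circ_continuous_comp k r 0) as K.
  assert (E : forall x, 0 + r * cis x = r * cis x) by (intros; ring).
  intros x Hx. specialize (K (fun x _ => ltac:(rewrite E; apply H)) x Hx).
  eapply continuous_ext; [|exact K]. intros y; cbv beta. now rewrite E.
Qed.

Lemma cauchy_formula' (f : C -> C) (r : R) (z : C) : (Cmod z < r)%R ->
  (forall w, (Cmod w <= r)%R -> cdiff f w) ->
  circ_int (fun x => f (r * cis x) * (r * cis x) * / (r * cis x - z)) = RtoC (2 * PI) * f z.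
Proof.
  intros Hz Hf. pose proof (Cmod_ge_0 z) as Pz.
  assert (Hr : forall x, Cmod (r * cis x) = r) by (intros x; rewrite Cmod_mult, Cmod_cis, Cmod_R, Rabs_pos_eq; lra).
  pose proof (cauchy_formula f r z Hz Hf) as H.
  rewrite circ_int_scal in H.
  - assert (HC : forall X Y, Ci * X = Ci * Y -> X = Y).
    { intros X Y E. assert (Hi : Ci * Ci = - (1)) by (unfold Ci, Cmult, Copp; simpl; apply injective_projections; simpl; ring).
      replace X with (- (Ci * Ci) * X) by (rewrite Hi; ring). replace Y with (- (Ci * Ci) * Y) by (rewrite Hi; ring).
      replace (- (Ci * Ci) * X) with (- Ci * (Ci * X)) by ring. rewrite E. ring. }
    now apply HC.
  - apply (circ_continuous_cdiff (fun w => f w * w * / (w - z))). intros x.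
    apply cdiff_mult; [apply cdiff_mult; [apply Hf; rewrite Hr; lra|apply cdiff_id]|].
    apply cdiff_inv; [|apply cdiff_minus; [apply cdiff_id|apply cdiff_const]].
    apply Cmod_gt_0. eapply Rlt_le_trans; [|apply Cmod_minus_ge]. rewrite Hr. lra.
Qed.

(** The kernel expands as w / (w - t) = 1 + t / w + t^2 / (w (w - t)). The first two terms give
    [g 0] and the coefficient [a]; the last one is the remainder, in which |w - t| >= r / 2. *)
Lemma cauchy_taylor (g : C -> C) (r M : R) : (0 < r)%R ->
  (forall w, (Cmod w <= r)%R -> cdiff g w) ->
  (forall w, (Cmod w <= r)%R -> (Cmod (g w) <= M)%R) ->
  exists a, (Cmod a <= 2 * M / r)%R /\
    forall t, (Cmod t <= r / 2)%R -> (Cmod (g t - g 0 - a * t) <= 4 * M * Cmod t ^ 2 / r ^ 2)%R.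
Proof.
  intros Pr Hg HM. pose proof PI_RGT_0 as HPI.
  assert (Hr : forall x, Cmod (r * cis x) = r) by (intros x; rewrite Cmod_mult, Cmod_cis, Cmod_R, Rabs_pos_eq; lra).
  assert (Hn0 : forall x, r * cis x <> 0) by (intros x; apply Cmod_gt_0; rewrite Hr; auto).
  assert (HgE : forall x, cdiff g (r * cis x)) by (intros x; apply Hg; rewrite Hr; lra).
  assert (H2pi : RtoC (2 * PI) <> 0) by (intros E; apply RtoC_inj in E; lra).
  assert (HM0 : (0 <= M)%R) by (eapply Rle_trans; [apply Cmod_ge_0|apply (HM 0); rewrite Cmod_0; lra]).
  assert (Hmod : Cmod (/ RtoC (2 * PI)) = (/ (2 * PI))%R) by (rewrite Cmod_inv, Cmod_R, Rabs_pos_eq by (auto || lra); auto).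
  assert (C0 : circ_continuous (fun x => g (r * cis x))) by (apply (circ_continuous_cdiff g); auto).
  assert (C1 : circ_continuous (fun x => g (r * cis x) * / (r * cis x))).
  { apply (circ_continuous_cdiff (fun w => g w * / w)). intros x. apply cdiff_mult; auto.
    apply (cdiff_inv (fun w => w)); auto. apply cdiff_id. }
  exists (/ RtoC (2 * PI) * circ_int (fun x => g (r * cis x) * / (r * cis x))). split.
  - rewrite Cmod_mult, Hmod.
    replace (2 * M / r)%R with (/ (2 * PI) * (4 * PI * (M * / r)))%R by (field; lra).
    apply Rmult_le_compat_l; [left; apply Rinv_0_lt_compat; lra|].
    apply circ_int_bound; auto. intros x _. rewrite Cmod_mult, Cmod_inv, Hr by auto.
    apply Rmult_le_compat_r; [left; apply Rinv_0_lt_compat; lra|]. apply HM; rewrite Hr; lra.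
  - intros t Ht. pose proof (Cmod_ge_0 t) as Pt.
    assert (Hd : forall x, (r / 2 <= Cmod (r * cis x - t))%R).
    { intros x. pose proof (Cmod_minus_ge (r * cis x) t). rewrite Hr in H. lra. }
    assert (Hd0 : forall x, r * cis x - t <> 0) by (intros x; apply Cmod_gt_0; specialize (Hd x); lra).
    set (k := fun w => g w * / (w * (w - t))).
    assert (C2 : circ_continuous (fun x => k (r * cis x))).
    { apply (circ_continuous_cdiff k). intros x. unfold k. apply cdiff_mult; auto.
      apply (cdiff_inv (fun w => w * (w - t))).
      - apply Cmult_neq_0; auto.
      - apply cdiff_mult; [apply cdiff_id|]. apply cdiff_minus; [apply cdiff_id|apply cdiff_const]. }
    assert (F0 : RtoC (2 * PI) * g 0 = circ_int (fun x => g (r * cis x))).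
    { rewrite <- (cauchy_formula' g r 0); [|rewrite Cmod_0; lra|auto].
      apply circ_int_ext. intros x _. replace (r * cis x - 0) with (r * cis x) by ring.
      generalize (Hn0 x). generalize (r * cis x). intros w Hw. field. auto. }
    assert (Ft : RtoC (2 * PI) * g t = circ_int (fun x => g (r * cis x))
        + (t * circ_int (fun x => g (r * cis x) * / (r * cis x)) + t ^ 2 * circ_int (fun x => k (r * cis x)))).
    { rewrite <- !circ_int_scal by auto. rewrite <- !circ_int_plus by auto.
      rewrite <- (cauchy_formula' g r t); [|lra|auto].
      apply circ_int_ext. intros x _. unfold k. generalize (Hn0 x) (Hd0 x). generalize (r * cis x). intros w Hw Hw'. field. auto. }
    replace (g t - g 0 - / RtoC (2 * PI) * circ_int (fun x => g (r * cis x) * / (r * cis x)) * t)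
      with (/ RtoC (2 * PI) * (RtoC (2 * PI) * g t - RtoC (2 * PI) * g 0 - circ_int (fun x => g (r * cis x) * / (r * cis x)) * t))
      by (field; auto).
    rewrite Ft, F0.
    match goal with |- (Cmod (_ * ?X) <= _)%R => replace X with (t ^ 2 * circ_int (fun x => k (r * cis x))) by ring end.
    rewrite !Cmod_mult, Hmod, Cmod_pow.
    assert (B : (Cmod (circ_int (fun x => k (r * cis x)%C)) <= 4 * PI * (M * (2 / r ^ 2)))%R).
    { apply circ_int_bound; auto. intros x _. unfold k. rewrite Cmod_mult, Cmod_inv, Cmod_mult, Hr by (apply Cmult_neq_0; auto).
      apply Rmult_le_compat; [apply Cmod_ge_0| |apply HM; rewrite Hr; lra|].
      - left. apply Rinv_0_lt_compat. specialize (Hd x). apply Rmult_lt_0_compat; lra.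
      - replace (2 / r ^ 2)%R with (/ (r * (r / 2)))%R by (field; lra).
        apply Rinv_le_contravar; [apply Rmult_lt_0_compat; lra|]. apply Rmult_le_compat_l; [lra|apply Hd]. }
    replace (4 * M * Cmod t ^ 2 / r ^ 2)%R with (/ (2 * PI) * (Cmod t ^ 2 * (4 * PI * (M * (2 / r ^ 2)))))%R by (field; lra).
    apply Rmult_le_compat_l; [left; apply Rinv_0_lt_compat; lra|].
    apply Rmult_le_compat_l; [apply pow_le; lra|auto].
Qed.

Lemma filterdiff_approx {U : NormedModule C_AbsRing} (f : U -> C) (z : U) (l : U -> C) :
  diffC f z l <->
  is_linear (V := CN) l /\ approx_linear f z l.
Proof.
  split.
  - intros [Hl H]. split; auto. split.
    + exact (linear_norm (V := CN) l Hl).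
    + intros eps He. specialize (H z (fun P H => H) (mkposreal eps He)).
      apply locally_norm_le_locally in H. destruct H as [d Hd]. exists d. split; [apply cond_pos|].
      intros v Hv. specialize (Hd (plus z v)). unfold ball_norm in Hd. rewrite minus_plus_l in Hd. exact (Hd Hv).
  - intros [Hl [_ H]]. split; auto. intros x Hx.
    apply is_filter_lim_locally_unique in Hx. subst x. intros eps.
    destruct (H eps (cond_pos eps)) as [d [Hd Hf]].
    apply locally_le_locally_norm. exists (mkposreal d Hd). intros y Hy. unfold ball_norm in Hy. simpl in Hy.
    specialize (Hf (minus y z) Hy). rewrite plus_minus_r in Hf. exact Hf.
Qed.

(** * Holomorphic functions on normed modules *)

(* [ring] does not see through the canonical module structure of [C]. *)
Ltac cring :=
  repeat match goal with
  | |- context [@plus ?G ?a ?b] => change (@plus G a b) with (Cplus a b)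
  | |- context [@minus ?G ?a ?b] => change (@minus G a b) with (Cminus a b)
  | |- context [@opp ?G ?a] => change (@opp G a) with (Copp a)
  | |- context [@scal ?K ?G ?a ?b] => change (@scal K G a b) with (Cmult a b)
  | |- context [@zero ?G] => change (@zero G) with (RtoC 0)
  end;
  refine (_ : @eq C _ _); ring.

Lemma norm_scal_C {U : NormedModule C_AbsRing} (t : C) (v : U) :
  (norm (scal t v) <= Cmod t * norm v)%R.
Proof. exact (norm_scal (K := C_AbsRing) t v). Qed.

Lemma norm_minus_diag {K : AbsRing} {U : NormedModule K} (z : U) : norm (minus z z) = 0%R.
Proof. rewrite minus_eq_zero. exact norm_zero. Qed.

Definition hol {U V : NormedModule C_AbsRing} (f : U -> V) (z : U) : Prop :=
  ex_filterdiff f (locally z).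

Section HolCalculus.
Context {U : NormedModule C_AbsRing}.

Lemma filterdiff_cmult (f g : U -> C) z lf lg :
  diffC f z lf -> diffC g z lg ->
  diffC (fun y => f y * g y) z (fun v => lf v * g z + f z * lg v).
Proof.
  intros Hf Hg. apply filterdiff_approx in Hf. apply filterdiff_approx in Hg.
  destruct Hf as [Lf Af], Hg as [Lg Ag]. pose proof (approx_mult _ _ _ _ _ Af Ag) as A.
  apply filterdiff_approx. split; auto. split.
  - intros x y. rewrite (linear_plus _ Lf), (linear_plus _ Lg). 
    change (plus (lf x) (lf y)) with (lf x + lf y). change (plus (lg x) (lg y)) with (lg x + lg y).
    cring.
  - intros k x. rewrite (linear_scal _ Lf), (linear_scal _ Lg).
    change (scal k (lf x)) with (k * lf x). change (scal k (lg x)) with (k * lg x).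
    cring.
  - apply A.
Qed.

Lemma filterdiff_cinv (f : U -> C) z lf : f z <> 0 ->
  diffC f z lf ->
  diffC (fun y => / f y) z (fun v => - (/ f z * / f z) * lf v).
Proof.
  intros H0 Hf. apply filterdiff_approx in Hf. destruct Hf as [Lf Af].
  pose proof (approx_comp _ _ _ _ _ Af (approx_inv _ H0)) as A.
  apply filterdiff_approx. split; auto. split.
  - intros x y. rewrite (linear_plus _ Lf). change (plus (lf x) (lf y)) with (lf x + lf y).
    cring.
  - intros k x. rewrite (linear_scal _ Lf). change (scal k (lf x)) with (k * lf x).
    cring.
  - apply A.
Qed.

Lemma hol_const {V : NormedModule C_AbsRing} (c : V) (z : U) : hol (fun _ : U => c) z.
Proof. eexists. apply filterdiff_const. Qed.

Lemma hol_id (z : U) : hol (fun y : U => y) z.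
Proof. eexists. apply filterdiff_id. Qed.

Lemma hol_linear {V : NormedModule C_AbsRing} (l : U -> V) z : is_linear l -> hol l z.
Proof. intros H. exists l. now apply filterdiff_linear. Qed.

Lemma hol_vplus {V : NormedModule C_AbsRing} (f g : U -> V) z :
  hol f z -> hol g z -> hol (fun y => plus (f y) (g y)) z.
Proof. intros [lf Hf] [lg Hg]. eexists. now apply filterdiff_plus_fct; eassumption. Qed.

Lemma hol_vminus {V : NormedModule C_AbsRing} (f g : U -> V) z :
  hol f z -> hol g z -> hol (fun y => minus (f y) (g y)) z.
Proof. intros [lf Hf] [lg Hg]. eexists. now apply filterdiff_minus_fct; eassumption. Qed.

Lemma hol_plus (f g : U -> C) z : hol (V := CN) f z -> hol (V := CN) g z ->
  hol (V := CN) (fun y => f y + g y) z.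
Proof. apply (hol_vplus (V := CN)). Qed.

Lemma hol_minus (f g : U -> C) z : hol (V := CN) f z -> hol (V := CN) g z ->
  hol (V := CN) (fun y => f y - g y) z.
Proof. apply (hol_vminus (V := CN)). Qed.

Lemma hol_mult (f g : U -> C) z : hol (V := CN) f z -> hol (V := CN) g z ->
  hol (V := CN) (fun y => f y * g y) z.
Proof. intros [lf Hf] [lg Hg]. eexists. now apply filterdiff_cmult; eassumption. Qed.

Lemma hol_inv (f : U -> C) z : f z <> 0 -> hol (V := CN) f z ->
  hol (V := CN) (fun y => / f y) z.
Proof. intros H0 [lf Hf]. eexists. now apply filterdiff_cinv; eassumption. Qed.

Lemma hol_comp {V W : NormedModule C_AbsRing} (f : U -> V) (g : V -> W) z :
  hol f z -> hol g (f z) -> hol (fun y => g (f y)) z.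
Proof. intros [lf Hf] [lg Hg]. eexists. now apply filterdiff_comp'; eassumption. Qed.

Lemma is_linear_scal_vec (v : U) : is_linear (U := CN) (fun w : C => scal w v).
Proof.
  split.
  - intros x y. exact (scal_distr_r x y v).
  - intros k x. change (scal k x) with (mult k x). symmetry. apply scal_assoc.
  - exists (norm v + 1)%R. split; [pose proof (norm_ge_0 v); lra|]. intros x.
    eapply Rle_trans; [apply norm_scal_C|]. change (norm x) with (Cmod x).
    pose proof (Cmod_ge_0 x). pose proof (norm_ge_0 v). nra.
Qed.

End HolCalculus.

Lemma hol_scal_vec {U V : NormedModule C_AbsRing} (f : U -> C) (v : V) z :
  hol (V := CN) f z -> hol (fun y => scal (f y) v) z.
Proof.
  intros Hf. apply (hol_comp (V := CN) f (fun w : C => scal w v)); auto.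
  apply (hol_linear (U := CN)), is_linear_scal_vec.
Qed.

(** Restriction to the complex line through [z] in direction [v]: this is how one-variable estimates
    reach an arbitrary normed module. *)
Lemma filterdiff_line {U : NormedModule C_AbsRing} (f : U -> C) (z v : U) (t : C) l :
  diffC f (plus z (scal t v)) l ->
  approx_linear (U := CN) (fun t => f (plus z (scal t v))) t (fun w => l v * w).
Proof.
  intros Hf.
  assert (H1 : filterdiff (U := CN) (fun t : C => plus z (scal t v)) (locally t) (fun w : C => plus zero (scal w v))).
  { apply (filterdiff_plus_fct (U := CN) (fun _ => z) (fun t : C => scal t v)).
    - apply (filterdiff_const (U := CN)).
    - apply (filterdiff_linear (U := CN)), is_linear_scal_vec. }
  pose proof (filterdiff_comp' (U := CN) (W := CN) _ f t _ _ H1 Hf) as H2.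
  apply filterdiff_approx in H2. eapply approx_ext_lin; [|apply H2].
  intros w. cbv beta. rewrite plus_zero_l, (linear_scal l (proj1 Hf)). 
  change (w * l v = l v * w). ring.
Qed.

Lemma approx_unique (g : C -> C) (w a b : C) :
  approx_linear (U := CN) g w (fun v => a * v) ->
  approx_linear (U := CN) g w (fun v => b * v) -> a = b.
Proof.
  intros [_ Ha] [_ Hb].
  assert (K : forall eps : R, (0 < eps)%R -> (Cmod (a - b) <= 2 * eps)%R).
  { intros eps He. destruct (Ha eps He) as [d1 [Hd1 H1]]. destruct (Hb eps He) as [d2 [Hd2 H2]].
    set (t := (Rmin d1 d2 / 2)%R). assert (Hm : (0 < Rmin d1 d2)%R) by now apply Rmin_pos.
    assert (Ht : (0 < t)%R) by (unfold t; lra).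
    assert (Ht1 : (t < d1)%R) by (pose proof (Rmin_l d1 d2); unfold t; lra).
    assert (Ht2 : (t < d2)%R) by (pose proof (Rmin_r d1 d2); unfold t; lra).
    assert (En : norm (RtoC t : CN) = t) by (change (Cmod t = t); rewrite Cmod_R, Rabs_pos_eq; lra).
    specialize (H1 (RtoC t)). specialize (H2 (RtoC t)). rewrite En in H1, H2.
    specialize (H1 Ht1). specialize (H2 Ht2). cbv beta in H1, H2.
    assert (E : Cmod ((a - b) * t) = (Cmod (a - b) * t)%R) by (rewrite Cmod_mult, Cmod_R, (Rabs_pos_eq t); lra).
    assert (H3 : (Cmod ((a - b) * t) <= eps * t + eps * t)%R).
    { replace ((a - b) * t) with ((g (plus w (RtoC t)) - g w - b * t) - (g (plus w (RtoC t)) - g w - a * t)) by ring.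
      eapply Rle_trans; [apply Cmod_minus_le|]. apply Rplus_le_compat; [exact H2|exact H1]. }
    rewrite E in H3. nra. }
  assert (HX : a - b = 0).
  { apply Cmod_eq_0. destruct (Rle_lt_or_eq_dec 0 (Cmod (a - b)) (Cmod_ge_0 _)) as [H|H]; auto.
    specialize (K (Cmod (a - b) / 4)%R ltac:(lra)). lra. }
  replace a with (a - b + b) by ring. rewrite HX. ring.
Qed.

(** * Cauchy estimates on normed modules *)

Definition bounded_holo {U : NormedModule C_AbsRing} (f : U -> C) (z : U) (rho M : R) : Prop :=
  forall y, (norm (minus y z) < rho)%R -> hol (V := CN) f y /\ (Cmod (f y) <= M)%R.

Section Estimates.
Context {U : NormedModule C_AbsRing}.
Implicit Types (f : U -> C) (z v : U).

(** On the line through [z] in direction [v] the disc of radius r = rho / (2 |v|) is half of what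
    the ball allows. The Taylor coefficient of [f] on it is [l v], by uniqueness of derivatives, and
    the point t = 1 is within reach of the remainder bound as soon as |v| <= rho / 4. *)
Lemma cauchy_direction f z v rho M l : (0 < rho)%R -> bounded_holo f z rho M ->
  diffC f z l ->
  (Cmod (l v) <= 4 * M / rho * norm v)%R /\
  ((norm v <= rho / 4)%R -> (Cmod (f (plus z v) - f z - l v) <= 16 * M / rho ^ 2 * norm v ^ 2)%R).
Proof.
  intros Hr Hb Hl. destruct (Rle_lt_or_eq_dec 0 (norm v) (norm_ge_0 v)) as [Hv|Hv].
  - set (r := (rho / (2 * norm v))%R).
    assert (Pr : (0 < r)%R) by (unfold r; apply Rdiv_lt_0_compat; lra).
    assert (Hin : forall t : C, (Cmod t <= r)%R -> (norm (minus (plus z (scal t v)) z) < rho)%R).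
    { intros t Ht. rewrite minus_plus_l. eapply Rle_lt_trans; [apply norm_scal_C|].
      apply (Rmult_le_compat_r (norm v)) in Ht; [|lra].
      replace (r * norm v)%R with (rho / 2)%R in Ht by (unfold r; field; lra). lra. }
    assert (E0 : plus z (scal (RtoC 0) v) = z).
    { rewrite (scal_zero_l (K := C_Ring) v : scal (RtoC 0) v = zero). apply plus_zero_r. }
    assert (E1 : plus z (scal (RtoC 1) v) = plus z v) by (f_equal; exact (scal_one v)).
    destruct (cauchy_taylor (fun t => f (plus z (scal t v))) r M Pr) as [a [Ha Ht]].
    + intros w Hw. destruct (Hb _ (Hin w Hw)) as [[lw Hlw] _]. exists (lw v).
      exact (filterdiff_line f z v w lw Hlw).
    + intros w Hw. apply Hb, Hin, Hw.
    + assert (Eal : a = l v).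
      { apply (approx_unique (fun t => f (plus z (scal t v))) 0).
        - assert (PM : (0 <= M)%R) by (eapply Rle_trans; [apply Cmod_ge_0|apply (Hb _ (Hin 0 ltac:(rewrite Cmod_0; lra)))]).
          split.
          + exists (Cmod a + 1)%R. split; [pose proof (Cmod_ge_0 a); lra|].
            intros w. rewrite Cmod_mult. change (norm w) with (Cmod w). pose proof (Cmod_ge_0 w). nra.
          + intros eps He. set (Cst := (4 * M / r ^ 2)%R).
            assert (PC : (0 <= Cst)%R) by (unfold Cst; apply Rdiv_le_0_compat; [lra|apply pow_lt; auto]).
            exists (Rmin (r / 2) (eps / (Cst + 1))). split; [apply Rmin_pos; [lra|apply Rdiv_lt_0_compat; lra]|].
            intros w Hw. change (norm w) with (Cmod w) in *. apply lt_Rmin in Hw. destruct Hw as [Hw1 Hw2].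
            change (plus (RtoC 0) w) with (0 + w). rewrite Cplus_0_l.
            eapply Rle_trans; [apply Ht; lra|].
            replace (4 * M * Cmod w ^ 2 / r ^ 2)%R with (Cst * Cmod w * Cmod w)%R by (unfold Cst; field; lra).
            pose proof (Cmod_ge_0 w). apply Rmult_le_compat_r; auto.
            apply (Rmult_lt_compat_l (Cst + 1)) in Hw2; [|lra].
            replace ((Cst + 1) * (eps / (Cst + 1)))%R with eps in Hw2 by (field; lra). nra.
        - apply filterdiff_line. rewrite E0. exact Hl. }
      subst a. split.
      * eapply Rle_trans; [exact Ha|]. right. unfold r. field. lra.
      * intros Hv4. specialize (Ht 1). rewrite E0, E1, Cmod_1 in Ht.
        assert (H1 : (1 <= r / 2)%R).
        { unfold r. apply (Rmult_le_reg_r (norm v)); auto. replace (rho / (2 * norm v) / 2 * norm v)%R with (rho / 4)%R by (field; lra). lra. }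
        specialize (Ht H1). rewrite Cmult_1_r in Ht. eapply Rle_trans; [exact Ht|]. right. unfold r. field. lra.
  - symmetry in Hv. pose proof (norm_eq_zero v Hv) as E. subst v.
    rewrite (linear_zero l (proj1 Hl)), plus_zero_r, norm_zero.
    change (@zero CN) with (RtoC 0). replace (f z - f z - 0) with (RtoC 0) by ring. rewrite Cmod_0.
    split; [lra|]. intros _. right; ring.
Qed.

Lemma cauchy_lipschitz f z v rho M : (0 < rho)%R -> bounded_holo f z rho M -> (norm v <= rho / 4)%R ->
  (Cmod (f (plus z v) - f z) <= 8 * M / rho * norm v)%R.
Proof.
  intros Hr Hb Hv.
  assert (H0 : (norm (minus z z) < rho)%R).
  { now rewrite norm_minus_diag. }
  destruct (Hb z H0) as [[l Hl] HM].
  destruct (cauchy_direction f z v rho M l Hr Hb Hl) as [H1 H2]. specialize (H2 Hv).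
  replace (f (plus z v) - f z) with ((f (plus z v) - f z - l v) + l v) by ring.
  eapply Rle_trans; [apply Cmod_triangle|].
  assert (PM : (0 <= M)%R) by (eapply Rle_trans; [apply Cmod_ge_0|exact HM]).
  (* For |v| <= rho / 4 the quadratic remainder is no larger than the bound of the linear part, so
     the constant 4 just doubles. *)
  assert (H3 : (16 * M / rho ^ 2 * norm v ^ 2 <= 4 * M / rho * norm v)%R).
  { replace (16 * M / rho ^ 2 * norm v ^ 2)%R with ((16 * M / rho ^ 2 * norm v) * norm v)%R by ring.
    apply Rmult_le_compat_r; [apply norm_ge_0|].
    replace (4 * M / rho)%R with (16 * M / rho ^ 2 * (rho / 4))%R by (field; lra).
    apply Rmult_le_compat_l; auto. apply Rdiv_le_0_compat; [lra|apply pow_lt; auto]. }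
  replace (8 * M / rho * norm v)%R with (4 * M / rho * norm v + 4 * M / rho * norm v)%R by (field; lra). lra.
Qed.
End Estimates.

(** * Strict differentiability and integrals with a parameter *)

Lemma locally_norm_iff {K : AbsRing} {U : NormedModule K} (p : U) (P : U -> Prop) :
  locally p P <-> exists rho : R, (0 < rho)%R /\ forall y : U, (norm (minus y p) < rho)%R -> P y.
Proof.
  split.
  - intros H. apply locally_norm_le_locally in H. destruct H as [e He].
    exists e. split; [apply cond_pos|]. exact He.
  - intros [r [Hr H]]. apply locally_le_locally_norm. exists (mkposreal r Hr). exact H.
Qed.

Lemma minus_plus_swap_group {G : AbelianGroup} (z v p : G) : minus (plus z v) p = plus (minus z p) v.
Proof. unfold minus. rewrite <- !plus_assoc. f_equal. apply plus_comm. Qed.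

Lemma minus_plus_swap {K : AbsRing} {U : NormedModule K} (z v p : U) : minus (plus z v) p = plus (minus z p) v.
Proof. exact (minus_plus_swap_group (G := NormedModule.AbelianGroup K U) z v p). Qed.

Lemma norm_minus_plus {K : AbsRing} {U : NormedModule K} (z v p : U) :
  (norm (minus (plus z v) p) <= norm (minus z p) + norm v)%R.
Proof. rewrite minus_plus_swap. apply norm_triangle. Qed.

Lemma norm_minus_trans {K : AbsRing} {U : NormedModule K} (x y z : U) :
  (norm (minus x z) <= norm (minus x y) + norm (minus y z))%R.
Proof. rewrite (minus_trans y x z). apply norm_triangle. Qed.

Lemma norm_minus_sym {K : AbsRing} {U : NormedModule K} (x y : U) : norm (minus x y) = norm (minus y x).
Proof. rewrite <- (norm_opp (minus x y)). f_equal. exact (opp_minus x y). Qed.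

Section Local.
Context {U : NormedModule C_AbsRing}.
Implicit Types (f : U -> C) (p z v : U).

(** Continuity at the single point [p] already bounds [f] nearby, so no compactness of balls
    enters. *)
Lemma holo_near_bounded f p : holo_near (V := CN) f p ->
  exists rho M : R, (0 < rho)%R /\ (0 <= M)%R /\ bounded_holo f p rho M.
Proof.
  intros H. apply locally_norm_iff in H. destruct H as [r1 [Hr1 H1]].
  assert (Hp : (norm (minus p p) < r1)%R) by now rewrite norm_minus_diag.
  destruct (H1 p Hp) as [l Hl]. apply filterdiff_approx in Hl. destruct Hl as [_ Al].
  destruct (approx_continuous_eps _ _ _ Al 1%R Rlt_0_1) as [d [Hd Hf]].
  exists (Rmin r1 d), (Cmod (f p) + 1)%R. split; [now apply Rmin_pos|].
  split; [pose proof (Cmod_ge_0 (f p)); lra|].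
  intros y Hy. apply lt_Rmin in Hy. destruct Hy as [Hy1 Hy2]. split; [now apply H1|].
  specialize (Hf (minus y p) Hy2). rewrite plus_minus_r in Hf.
  replace (f y) with (f y - f p + f p) by ring. eapply Rle_trans; [apply Cmod_triangle|]. lra.
Qed.

Lemma bounded_holo_shift f p z rho rho' M : bounded_holo f p rho M -> (norm (minus z p) + rho' <= rho)%R ->
  bounded_holo f z rho' M.
Proof.
  intros H Hz y Hy. apply H. pose proof (norm_minus_trans y z p). lra.
Qed.

Lemma hol_translate f p w : hol (V := CN) f (plus p w) -> hol (V := CN) (fun y => f (plus y w)) p.
Proof.
  intros H. apply (hol_comp (fun y => plus y w) f); auto. apply hol_vplus; [apply hol_id|apply hol_const].
Qed.

(** For fixed [w] the function y -> f(y + w) - f(y) is holomorphic and of size O(|w|), so the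
    Lipschitz estimate applied to it gains a further factor |u|. Together with the remainder at [p]
    this is strict differentiability with an explicit rate. *)
Lemma bounded_holo_strict f p rho M l : (0 < rho)%R -> bounded_holo f p rho M ->
  diffC f p l ->
  forall u w : U, (norm u <= rho / 8)%R -> (norm w <= rho / 8)%R ->
  (Cmod (f (plus (plus p u) w) - f (plus p u) - l w) <= 256 * M / rho ^ 2 * norm w * (norm u + norm w))%R.
Proof.
  intros Hr Hb Hl u w Hu Hw. pose proof (norm_ge_0 u) as Pu. pose proof (norm_ge_0 w) as Pw.
  assert (PM : (0 <= M)%R).
  { eapply Rle_trans; [apply Cmod_ge_0|apply (Hb p)]. now rewrite norm_minus_diag. }
  assert (Hk : bounded_holo (fun y => f (plus y w) - f y) p (rho / 2) (16 * M / rho * norm w)).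
  { intros y Hy. split.
    - apply hol_minus; [apply hol_translate|]; apply Hb; [pose proof (norm_minus_plus y w p)|]; lra.
    - replace (16 * M / rho * norm w)%R with (8 * M / (rho / 2) * norm w)%R by (field; lra).
      apply cauchy_lipschitz; try lra. apply (bounded_holo_shift f p y rho); auto. lra. }
  pose proof (cauchy_lipschitz _ p u (rho / 2) _ ltac:(lra) Hk ltac:(lra)) as H1. cbv beta in H1.
  destruct (cauchy_direction f p w rho M l Hr Hb Hl) as [_ H2]. specialize (H2 ltac:(lra)).
  replace (f (plus (plus p u) w) - f (plus p u) - l w) with
    ((f (plus (plus p u) w) - f (plus p u) - (f (plus p w) - f p)) + (f (plus p w) - f p - l w)) by ring.
  eapply Rle_trans; [apply Cmod_triangle|].
  replace (8 * (16 * M / rho * norm w) / (rho / 2) * norm u)%R with (256 * M / rho ^ 2 * norm w * norm u)%R in H1 by (field; lra).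
  rewrite Rmult_plus_distr_l. apply Rplus_le_compat; auto.
  eapply Rle_trans; [exact H2|]. replace (norm w ^ 2)%R with (norm w * norm w)%R by ring.
  rewrite Rmult_assoc. rewrite <- (Rmult_assoc _ (norm w) (norm w)).
  assert (0 <= M / rho ^ 2)%R by (apply Rdiv_le_0_compat; [lra|apply pow_lt; auto]).
  assert (0 <= norm w * norm w)%R by nra.
  replace (16 * M / rho ^ 2)%R with (16 * (M / rho ^ 2))%R by (field; lra).
  replace (256 * M / rho ^ 2)%R with (256 * (M / rho ^ 2))%R by (field; lra).
  rewrite !Rmult_assoc. nra.
Qed.

Lemma holo_near_strict f p l : holo_near (V := CN) f p ->
  diffC f p l ->
  forall eps : R, (0 < eps)%R -> exists d : R, (0 < d)%R /\
  forall z w, (norm (minus z p) < d)%R -> (norm w < d)%R ->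
    (Cmod (f (plus z w) - f z - l w) <= eps * norm w)%R.
Proof.
  intros Hf Hl eps He. destruct (holo_near_bounded f p Hf) as [rho [M [Hr [HM Hb]]]].
  set (K := (256 * M / rho ^ 2)%R).
  assert (PK : (0 <= K)%R) by (unfold K; apply Rdiv_le_0_compat; [lra|apply pow_lt; auto]).
  exists (Rmin (rho / 8) (eps / 2 / (K + 1))). split; [apply Rmin_pos; [lra|]; apply Rdiv_lt_0_compat; lra|].
  intros z w Hz Hw. apply lt_Rmin in Hz. apply lt_Rmin in Hw. destruct Hz as [Hz1 Hz2], Hw as [Hw1 Hw2].
  pose proof (bounded_holo_strict f p rho M l Hr Hb Hl (minus z p) w ltac:(lra) ltac:(lra)) as H.
  rewrite plus_minus_r in H. eapply Rle_trans; [exact H|]. fold K.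
  pose proof (norm_ge_0 w). pose proof (norm_ge_0 (minus z p)).
  assert (E : (eps / 2 = (K + 1) * (eps / 2 / (K + 1)))%R) by (field; lra).
  replace (K * norm w * (norm (minus z p) + norm w))%R with (K * (norm (minus z p) + norm w) * norm w)%R by ring.
  apply Rmult_le_compat_r; auto. nra.
Qed.

(** One constant bounds the derivatives at all points near [p]; this does the work of continuity of
    the derivative. *)
Lemma holo_near_deriv_bounded f p : holo_near (V := CN) f p ->
  exists d B : R, (0 < d)%R /\ (0 < B)%R /\ forall z l, (norm (minus z p) < d)%R ->
    diffC f z l -> forall v, (Cmod (l v) <= B * norm v)%R.
Proof.
  intros Hf. destruct (holo_near_bounded f p Hf) as [rho [M [Hr [HM Hb]]]].
  exists (rho / 2)%R, (4 * M / (rho / 2) + 1)%R. split; [lra|].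
  assert (H0 : (0 <= 4 * M / (rho / 2))%R) by (apply Rdiv_le_0_compat; lra).
  split; [lra|].
  intros z l Hz Hl v. destruct (cauchy_direction f z v (rho / 2) M l ltac:(lra)) as [H1 _]; auto.
  - apply (bounded_holo_shift f p z rho); auto. lra.
  - pose proof (norm_ge_0 v). lra.
Qed.

(** Differentiation under the integral sign: the quadratic remainder of the Cauchy estimate is
    uniform in [x] and can be integrated, so the derivative is the integral of the derivatives
    [D x]. *)
Lemma circ_int_holo (k : R -> U -> C) p (rho M : R) :
  (forall x, bounded_holo (k x) p rho M) ->
  (forall z, (norm (minus z p) < rho)%R -> forall x : R, continuous (fun x => k x z : C) x) ->
  forall z, (norm (minus z p) < rho)%R -> hol (V := CN) (fun z => circ_int (fun x => k x z)) z.
Proof.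
  intros Hb Hc z Hz. set (d := (rho - norm (minus z p))%R). assert (Hd : (0 < d)%R) by (unfold d; lra).
  assert (Hbz : forall x, bounded_holo (k x) z d M).
  { intros x. apply (bounded_holo_shift _ p z rho); auto. unfold d; lra. }
  assert (HM : (0 <= M)%R).
  { eapply Rle_trans; [apply Cmod_ge_0|apply (Hbz 0%R z)]. now rewrite norm_minus_diag. }
  assert (HD : forall x, exists l, diffC (k x) z l).
  { intros x. apply (Hb x z Hz). }
  set (D := fun x => proj1_sig (constructive_indefinite_description _ (HD x))).
  assert (HDx : forall x, diffC (k x) z (D x)).
  { intros x. exact (proj2_sig (constructive_indefinite_description _ (HD x))). }
  clearbody D.
  pose proof (fun x v => cauchy_direction (k x) z v d M (D x) Hd (Hbz x) (HDx x)) as Est.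
  set (A := (16 * M / d ^ 2)%R) in *. assert (PA : (0 <= A)%R) by (unfold A; apply Rdiv_le_0_compat; [lra|apply pow_lt; auto]).
  set (B := (4 * M / d)%R) in *. assert (PB : (0 <= B)%R) by (unfold B; apply Rdiv_le_0_compat; lra).
  assert (Hcv : forall v, (norm v < d)%R -> forall x : R, continuous (fun x => k x (plus z v) : C) x).
  { intros v Hv. apply Hc. pose proof (norm_minus_plus z v p). unfold d in Hv. lra. }
  assert (Hcz : forall x : R, continuous (fun x => k x z : C) x) by (apply Hc; auto).
  (* To be integrable, [D x v] has to be continuous in [x]. For one sufficiently small [t] the
     difference quotient [S] is continuous and within eps / 3 of [D x v], uniformly in [x]. *)
  assert (HDc : forall v (x : R), continuous (fun x => D x v : C) x).
  { intros v x. unfold continuous. apply (filterlim_locally_ball_norm (U := CN) (fun x => D x v) (D x v)). intros eps.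
    pose proof (norm_ge_0 v) as Pv. pose proof (cond_pos eps) as Pe.
    set (N := (norm v + 1)%R). assert (HN : (0 < N)%R) by (unfold N; lra).
    set (t := Rmin (d / 4 / N) (eps / 3 / ((A + 1) * N ^ 2))).
    assert (HAN : (0 < (A + 1) * N ^ 2)%R) by (apply Rmult_lt_0_compat; [lra|apply pow_lt; auto]).
    assert (Pt : (0 < t)%R) by (unfold t; apply Rmin_pos; repeat apply Rdiv_lt_0_compat; lra).
    assert (Ht1 : (t * N <= d / 4)%R).
    { replace (d / 4)%R with (d / 4 / N * N)%R by (field; lra). apply Rmult_le_compat_r; [lra|apply Rmin_l]. }
    assert (Ht2 : (t * ((A + 1) * N ^ 2) <= eps / 3)%R).
    { replace (eps / 3)%R with (eps / 3 / ((A + 1) * N ^ 2) * ((A + 1) * N ^ 2))%R by (field; split; lra).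
      apply Rmult_le_compat_r; [lra|apply Rmin_r]. }
    assert (Hn : (norm (scal (RtoC t) v) <= t * N)%R).
    { eapply Rle_trans; [apply norm_scal_C|]. rewrite Cmod_R, Rabs_pos_eq by lra. apply Rmult_le_compat_l; [lra|]. unfold N; lra. }
    pose proof (norm_ge_0 (scal (RtoC t) v)) as Pn.
    set (S := fun x => / RtoC t * (k x (plus z (scal (RtoC t) v)) - k x z)).
    assert (Ht0 : RtoC t <> 0) by (intros E; apply RtoC_inj in E; lra).
    assert (HS : forall x, (Cmod (D x v - S x) <= eps / 3)%R).
    { intros y. destruct (Est y (scal (RtoC t) v)) as [_ H]. specialize (H ltac:(lra)).
      assert (El : D y (scal (RtoC t) v) = RtoC t * D y v) by exact (linear_scal _ (proj1 (HDx y)) (RtoC t) v).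
      rewrite El in H.
      assert (E : D y v - S y = - / RtoC t * (k y (plus z (scal (RtoC t) v)) - k y z - RtoC t * D y v)) by (unfold S; field; auto).
      rewrite E, Cmod_mult, Cmod_opp, Cmod_inv, Cmod_R, Rabs_pos_eq by (auto || lra).
      apply (Rmult_le_reg_l t); auto. rewrite <- Rmult_assoc, Rinv_r, Rmult_1_l by lra.
      eapply Rle_trans; [exact H|].
      assert (norm (scal (RtoC t) v) ^ 2 <= (t * N) ^ 2)%R by (apply pow_incr; lra).
      apply Rle_trans with (t * (t * (A * N ^ 2)))%R; [|].
      - replace (t * (t * (A * N ^ 2)))%R with (A * (t * N) ^ 2)%R by ring. apply Rmult_le_compat_l; auto.
      - apply Rmult_le_compat_l; [lra|]. eapply Rle_trans; [|exact Ht2]. apply Rmult_le_compat_l; [lra|].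
        apply Rmult_le_compat_r; [apply pow_le; lra|lra]. }
    assert (CS : continuous (S : R -> C) x).
    { apply (continuous_scal_r (K := C_AbsRing) (V := CN) (/ RtoC t)).
      apply (continuous_minus (K := C_AbsRing) (V := CN)); [|apply Hcz]. apply Hcv. lra. }
    pose proof (proj1 (filterlim_locally_ball_norm (U := CN) S (S x)) CS (mkposreal (eps / 3) ltac:(lra))) as L.
    eapply filter_imp; [|exact L]. intros y Hy. unfold ball_norm in *. change (Cmod (S y - S x) < eps / 3)%R in Hy.
    change (Cmod (D y v - D x v) < eps)%R.
    replace (D y v - D x v) with ((D y v - S y) - (D x v - S x) + (S y - S x)) by ring.
    eapply Rle_lt_trans; [apply Cmod_triangle|]. pose proof (Cmod_minus_le (D y v - S y) (D x v - S x)).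
    pose proof (HS y). pose proof (HS x). lra. }
  assert (circD : forall v, circ_continuous (fun x => D x v)) by (intros v x _; apply HDc).
  exists (fun v => circ_int (fun x => D x v)). apply filterdiff_approx.
  assert (Hbd : forall v, (Cmod (circ_int (fun x => D x v)) <= 4 * PI * B * norm v)%R).
  { intros v. rewrite Rmult_assoc. apply circ_int_bound; auto. intros x _. apply Est. }
  pose proof PI_RGT_0 as HPI.
  assert (bnd : exists M0 : R, (0 < M0)%R /\ forall v, (Cmod (circ_int (fun x => D x v)) <= M0 * norm v)%R).
  { exists (4 * PI * B + 1)%R. split; [assert (0 <= 4 * PI * B)%R by (apply Rmult_le_pos; lra); lra|].
    intros v. specialize (Hbd v). pose proof (norm_ge_0 v). lra. }
  split; [split|split].
  - intros v w. rewrite (circ_int_ext _ (fun x => D x v + D x w)).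
    + apply circ_int_plus; auto.
    + intros x _. exact (linear_plus _ (proj1 (HDx x)) v w).
  - intros c v. rewrite (circ_int_ext _ (fun x => c * D x v)).
    + apply circ_int_scal; auto.
    + intros x _. exact (linear_scal _ (proj1 (HDx x)) c v).
  - exact bnd.
  - exact bnd.
  - intros eps He.
    assert (P4 : (0 <= 4 * PI * A)%R) by (apply Rmult_le_pos; lra).
    exists (Rmin (d / 4) (eps / (4 * PI * A + 1))). split; [apply Rmin_pos; [lra|apply Rdiv_lt_0_compat; lra]|].
    intros v Hv. apply lt_Rmin in Hv. destruct Hv as [Hv1 Hv2]. pose proof (norm_ge_0 v) as Pv.
    assert (C1 : circ_continuous (fun x => k x (plus z v))) by (intros x _; apply Hcv; lra).
    assert (C2 : circ_continuous (fun x => k x z)) by (intros x _; apply Hcz).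
    replace (circ_int (fun x => k x (plus z v)) - circ_int (fun x => k x z) - circ_int (fun x => D x v))
      with (circ_int (fun x => k x (plus z v)) + (- (1) * circ_int (fun x => k x z) + - (1) * circ_int (fun x => D x v))) by ring.
    rewrite <- !circ_int_scal, <- !circ_int_plus by auto.
    eapply Rle_trans; [apply circ_int_bound|].
    + auto.
    + intros x _. destruct (Est x v) as [_ H]. specialize (H ltac:(lra)).
      replace (k x (plus z v) + (- (1) * k x z + - (1) * D x v)) with (k x (plus z v) - k x z - D x v) by ring. exact H.
    + replace (4 * PI * (A * norm v ^ 2))%R with ((4 * PI * A * norm v) * norm v)%R by ring.
      apply Rmult_le_compat_r; auto.
      replace eps with ((4 * PI * A + 1) * (eps / (4 * PI * A + 1)))%R by (field; lra).
      apply Rmult_le_compat; lra.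
Qed.
End Local.

(* With [s = l z - l p], the quotient is the Cauchy integral
   [q z = 1/(2 pi) * int h (z + (w - s) e) / (w - s) dx] over [w = r e^(ix)]. *)
Theorem holo_division {U : NormedModule C_AbsRing} (l : U -> C) (e p : U) (h : U -> C) :
  is_linear (V := CN) l -> l e = 1 ->
  holo_near (V := CN) h p ->
  locally p (fun z => l z = l p -> h z = 0) ->
  exists q : U -> C, holo_near (V := CN) q p /\ locally p (fun z => h z = (l z - l p) * q z).
Proof.
  intros Ll He Hh H0. destruct (holo_near_bounded h p Hh) as [rho1 [M [Hr1 [HM Hb1]]]].
  apply locally_norm_iff in H0. destruct H0 as [rho2 [Hr2 H0]].
  set (rho := Rmin rho1 rho2). assert (Hr : (0 < rho)%R) by now apply Rmin_pos.
  assert (Hb : bounded_holo h p rho M).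
  { intros y Hy. apply Hb1. eapply Rlt_le_trans; [exact Hy|apply Rmin_l]. }
  assert (Hz0 : forall z : U, (norm (minus z p) < rho)%R -> l z = l p -> h z = 0).
  { intros z Hz. apply H0. eapply Rlt_le_trans; [exact Hz|apply Rmin_r]. }
  clearbody rho. clear Hb1 H0.
  destruct (linear_norm l Ll) as [Ml [HMl Hl]].
  set (N := (norm e + 1)%R). pose proof (norm_ge_0 e) as Pe. assert (HN : (1 <= N)%R) by (unfold N; lra).
  set (r := (rho / (4 * N))%R). assert (Pr : (0 < r)%R) by (unfold r; apply Rdiv_lt_0_compat; lra).
  assert (HrN : (r * N = rho / 4)%R) by (unfold r; field; lra).
  (* [d] keeps |s z| <= r / 2, hence the circle of radius [r] away from [s z], and keeps the points
     [Y w z] below in the ball where [h] is holomorphic. *)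
  set (d := Rmin (rho / 4) (r / (2 * Ml))).
  assert (Pd : (0 < d)%R) by (unfold d; apply Rmin_pos; [lra|apply Rdiv_lt_0_compat; lra]).
  set (s := fun z => l z - l p).
  assert (Hs : forall z : U, (norm (minus z p) < d)%R -> (Cmod (s z) <= r / 2)%R).
  { intros z Hz. unfold s. assert (E : l z - l p = l (minus z p)) by (symmetry; exact (linear_minus l z p Ll)).
    rewrite E. eapply Rle_trans; [apply Hl|].
    assert (Hz2 : (norm (minus z p) < r / (2 * Ml))%R) by (eapply Rlt_le_trans; [exact Hz|apply Rmin_r]).
    apply (Rmult_lt_compat_l Ml) in Hz2; auto.
    replace (Ml * (r / (2 * Ml)))%R with (r / 2)%R in Hz2 by (field; lra). lra. }
  assert (Hd4 : (d <= rho / 4)%R) by apply Rmin_l.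
  (* [Y w z] is the point of the line through [z] in direction [e] at which l - l p equals [w]: it
     is [z] itself for w = s z, and for w = 0 it lies on the set where [h] vanishes. *)
  set (Y := fun (w : C) (z : U) => plus z (scal (w - s z) e)).
  assert (HY : forall (w : C) (z : U), (Cmod w <= r)%R -> (norm (minus z p) < d)%R -> (norm (minus (Y w z) p) < rho)%R).
  { intros w z Hw Hz. unfold Y. eapply Rle_lt_trans; [apply norm_minus_plus|].
    assert (norm (scal (w - s z)%C e) <= (3 / 2 * r) * N)%R.
    { eapply Rle_trans; [apply norm_scal_C|]. apply Rmult_le_compat; [apply Cmod_ge_0|auto| |unfold N; lra].
      eapply Rle_trans; [apply Cmod_minus_le|]. specialize (Hs z Hz). lra. }
    lra. }
  assert (hol_s : forall z, hol (V := CN) s z).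
  { intros z. apply hol_minus; [now apply hol_linear|apply hol_const]. }
  assert (Hcirc : forall x, Cmod (r * cis x) = r) by (intros x; rewrite Cmod_mult, Cmod_cis, Cmod_R, Rabs_pos_eq; lra).
  assert (Hden : forall (x : R) (z : U), (norm (minus z p) < d)%R -> (r / 2 <= Cmod (r * cis x - s z)%C)%R).
  { intros x z Hz. pose proof (Cmod_minus_ge (r * cis x) (s z)) as H. rewrite Hcirc in H. specialize (Hs z Hz). lra. }
  assert (Hden0 : forall (x : R) (z : U), (norm (minus z p) < d)%R -> r * cis x - s z <> 0).
  { intros x z Hz. apply Cmod_gt_0. specialize (Hden x z Hz). lra. }
  assert (HlY : forall z, l (Y 0 z) = l p).
  { intros z. unfold Y.
    assert (E1 : l (plus z (scal (0 - s z) e)) = l z + (0 - s z) * l e).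
    { etransitivity; [exact (linear_plus l Ll _ _)|]. 
      change (l z + l (scal (0 - s z) e) = l z + (0 - s z) * l e). f_equal. exact (linear_scal l Ll (0 - s z) e). }
    rewrite E1, He. unfold s. ring. }
  assert (HYs : forall z, Y (s z) z = z).
  { intros z. unfold Y. replace (s z - s z) with (RtoC 0) by ring.
    rewrite (scal_zero_l (K := C_Ring) e : scal (RtoC 0) e = zero). apply plus_zero_r. }
  assert (Hline : forall (z : U) (w : C), (norm (minus z p) < d)%R -> (Cmod w <= r)%R -> cdiff (fun w => h (Y w z)) w).
  { intros z w Hz Hw. destruct (Hb _ (HY w z Hw Hz)) as [[lw Hlw] _]. unfold Y in *.
    exists (lw e).
    pose proof (filterdiff_line h (plus z (scal (- s z) e)) e w lw) as FL.
    assert (EY : forall w, plus (plus z (scal (- s z) e)) (scal w e) = plus z (scal (w - s z) e)).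
    { intros w'. rewrite <- plus_assoc. f_equal.
      transitivity (scal (plus (- s z) w' : C) e); [symmetry; exact (scal_distr_r (K := C_Ring) (- s z) w' e)|].
      f_equal. change (- s z + w' = w' - s z). ring. }
    rewrite EY in FL. specialize (FL Hlw). eapply approx_ext; [|exact FL]. intros y. cbv beta. now rewrite EY. }
  set (k := fun (x : R) (z : U) => h (Y (r * cis x) z) * / (r * cis x - s z)).
  assert (Hk : forall x, bounded_holo (k x) p d (M * (2 / r))).
  { intros x z Hz. assert (HYz := HY (r * cis x) z ltac:(rewrite Hcirc; lra) Hz). split.
    - unfold k. apply hol_mult.
      + apply (hol_comp (Y (r * cis x)) h); [|apply Hb; auto].
        unfold Y. apply hol_vplus; [apply hol_id|]. apply hol_scal_vec. apply hol_minus; [apply hol_const|apply hol_s].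
      + apply hol_inv; [apply Hden0; auto|]. apply hol_minus; [apply hol_const|apply hol_s].
    - unfold k. rewrite Cmod_mult, Cmod_inv by (apply Hden0; auto). apply Rmult_le_compat; [apply Cmod_ge_0| |apply Hb; auto|].
      + left. apply Rinv_0_lt_compat. specialize (Hden x z Hz). lra.
      + replace (2 / r)%R with (/ (r / 2))%R by (field; lra). apply Rinv_le_contravar; [lra|apply Hden; auto]. }
  assert (Hkd : forall z : U, (norm (minus z p) < d)%R -> forall x, cdiff (fun w => h (Y w z) * / (w - s z)) (r * cis x)).
  { intros z Hz x. apply cdiff_mult; [apply Hline; auto; rewrite Hcirc; lra|].
    apply (cdiff_inv (fun w => w - s z)); [apply Hden0; auto|]. apply cdiff_minus; [apply cdiff_id|apply cdiff_const]. }
  assert (Hkc : forall z : U, (norm (minus z p) < d)%R -> forall x : R, continuous (fun x => k x z : C) x).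
  { intros z Hz x. destruct (Hkd z Hz x) as [a Ha].
    assert (E : forall y, RtoC 0 + r * cis y = r * cis y) by (intros; ring).
    rewrite <- E in Ha. destruct (approx_circ_comp _ r 0 x a Ha) as [lx Hlx].
    apply approx_continuous in Hlx. eapply continuous_ext; [|exact Hlx]. intros y. cbv beta. now rewrite E. }
  pose proof PI_RGT_0 as HPI.
  assert (H2pi : RtoC (2 * PI) <> 0) by (intros E; apply RtoC_inj in E; lra).
  exists (fun z => / RtoC (2 * PI) * circ_int (fun x => k x z)). split.
  - apply locally_norm_iff. exists d. split; auto. intros z Hz. apply hol_mult; [apply hol_const|].
    exact (circ_int_holo k p d (M * (2 / r)) Hk Hkc z Hz).
  - apply locally_norm_iff. exists d. split; auto. intros z Hz. fold (s z).
    (* Cauchy's formula at [s z] gives [h z], at 0 it gives 0. Subtracting by means of w / (w - s) -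
       1 = s / (w - s) leaves [s z] times the integral of [k]. *)
    pose proof (cauchy_formula' (fun w => h (Y w z)) r (s z)) as F1.
    pose proof (cauchy_formula' (fun w => h (Y w z)) r 0) as F2.
    assert (Hsr : (Cmod (s z) < r)%R) by (specialize (Hs z Hz); lra).
    specialize (F1 Hsr (fun w => Hline z w Hz)). specialize (F2 ltac:(rewrite Cmod_0; lra) (fun w => Hline z w Hz)).
    cbv beta in F1, F2. rewrite HYs in F1.
    rewrite (Hz0 (Y 0 z)) in F2; [|apply HY; auto; rewrite Cmod_0; lra|apply HlY].
    assert (cc : circ_continuous (fun x => k x z)) by (intros x _; apply Hkc; auto).
    assert (Hn0 : forall x, r * cis x <> 0) by (intros x; apply Cmod_gt_0; rewrite Hcirc; lra).
    assert (F3 : RtoC (2 * PI) * h z = s z * circ_int (fun x => k x z)).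
    { rewrite <- F1.
      rewrite (circ_int_ext _ (fun x => s z * k x z + h (Y (r * cis x) z) * (r * cis x) * / (r * cis x - 0))).
      - rewrite circ_int_plus, circ_int_scal, F2; auto.
        + ring.
        + apply (circ_continuous_cdiff (fun w => h (Y w z) * w * / (w - 0))). intros x.
          apply cdiff_mult; [apply cdiff_mult; [apply Hline; auto; rewrite Hcirc; lra|apply cdiff_id]|].
          apply (cdiff_inv (fun w => w - 0)); [|apply cdiff_minus; [apply cdiff_id|apply cdiff_const]].
          replace (r * cis x - 0) with (r * cis x) by ring. auto.
      - intros x _. unfold k. replace (r * cis x - 0) with (r * cis x) by ring.
        generalize (Hden0 x z Hz) (Hn0 x). generalize (h (Y (r * cis x) z)). generalize (r * cis x).
        intros w y A1 A2. field. auto. }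
    replace (h z) with (/ RtoC (2 * PI) * (RtoC (2 * PI) * h z)) by (field; auto). rewrite F3. ring.
Qed.

(** * The inverse function theorem on C^2 *)

Notation CC := (prod_NormedModule C_AbsRing CN CN).

Lemma norm_CC_fst (v : CC) : (Cmod (fst v) <= norm v)%R.
Proof. exact (norm_le_prod_norm_1 (K := C_AbsRing) (U := CN) (V := CN) v). Qed.

Lemma norm_CC_snd (v : CC) : (Cmod (snd v) <= norm v)%R.
Proof. exact (norm_le_prod_norm_2 (K := C_AbsRing) (U := CN) (V := CN) v). Qed.

Lemma norm_CC_le (v : CC) : (norm v <= Cmod (fst v) + Cmod (snd v))%R.
Proof.
  change (sqrt (Cmod (fst v) ^ 2 + Cmod (snd v) ^ 2) <= Cmod (fst v) + Cmod (snd v))%R.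
  pose proof (Cmod_ge_0 (fst v)). pose proof (Cmod_ge_0 (snd v)).
  rewrite <- (sqrt_Rsqr (Cmod (fst v) + Cmod (snd v))) by lra.
  apply sqrt_le_1_alt. unfold Rsqr. nra.
Qed.

Ltac c2ring :=
  apply injective_projections;
  unfold minus, plus, opp, scal, zero; simpl;
  unfold prod_plus, prod_opp, prod_scal, prod_zero, minus, plus, opp, scal, mult, zero; simpl;
  refine (_ : @eq C _ _); ring.

Lemma filterdiff_eps {K : AbsRing} {U V : NormedModule K} (f : U -> V) (z : U) (l : U -> V) :
  filterdiff f (locally z) l <-> is_linear l /\
  forall eps : R, (0 < eps)%R -> exists d : R, (0 < d)%R /\ forall v, (norm v < d)%R ->
     (norm (minus (minus (f (plus z v)) (f z)) (l v)) <= eps * norm v)%R.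
Proof.
  split.
  - intros [Hl H]. split; auto. intros eps He. specialize (H z (fun P H => H) (mkposreal eps He)).
    apply locally_norm_le_locally in H. destruct H as [d Hd]. exists d. split; [apply cond_pos|].
    intros v Hv. specialize (Hd (plus z v)). unfold ball_norm in Hd. rewrite minus_plus_l in Hd. exact (Hd Hv).
  - intros [Hl H]. split; auto. intros x Hx.
    apply is_filter_lim_locally_unique in Hx. subst x. intros eps.
    destruct (H eps (cond_pos eps)) as [d [Hd Hf]].
    apply locally_le_locally_norm. exists (mkposreal d Hd). intros y Hy. unfold ball_norm in Hy. simpl in Hy.
    specialize (Hf (minus y z) Hy). rewrite plus_minus_r in Hf. exact Hf.
Qed.

Lemma filterdiff_fst {U : NormedModule C_AbsRing} (f : U -> CC) z l :
  filterdiff f (locally z) l ->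
  diffC (fun y => fst (f y)) z (fun v => fst (l v)).
Proof.
  intros H. apply (filterdiff_comp' f (fst : CC -> CN)); auto.
  apply filterdiff_linear. exact (is_linear_fst (U := CN) (V := CN)).
Qed.

Lemma filterdiff_snd {U : NormedModule C_AbsRing} (f : U -> CC) z l :
  filterdiff f (locally z) l ->
  diffC (fun y => snd (f y)) z (fun v => snd (l v)).
Proof.
  intros H. apply (filterdiff_comp' f (snd : CC -> CN)); auto.
  apply filterdiff_linear. exact (is_linear_snd (U := CN) (V := CN)).
Qed.

Lemma filterdiff_pair {U V W : NormedModule C_AbsRing} (f : U -> V) (g : U -> W) z lf lg :
  filterdiff f (locally z) lf -> filterdiff g (locally z) lg ->
  filterdiff (V := prod_NormedModule C_AbsRing V W) (fun y => (f y, g y)) (locally z) (fun v => (lf v, lg v)).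
Proof.
  intros Hf Hg. apply (filterdiff_comp'_2 f g (fun a b => (a, b)) z lf lg (fun a b => (a, b))); auto.
  apply (filterdiff_ext (fun t => t)); [intros [a b]; reflexivity|].
  apply (filterdiff_ext_lin (fun t => t) (fun t => t)); [apply filterdiff_id|intros [a b]; reflexivity].
Qed.

Lemma is_linear_form (a b : C) : is_linear (U := CC) (V := CN) (fun v => a * fst v + b * snd v).
Proof.
  split.
  - intros [x1 x2] [y1 y2]. change (a * (x1 + y1) + b * (x2 + y2) = a * x1 + b * x2 + (a * y1 + b * y2)). ring.
  - intros k [x1 x2]. change (a * (k * x1) + b * (k * x2) = k * (a * x1 + b * x2)). ring.
  - exists (Cmod a + Cmod b + 1)%R. split; [pose proof (Cmod_ge_0 a); pose proof (Cmod_ge_0 b); lra|].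
    intros v. change (Cmod (a * fst v + b * snd v) <= (Cmod a + Cmod b + 1) * norm v)%R.
    eapply Rle_trans; [apply Cmod_triangle|]. rewrite !Cmod_mult.
    pose proof (norm_CC_fst v). pose proof (norm_CC_snd v). pose proof (Cmod_ge_0 a). pose proof (Cmod_ge_0 b).
    pose proof (Cmod_ge_0 (fst v)). pose proof (Cmod_ge_0 (snd v)). nra.
Qed.

Definition e1 : CC := (RtoC 1, RtoC 0).
Definition e2 : CC := (RtoC 0, RtoC 1).

Lemma CC_decomp (x y : C) : ((x, y) : CC) = plus (scal x e1) (scal y e2).
Proof.
  change (@eq (C * C) (x, y) (x * 1 + y * 0, x * 0 + y * 1)).
  apply injective_projections; cbn [fst snd]; ring.
Qed.

Lemma linear_form_coord (l : CC -> C) : is_linear (U := CC) (V := CN) l ->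
  forall v, l v = l e1 * fst v + l e2 * snd v.
Proof.
  intros H [x y].
  etransitivity; [exact (f_equal l (CC_decomp x y))|]. etransitivity; [exact (linear_plus l H _ _)|].
  etransitivity; [exact (f_equal2 Cplus (linear_scal l H x e1) (linear_scal l H y e2))|].
  change (x * l e1 + y * l e2 = l e1 * x + l e2 * y). ring.
Qed.

Definition det2 (L : CC -> CC) : C := fst (L e1) * snd (L e2) - fst (L e2) * snd (L e1).

Lemma linear_CC_coord (L : CC -> CC) : is_linear (U := CC) (V := CC) L ->
  forall v, L v = (fst (L e1) * fst v + fst (L e2) * snd v, snd (L e1) * fst v + snd (L e2) * snd v).
Proof.
  intros H v.
  pose proof (linear_form_coord (fun v => fst (L v)) (is_linear_comp L _ H (is_linear_fst (U := CN) (V := CN)))) as E1.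
  pose proof (linear_form_coord (fun v => snd (L v)) (is_linear_comp L _ H (is_linear_snd (U := CN) (V := CN)))) as E2.
  apply injective_projections; [exact (E1 v)|exact (E2 v)].
Qed.

Lemma Copp_eq_0 (x : C) : - x = 0 -> x = 0.
Proof. intros H. replace x with (- - x) by ring. rewrite H. ring. Qed.

(** If the determinant vanished, the columns of the adjugate would lie in the kernel and hence be 0;
    then the first column of the matrix is 0, so that [e1] lies in the kernel too. *)
Lemma det2_inj (L : CC -> CC) : is_linear (U := CC) (V := CC) L ->
  (forall v, L v = origin -> v = origin) -> det2 L <> 0.
Proof.
  intros HL Hi. pose proof (linear_CC_coord L HL) as E. unfold det2. 
  set (a := fst (L e1)) in *. set (b := fst (L e2)) in *. set (c := snd (L e1)) in *. set (d := snd (L e2)) in *.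
  intros D.
  assert (H1 : ((b, - a) : C2) = origin).
  { apply Hi. rewrite E. unfold origin. simpl fst; simpl snd. f_equal; [ring|].
    replace (c * b + d * - a) with (- (a * d - b * c)) by ring. rewrite D. ring. }
  assert (H2 : ((d, - c) : C2) = origin).
  { apply Hi. rewrite E. unfold origin. simpl fst; simpl snd. f_equal; [|ring].
    replace (a * d + b * - c) with (a * d - b * c) by ring. exact D. }
  assert (Ha : a = RtoC 0) by (apply Copp_eq_0; exact (f_equal snd H1)).
  assert (Hc : c = RtoC 0) by (apply Copp_eq_0; exact (f_equal snd H2)).
  assert (H3 : e1 = origin).
  { apply Hi. rewrite E, Ha, Hc. apply injective_projections; unfold origin, e1; cbn [fst snd]; cring. }
  apply (f_equal (fun z : C2 => fst (fst z))) in H3. simpl in H3. lra.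
Qed.

Lemma linear_CC_inverse (L : CC -> CC) : is_linear (U := CC) (V := CC) L -> det2 L <> 0 ->
  exists Li : CC -> CC, is_linear (U := CC) (V := CC) Li /\ (forall v, Li (L v) = v) /\ (forall w, L (Li w) = w).
Proof.
  intros HL HD. pose proof (linear_CC_coord L HL) as E. unfold det2 in HD.
  set (a := fst (L e1)) in *. set (b := fst (L e2)) in *. set (c := snd (L e1)) in *. set (d := snd (L e2)) in *.
  set (D := a * d - b * c) in *.
  exists (fun w => (d / D * fst w + - b / D * snd w, - c / D * fst w + a / D * snd w)). split; [|split].
  - apply (is_linear_prod (T := CC) (U := CN) (V := CN)); apply is_linear_form.
  - intros v. rewrite (E v). cbn [fst snd]. destruct v as [x y]. cbn [fst snd].
    apply injective_projections; cbn [fst snd]; unfold D in *; refine (_ : @eq C _ _); field; auto.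
  - intros w. rewrite (E (_ , _)). cbn [fst snd]. destruct w as [x y]. cbn [fst snd].
    apply injective_projections; cbn [fst snd]; unfold D in *; refine (_ : @eq C _ _); field; auto.
Qed.

(** The intervals of radius 2 c / 2^n about [x n] are nested, because that radius is the sum of all
    remaining steps. *)
Lemma geometric_limit (x : nat -> R) (c : R) : (0 <= c)%R -> (forall n, Rabs (x (S n) - x n) <= c / 2 ^ n)%R ->
  exists l : R, forall n, (Rabs (x n - l) <= 2 * c / 2 ^ n)%R.
Proof.
  intros Hc H. destruct (nested_limit (fun n => x n - 2 * c / 2 ^ n)%R (fun n => 4 * c / 2 ^ n)%R (4 * c)) as [l Hl]; try lra; auto.
  - intros n. specialize (H n). apply Rabs_le_between in H.
    replace (2 * c / 2 ^ S n)%R with (c / 2 ^ n)%R by (simpl; field; apply pow_nonzero; lra).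
    replace (2 * c / 2 ^ n)%R with (c / 2 ^ n + c / 2 ^ n)%R by (field; apply pow_nonzero; lra). lra.
  - intros n. specialize (H n). apply Rabs_le_between in H.
    replace (2 * c / 2 ^ S n)%R with (c / 2 ^ n)%R by (simpl; field; apply pow_nonzero; lra).
    replace (4 * c / 2 ^ S n)%R with (2 * (c / 2 ^ n))%R by (simpl; field; apply pow_nonzero; lra).
    replace (2 * c / 2 ^ n)%R with (2 * (c / 2 ^ n))%R by (field; apply pow_nonzero; lra).
    replace (4 * c / 2 ^ n)%R with (4 * (c / 2 ^ n))%R by (field; apply pow_nonzero; lra). lra.
  - exists l. intros n. specialize (Hl n).
    replace (4 * c / 2 ^ n)%R with (2 * c / 2 ^ n + 2 * c / 2 ^ n)%R in Hl by (field; apply pow_nonzero; lra).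
    apply Rabs_le. lra.
Qed.

(** Four real coordinates, each within 2 c / 2^n of its limit, give the factor 8. *)
Lemma geometric_limit_CC (u : nat -> CC) (c : R) : (0 <= c)%R ->
  (forall n, norm (minus (u (S n)) (u n)) <= c / 2 ^ n)%R ->
  exists l : CC, forall n, (norm (minus (u n) l) <= 8 * c / 2 ^ n)%R.
Proof.
  intros Hc H.
  assert (F : forall n, (Cmod (fst (u (S n)) - fst (u n)) <= c / 2 ^ n)%R).
  { intros n. eapply Rle_trans; [|apply H]. exact (norm_CC_fst (minus (u (S n)) (u n))). }
  assert (S' : forall n, (Cmod (snd (u (S n)) - snd (u n)) <= c / 2 ^ n)%R).
  { intros n. eapply Rle_trans; [|apply H]. exact (norm_CC_snd (minus (u (S n)) (u n))). }
  destruct (geometric_limit (fun n => fst (fst (u n))) c Hc) as [l1 H1].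
  { intros n. eapply Rle_trans; [|apply F]. exact (Rabs_fst_le_Cmod (fst (u (S n)) - fst (u n))). }
  destruct (geometric_limit (fun n => snd (fst (u n))) c Hc) as [l2 H2].
  { intros n. eapply Rle_trans; [|apply F]. exact (Rabs_snd_le_Cmod (fst (u (S n)) - fst (u n))). }
  destruct (geometric_limit (fun n => fst (snd (u n))) c Hc) as [l3 H3].
  { intros n. eapply Rle_trans; [|apply S']. exact (Rabs_fst_le_Cmod (snd (u (S n)) - snd (u n))). }
  destruct (geometric_limit (fun n => snd (snd (u n))) c Hc) as [l4 H4].
  { intros n. eapply Rle_trans; [|apply S']. exact (Rabs_snd_le_Cmod (snd (u (S n)) - snd (u n))). }
  exists ((l1, l2), (l3, l4)). intros n.
  eapply Rle_trans; [apply norm_CC_le|].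
  pose proof (Cmod_le_parts (fst (u n) - (l1, l2)) :
    (_ <= Rabs (fst (fst (u n)) - l1) + Rabs (snd (fst (u n)) - l2))%R) as K1.
  pose proof (Cmod_le_parts (snd (u n) - (l3, l4)) :
    (_ <= Rabs (fst (snd (u n)) - l3) + Rabs (snd (snd (u n)) - l4))%R) as K2.
  specialize (H1 n); specialize (H2 n); specialize (H3 n); specialize (H4 n). cbv beta in *.
  change (Cmod (fst (u n) - (l1, l2)) + Cmod (snd (u n) - (l3, l4)) <= 8 * c / 2 ^ n)%R.
  replace (8 * c / 2 ^ n)%R with (4 * (2 * c / 2 ^ n))%R by (field; apply pow_nonzero; lra). lra.
Qed.

Lemma holo_near_strict_CC (f : CC -> CC) p l : holo_near f p -> filterdiff f (locally p) l ->
  forall eps : R, (0 < eps)%R -> exists d : R, (0 < d)%R /\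
  forall z w : CC, (norm (minus z p) < d)%R -> (norm w < d)%R ->
    (norm (minus (minus (f (plus z w)) (f z)) (l w)) <= eps * norm w)%R.
Proof.
  intros Hf Hl eps He.
  assert (H1 : holo_near (V := CN) (fun y => fst (f y)) p).
  { unfold holo_near. eapply filter_imp; [|exact Hf]. intros z [lz Hz]. eexists. apply filterdiff_fst, Hz. }
  assert (H2 : holo_near (V := CN) (fun y => snd (f y)) p).
  { unfold holo_near. eapply filter_imp; [|exact Hf]. intros z [lz Hz]. eexists. apply filterdiff_snd, Hz. }
  destruct (holo_near_strict _ p _ H1 (filterdiff_fst _ _ _ Hl) (eps / 2)%R ltac:(lra)) as [d1 [Hd1 K1]].
  destruct (holo_near_strict _ p _ H2 (filterdiff_snd _ _ _ Hl) (eps / 2)%R ltac:(lra)) as [d2 [Hd2 K2]].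
  exists (Rmin d1 d2). split; [now apply Rmin_pos|]. intros z w Hz Hw.
  apply lt_Rmin in Hz. apply lt_Rmin in Hw. destruct Hz, Hw.
  eapply Rle_trans; [apply norm_CC_le|].
  specialize (K1 z w ltac:(auto) ltac:(auto)). specialize (K2 z w ltac:(auto) ltac:(auto)).
  replace (eps * norm w)%R with (eps / 2 * norm w + eps / 2 * norm w)%R by field.
  apply Rplus_le_compat; [exact K1|exact K2].
Qed.

Lemma minus_zero_eq {K : AbsRing} {V : NormedModule K} (x y : V) : norm (minus x y) = 0%R -> x = y.
Proof.
  intros H. rewrite <- (plus_minus_r y x), (norm_eq_zero _ H). apply plus_zero_r.
Qed.

Section Inverse.
Variables (F : CC -> CC) (p : CC) (L Li : CC -> CC) (D K : R).
Hypothesis PD : (0 < D)%R.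
Hypothesis PK : (0 < K)%R.
Hypothesis LLi : is_linear Li.
Hypothesis LiL : forall v, Li (L v) = v.
Hypothesis LLinv : forall v, L (Li v) = v.
Hypothesis boundLi : forall v, (norm (Li v) <= K * norm v)%R.
Hypothesis strict : forall z z' : CC, (norm (minus z p) < D)%R -> (norm (minus z' p) < D)%R ->
  (norm (minus (minus (F z') (F z)) (L (minus z' z))) <= / (2 * K) * norm (minus z' z))%R.

(** Since [Li] inverts [L], the left side is up to sign [Li] applied to the strict remainder; the
    constant / (2 K) in [strict] is chosen so that z -> z - Li (F z) contracts by 1/2. *)
Lemma newton_contract (z z' : CC) : (norm (minus z p) < D)%R -> (norm (minus z' p) < D)%R ->
  (norm (minus (minus z' z) (Li (minus (F z') (F z)))) <= / 2 * norm (minus z' z))%R.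
Proof.
  intros Hz Hz'. pose proof (strict z z' Hz Hz') as H.
  rewrite norm_minus_sym.
  assert (E : minus (Li (minus (F z') (F z))) (minus z' z) = Li (minus (minus (F z') (F z)) (L (minus z' z)))).
  { rewrite <- (LiL (minus z' z)) at 1. symmetry. exact (linear_minus Li _ _ LLi). }
  rewrite E. eapply Rle_trans; [apply boundLi|].
  apply (Rmult_le_compat_l K) in H; [|lra]. eapply Rle_trans; [exact H|]. right. field. lra.
Qed.

Lemma inverse_lipschitz (z z' : CC) : (norm (minus z p) < D)%R -> (norm (minus z' p) < D)%R ->
  (norm (minus z' z) <= 2 * K * norm (minus (F z') (F z)))%R.
Proof.
  intros Hz Hz'. pose proof (newton_contract z z' Hz Hz') as H.
  pose proof (boundLi (minus (F z') (F z))) as B.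
  pose proof (norm_triangle_inv (minus z' z) (Li (minus (F z') (F z)))) as T. 
  pose proof (Rle_abs (norm (minus z' z) - norm (Li (minus (F z') (F z))))) as A.
  assert (norm (minus z' z) - norm (Li (minus (F z') (F z))) <= / 2 * norm (minus z' z))%R by
    (eapply Rle_trans; [exact A|eapply Rle_trans; [exact T|exact H]]).
  lra.
Qed.

(** Newton's iteration with the derivative frozen at [p]. Its first step has length c0 <= K |w - F
    p| and the step bounds halve, so the iterates stay within 2 c0 of [p]; the hypothesis leaves
    room for the cruder bound 8 c0 on the limit. *)
Lemma newton_solve (w : CC) : (8 * (K * norm (minus w (F p))) < D)%R ->
  exists z, (norm (minus z p) < D)%R /\ F z = w.
Proof.
  intros Hw. set (T := fun z : CC => plus z (Li (minus w (F z))) : CC).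
  assert (HT : forall z z' : CC, (norm (minus z p) < D)%R -> (norm (minus z' p) < D)%R ->
    (norm (minus (T z') (T z)) <= / 2 * norm (minus z' z))%R).
  { intros z z' Hz Hz'. eapply Rle_trans; [|apply newton_contract; auto]. right. f_equal. unfold T.
    assert (E1 : Li (minus w (F z)) = minus (Li w) (Li (F z))) by exact (linear_minus Li _ _ LLi).
    assert (E2 : Li (minus w (F z')) = minus (Li w) (Li (F z'))) by exact (linear_minus Li _ _ LLi).
    assert (E3 : Li (minus (F z') (F z)) = minus (Li (F z')) (Li (F z))) by exact (linear_minus Li _ _ LLi).
    rewrite E1, E2, E3. generalize (Li w) (Li (F z)) (Li (F z')). intros [a1 a2] [b1 b2] [c1 c2].
    destruct z as [z1 z2], z' as [z1' z2']. c2ring. }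
  set (c0 := norm (Li (minus w (F p)))).
  assert (Pc : (0 <= c0)%R) by apply norm_ge_0.
  assert (Hc : (8 * c0 < D)%R).
  { eapply Rle_lt_trans; [|exact Hw]. apply Rmult_le_compat_l; [lra|]. apply boundLi. }
  set (u := fix u n := match n with O => p | S m => T (u m) end).
  assert (P2 : forall n, (0 < 2 ^ n)%R) by (intros; apply pow_lt; lra).
  assert (Hu : forall n, (norm (minus (u n) p) <= 2 * c0 - 2 * c0 / 2 ^ n)%R /\ (norm (minus (u (S n)) (u n)) <= c0 / 2 ^ n)%R).
  { induction n as [|n [IH1 IH2]].
    - simpl u. simpl pow. rewrite norm_minus_diag. split; [right; field|].
      unfold T. rewrite minus_plus_l. fold c0. right; field.
    - assert (Hn1 : (norm (minus (u (S n)) p) <= 2 * c0 - 2 * c0 / 2 ^ S n)%R).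
      { eapply Rle_trans; [apply (norm_minus_trans _ (u n))|].
        replace (2 * c0 / 2 ^ S n)%R with (c0 / 2 ^ n)%R by (simpl; field; specialize (P2 n); lra).
        replace (2 * c0 / 2 ^ n)%R with (c0 / 2 ^ n + c0 / 2 ^ n)%R in IH1 by (field; specialize (P2 n); lra). lra. }
      split; auto.
      assert (Q : forall m, (0 <= 2 * c0 / 2 ^ m)%R) by (intros m; apply Rdiv_le_0_compat; [lra|auto]).
      pose proof (Q n). pose proof (Q (S n)).
      eapply Rle_trans; [apply (HT (u n) (u (S n))); lra|].
      apply (Rmult_le_compat_l (/ 2)) in IH2; [|lra]. eapply Rle_trans; [exact IH2|]. right. simpl. field. specialize (P2 n); lra. }
  destruct (geometric_limit_CC u c0 Pc (fun n => proj2 (Hu n))) as [z Hz].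
  assert (Hzp : (norm (minus z p) < D)%R).
  { specialize (Hz 0%nat). simpl in Hz. rewrite norm_minus_sym. eapply Rle_lt_trans; [exact Hz|]. lra. }
  assert (Hup : forall n, (norm (minus (u n) p) < D)%R).
  { intros n. destruct (Hu n) as [H _]. assert (0 <= 2 * c0 / 2 ^ n)%R by (apply Rdiv_le_0_compat; [lra|auto]). lra. }
  (* Both [T z] and [z] are close to [u (S n)], the former by contraction, with bounds that together
     stay below 8 c0 / 2^n. *)
  assert (HTz : T z = z).
  { apply minus_zero_eq. apply Rle_antisym; [|apply norm_ge_0]. apply Rnot_lt_le. intros Hpos.
    destruct (pow2_div_lt (8 * c0) (norm (minus (T z) z)) Hpos) as [n Hn].
    pose proof (norm_minus_trans (T z) (u (S n)) z) as H1.
    pose proof (HT (u n) z (Hup n) Hzp) as H2. change (T (u n)) with (u (S n)) in H2.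
    rewrite (norm_minus_sym z (u n)) in H2.
    pose proof (Hz n) as H3. pose proof (Hz (S n)) as H4.
    replace (8 * c0 / 2 ^ S n)%R with (/ 2 * (8 * c0 / 2 ^ n))%R in H4 by (simpl; field; specialize (P2 n); lra).
    lra. }
  exists z. split; auto.
  assert (E : Li (minus w (F z)) = zero).
  { rewrite <- (minus_plus_l z (Li (minus w (F z)))). change (plus z (Li (minus w (F z)))) with (T z). rewrite HTz.
    exact (minus_eq_zero (G := NormedModule.AbelianGroup C_AbsRing CC) z). }
  symmetry. apply minus_zero_eq. rewrite <- (LLinv (minus w (F z))), E.
  assert (E0 : L zero = zero).
  { transitivity (L (Li zero)); [f_equal; symmetry; exact (linear_zero Li LLi)|apply LLinv]. }
  rewrite E0. exact norm_zero.
Qed.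
End Inverse.

Theorem inverse_function (F : CC -> CC) (p : CC) (L : CC -> CC) : holo_near F p ->
  filterdiff F (locally p) L -> (forall v, L v = origin -> v = origin) -> biholo_germ F p (F p).
Proof.
  intros HF HL Hinj. pose proof (proj1 HL) as LL.
  destruct (linear_CC_inverse L LL (det2_inj L LL Hinj)) as [Li [LLi [LiL LLinv]]].
  destruct (linear_norm Li LLi) as [K [PK boundLi]].
  assert (PK2 : (0 < / (2 * K))%R) by (apply Rinv_0_lt_compat; lra).
  destruct (holo_near_strict_CC F p L HF HL _ PK2) as [d [Hd Hs]].
  destruct (proj1 (locally_norm_iff _ _) HF) as [d1 [Hd1 Hhol]].
  (* Half of the radius, because differences of two points within [D] of [p] have norm below 2 D. *)
  set (D := (Rmin d d1 / 2)%R). assert (Hm : (0 < Rmin d d1)%R) by now apply Rmin_pos.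
  assert (PD : (0 < D)%R) by (unfold D; lra).
  assert (HDd : (2 * D <= d)%R) by (pose proof (Rmin_l d d1); unfold D; lra).
  assert (HDd1 : (2 * D <= d1)%R) by (pose proof (Rmin_r d d1); unfold D; lra).
  assert (strict : forall z z' : CC, (norm (minus z p) < D)%R -> (norm (minus z' p) < D)%R ->
    (norm (minus (minus (F z') (F z)) (L (minus z' z))) <= / (2 * K) * norm (minus z' z))%R).
  { intros z z' Hz Hz'. pose proof (Hs z (minus z' z)) as H. rewrite plus_minus_r in H. apply H; [lra|].
    pose proof (norm_minus_trans z' p z). rewrite (norm_minus_sym p z) in H0. lra. }
  clearbody D. clear Hs.
  pose proof (inverse_lipschitz F p L Li D K PK LLi LiL boundLi strict) as Lip.
  pose proof (newton_solve F p L Li D K PD PK LLi LiL LLinv boundLi strict) as Sol.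
  (* [G] chooses a preimage within [D] of [p], unique by [Lip]; where there is none its value is
     arbitrary. *)
  set (G := fun w : CC => epsilon (inhabits p) (fun z => (norm (minus z p) < D)%R /\ F z = w)).
  assert (HG : forall w, (exists z, (norm (minus z p) < D)%R /\ F z = w) -> (norm (minus (G w) p) < D)%R /\ F (G w) = w).
  { intros w Hw. apply (epsilon_spec (inhabits p) (fun z => (norm (minus z p) < D)%R /\ F z = w) Hw). }
  clearbody G.
  assert (Hinj' : forall z z', (norm (minus z p) < D)%R -> (norm (minus z' p) < D)%R -> F z = F z' -> z' = z).
  { intros z z' Hz Hz' E. apply minus_zero_eq. pose proof (Lip z z' Hz Hz') as H. rewrite E in H.
    rewrite norm_minus_diag in H. pose proof (norm_ge_0 (minus z' z)). lra. }
  assert (HGF : forall z, (norm (minus z p) < D)%R -> G (F z) = z).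
  { intros z Hz. destruct (HG (F z)) as [A B]; [exists z; auto|]. apply (Hinj' z); auto. }
  set (eta := (D / (8 * K))%R). assert (Peta : (0 < eta)%R) by (unfold eta; apply Rdiv_lt_0_compat; lra).
  assert (HGw : forall w, (norm (minus w (F p)) < eta)%R -> (norm (minus (G w) p) < D)%R /\ F (G w) = w).
  { intros w Hw. apply HG, Sol. apply (Rmult_lt_compat_l (8 * K)) in Hw; [|lra].
    replace (8 * K * eta)%R with D in Hw by (unfold eta; field; lra). lra. }
  assert (Hp0 : (norm (minus p p) < D)%R) by now rewrite norm_minus_diag.
  split; [reflexivity|split; [exact HF|]]. exists G. split; [apply HGF; auto|split; [|split]].
  - apply locally_norm_iff. exists eta. split; auto. intros w Hw.
    destruct (HGw w Hw) as [Hz Ez]. set (z := G w) in *.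
    destruct (Hhol z ltac:(lra)) as [Lz HLz]. pose proof (proj1 HLz) as LLz.
    pose proof (proj1 (filterdiff_eps _ _ _) HLz) as [_ HLzeps].
    (* Injectivity is given at [p] only. At [z] it follows from [Lip]: along a short kernel vector
       v' the map would move by at most |v'| / (4 K), whereas [Lip] demands at least |v'| / (2
       K). *)
    assert (Hiz : forall v, Lz v = origin -> v = origin).
    { intros v Hv. apply (norm_eq_zero (v : CC)). apply Rle_antisym; [|apply norm_ge_0]. apply Rnot_lt_le. intros Pv.
      destruct (HLzeps (/ (4 * K))%R) as [dd [Hdd HH]]; [apply Rinv_0_lt_compat; lra|].
      set (g := (D - norm (minus z p))%R). assert (Pg : (0 < g)%R) by (unfold g; lra).
      set (t := (Rmin dd g / 2 / norm v)%R). assert (Pm : (0 < Rmin dd g)%R) by now apply Rmin_pos.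
      assert (Pt : (0 < t)%R) by (unfold t; apply Rdiv_lt_0_compat; lra).
      assert (Ht0 : RtoC t <> 0) by (intros E; apply RtoC_inj in E; lra).
      set (v' := scal (RtoC t) v : CC).
      assert (Nv' : (norm v' <= Rmin dd g / 2)%R).
      { eapply Rle_trans; [apply norm_scal_C|]. rewrite Cmod_R, Rabs_pos_eq by lra. unfold t. right; field. lra. }
      pose proof (Rmin_l dd g). pose proof (Rmin_r dd g).
      specialize (HH v' ltac:(lra)).
      assert (Ev' : Lz v' = zero).
      { transitivity (scal (RtoC t) (Lz v)); [exact (linear_scal Lz LLz (RtoC t) v)|]. rewrite Hv.
        change (@eq (C * C) (t * 0, t * 0) (RtoC 0, RtoC 0)). f_equal; ring. }
      assert (HH0 : (norm (minus (F (plus z v')) (F z)) <= / (4 * K) * norm v')%R).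
      { eapply Rle_trans; [|exact HH]. rewrite Ev'. right; f_equal; symmetry.
        exact (minus_zero_r (G := NormedModule.AbelianGroup C_AbsRing CC) _). }
      clear HH. rename HH0 into HH.
      assert (Hz' : (norm (minus (plus z v') p) < D)%R).
      { eapply Rle_lt_trans; [apply norm_minus_plus|]. unfold g in *; lra. }
      pose proof (Lip z (plus z v') Hz Hz') as HL1. rewrite minus_plus_l in HL1.
      apply (Rmult_le_compat_l (2 * K)) in HH; [|lra].
      replace (2 * K * (/ (4 * K) * norm v'))%R with (norm v' / 2)%R in HH by (field; lra).
      assert (Nv0 : (norm v' <= 0)%R) by lra.
      assert (Zv : v' = zero) by (apply norm_eq_zero; apply Rle_antisym; [exact Nv0|apply norm_ge_0]).
      assert (Z : v = scal (/ RtoC t) v').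
      { unfold v'. destruct v as [v1 v2].
        change (@eq (C * C) (v1, v2) (/ t * (t * v1), / t * (t * v2))).
        apply injective_projections; cbn [fst snd]; refine (_ : @eq C _ _); symmetry; field; auto. }
      rewrite Zv in Z. 
      assert (norm v = 0)%R; [|lra].
      rewrite Z. apply Rle_antisym; [|apply norm_ge_0]. eapply Rle_trans; [apply norm_scal_C|].
      rewrite norm_zero. lra. }
    destruct (linear_CC_inverse Lz LLz (det2_inj Lz LLz Hiz)) as [Lzi [LLzi [LziL _]]].
    destruct (linear_norm Lzi LLzi) as [Kz [PKz boundLzi]].
    exists Lzi. apply filterdiff_eps. split; auto. intros eps He.
    (* [G] moves by at most 2 K |y| and [Lzi] multiplies norms by at most [Kz]; the tolerance
       compensates for both factors. *)
    destruct (HLzeps (eps / (Kz * (2 * K)))%R) as [dd [Hdd HH]].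
    { apply Rdiv_lt_0_compat; auto. apply Rmult_lt_0_compat; lra. }
    exists (Rmin (eta - norm (minus w (F p))) (dd / (2 * K))). split.
    { apply Rmin_pos; [lra|apply Rdiv_lt_0_compat; lra]. }
    intros y Hy. apply lt_Rmin in Hy. destruct Hy as [Hy1 Hy2].
    destruct (HGw (plus w y)) as [Hz' Ez'].
    { eapply Rle_lt_trans; [apply norm_minus_plus|]. lra. }
    fold z. set (z' := G (plus w y)) in *.
    pose proof (Lip z z' Hz Hz') as HL1. rewrite Ez, Ez', minus_plus_l in HL1.
    assert (Hdz : (norm (minus z' z) < dd)%R).
    { eapply Rle_lt_trans; [exact HL1|]. apply (Rmult_lt_compat_l (2 * K)) in Hy2; [|lra].
      replace (2 * K * (dd / (2 * K)))%R with dd in Hy2 by (field; lra). exact Hy2. }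
    specialize (HH (minus z' z) Hdz). rewrite plus_minus_r, Ez, Ez', minus_plus_l in HH.
    assert (E : minus (Lzi y) (minus z' z) = Lzi (minus y (Lz (minus z' z)))).
    { rewrite <- (LziL (minus z' z)) at 1. symmetry. exact (linear_minus Lzi _ _ LLzi). }
    rewrite norm_minus_sym, E. eapply Rle_trans; [apply boundLzi|].
    apply (Rmult_le_compat_l Kz) in HH; [|lra]. eapply Rle_trans; [exact HH|].
    replace (Kz * (eps / (Kz * (2 * K)) * norm (minus z' z)))%R with (eps / (2 * K) * norm (minus z' z))%R by (field; lra).
    replace (eps * norm y)%R with (eps / (2 * K) * (2 * K * norm y))%R by (field; lra).
    apply Rmult_le_compat_l; auto. left. apply Rdiv_lt_0_compat; lra.
  - apply locally_norm_iff. exists D. split; auto.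
  - apply locally_norm_iff. exists eta. split; auto. intros w Hw. apply (HGw w Hw).
Qed.

(** * Polynomial maps *)

Lemma sumC_app l1 l2 : sumC (l1 ++ l2) = sumC l1 + sumC l2.
Proof.
  induction l1 as [|x l IH].
  - change (sumC l2 = 0 + sumC l2). ring.
  - change (x + sumC (l ++ l2) = x + sumC l + sumC l2). rewrite IH. ring.
Qed.

Lemma sum_lt_S n a : sum_lt (S n) a = sum_lt n a + a n.
Proof. unfold sum_lt. rewrite seq_S, map_app, sumC_app.
  change (sumC (map a (seq 0 n)) + (a n + 0) = sumC (map a (seq 0 n)) + a n). ring. Qed.

Lemma sum_lt_ext n (a b : nat -> C) : (forall i, (i < n)%nat -> a i = b i) -> sum_lt n a = sum_lt n b.
Proof. induction n as [|n IH]; intros H; [reflexivity|]. rewrite !sum_lt_S, IH, H; auto. Qed.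

Lemma sum_lt_plus n (a b : nat -> C) : sum_lt n (fun i => a i + b i) = sum_lt n a + sum_lt n b.
Proof. induction n as [|n IH]; [unfold sum_lt, sumC; simpl; ring|]. rewrite !sum_lt_S, IH. ring. Qed.

Lemma sum_lt_mult_r n (a : nat -> C) (c : C) : sum_lt n (fun i => a i * c) = sum_lt n a * c.
Proof. induction n as [|n IH]; [unfold sum_lt, sumC; simpl; ring|]. rewrite !sum_lt_S, IH. ring. Qed.

(** Reindexing after differentiation: the term of index 0 carries the factor 0, and the top term of
    the shifted sum carries a coefficient of degree above d. Hence [pdx] and [pdy] can be evaluated
    with the same bound [d]. *)
Lemma sum_lt_shift n (a b : nat -> C) : a 0%nat = 0 -> b n = 0 -> (forall i, a (S i) = b i) -> sum_lt (S n) a = sum_lt (S n) b.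
Proof.
  intros Ha Hb H. rewrite (sum_lt_S n b), Hb. clear Hb. induction n as [|n IH].
  - unfold sum_lt, sumC; simpl. rewrite Ha. ring.
  - rewrite sum_lt_S, IH, H, (sum_lt_S n b). ring.
Qed.

Lemma filterdiff_sum_lt {U : NormedModule C_AbsRing} n (f l : nat -> U -> C) z :
  (forall i, diffC (f i) z (l i)) ->
  diffC (fun y => sum_lt n (fun i => f i y)) z (fun v => sum_lt n (fun i => l i v)).
Proof.
  intros H. induction n as [|n IH].
  - apply (filterdiff_ext (V := CN) (fun _ => zero)); [reflexivity|].
    apply (filterdiff_ext_lin (V := CN) _ (fun _ => zero)); [apply filterdiff_const|reflexivity].
  - apply (filterdiff_ext (V := CN) (fun y => plus (sum_lt n (fun i => f i y) : CN) (f n y))).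
    { intros y. rewrite sum_lt_S. reflexivity. }
    eapply filterdiff_ext_lin.
    + apply (filterdiff_plus_fct (V := CN)); [apply IH|apply H].
    + intros v. rewrite sum_lt_S. reflexivity.
Qed.

Lemma filterdiff_pow {U : NormedModule C_AbsRing} n (f l : U -> C) z :
  diffC f z l ->
  diffC (fun y => pow_n (f y) n) z (fun v => RtoC (INR n) * pow_n (f z) (pred n) * l v).
Proof.
  intros H. induction n as [|n IH].
  - apply (filterdiff_ext_lin (V := CN) _ (fun _ => zero));
      [exact (filterdiff_const (V := CN) (one : C))|].
    intros v. simpl. change (RtoC 0 = 0 * one * l v). refine (_ : @eq C _ _); ring.
  - eapply filterdiff_ext_lin; [exact (filterdiff_cmult _ _ _ _ _ H IH)|].
    intros v. cbv beta. rewrite S_INR, RtoC_plus. simpl pred. destruct n as [|n].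
    + change (l v * one + f z * (RtoC 0 * one * l v) = (RtoC 0 + 1) * one * l v). change (@one C_Ring) with (RtoC 1). refine (_ : @eq C _ _); ring.
    + simpl pred. change (pow_n (f z) (S n)) with (f z * pow_n (f z) n). refine (_ : @eq C _ _); ring.
Qed.

Lemma filterdiff_peval d c (z : CC) : deg_le d c ->
  diffC (peval d c) z (fun v => peval d (pdx c) z * fst v + peval d (pdy c) z * snd v).
Proof.
  intros Hd.
  assert (Hx : diffC (fun y => fst y) z (fun v => fst v)).
  { apply filterdiff_linear, (is_linear_fst (U := CN) (V := CN)). }
  assert (Hy : diffC (fun y => snd y) z (fun v => snd v)).
  { apply filterdiff_linear, (is_linear_snd (U := CN) (V := CN)). }
  eapply filterdiff_ext_lin.
  - unfold peval. apply (filterdiff_sum_lt (U := CC)). intros i. apply (filterdiff_sum_lt (U := CC)). intros j.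
    apply (filterdiff_cmult (U := CC) (fun y => c i j * pow_n (fst y) i) (fun y => pow_n (snd y) j)).
    + apply (filterdiff_cmult (U := CC) (fun _ => c i j)); [|apply (filterdiff_pow (U := CC)); exact Hx].
      apply (filterdiff_const (U := CC) (V := CN)).
    + apply (filterdiff_pow (U := CC)); exact Hy.
  - intros [u v]. destruct z as [x y]. cbn [fst snd]. change (@zero CN) with (RtoC 0).
    unfold peval. cbn [fst snd].
    transitivity (sum_lt (S d) (fun i => sum_lt (S d) (fun j => RtoC (INR i) * c i j * pow_n x (pred i) * pow_n y j)) * u
       + sum_lt (S d) (fun i => sum_lt (S d) (fun j => RtoC (INR j) * c i j * pow_n x i * pow_n y (pred j))) * v).
    + rewrite <- !sum_lt_mult_r, <- sum_lt_plus. apply sum_lt_ext. intros i _.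
      rewrite <- !sum_lt_mult_r, <- sum_lt_plus. apply sum_lt_ext. intros j _. ring.
    + apply (f_equal2 Cplus); apply (f_equal2 Cmult); try reflexivity.
      * refine (sum_lt_shift d _ _ _ _ _).
        -- rewrite (sum_lt_ext _ _ (fun _ => 0 * 0)); [rewrite sum_lt_mult_r; ring|]. intros j _. simpl. ring.
        -- rewrite (sum_lt_ext _ _ (fun _ => 0 * 0)); [rewrite sum_lt_mult_r; ring|]. intros j _. unfold pdx.
           rewrite (Hd (S d) j) by lia. ring.
        -- intros i. apply sum_lt_ext. intros j _. unfold pdx. simpl pred. reflexivity.
      * apply sum_lt_ext. intros i _. refine (sum_lt_shift d _ _ _ _ _).
        -- simpl. ring.
        -- unfold pdy. rewrite (Hd i (S d)) by lia. ring.
        -- intros j. unfold pdy. simpl pred. ring.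
Qed.

Lemma deg_le_pdx d c : deg_le d c -> deg_le d (pdx c).
Proof. intros H i j Hij. unfold pdx. rewrite H by lia. ring. Qed.

Lemma deg_le_pdy d c : deg_le d c -> deg_le d (pdy c).
Proof. intros H i j Hij. unfold pdy. rewrite H by lia. ring. Qed.

Definition dpmap d1 d2 cf cg (z : C2) (v : C2) : C2 :=
  (peval d1 (pdx cf) z * fst v + peval d1 (pdy cf) z * snd v,
   peval d2 (pdx cg) z * fst v + peval d2 (pdy cg) z * snd v).

Lemma filterdiff_pmap d1 d2 cf cg (z : C2) : deg_le d1 cf -> deg_le d2 cg ->
  filterdiff (U := CC) (V := CC) (pmap d1 d2 cf cg) (locally (z : CC)) (dpmap d1 d2 cf cg z).
Proof.
  intros Hf Hg. apply (filterdiff_pair (U := CC) (V := CN) (W := CN)); apply filterdiff_peval; auto.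
Qed.

Lemma det2_dpmap d1 d2 cf cg z : det2 (dpmap d1 d2 cf cg z) = jac d1 d2 cf cg z.
Proof. unfold det2, dpmap, jac, e1, e2. cbn [fst snd]. ring. Qed.

Lemma hol_jac d1 d2 cf cg (z : C2) : deg_le d1 cf -> deg_le d2 cg ->
  hol (U := CC) (V := CN) (jac d1 d2 cf cg) z.
Proof.
  intros Hf Hg. unfold jac.
  assert (H : forall d c, deg_le d c -> hol (U := CC) (V := CN) (peval d c) z).
  { intros d c Hc. eexists. apply filterdiff_peval, Hc. }
  apply (hol_minus (U := CC)); apply (hol_mult (U := CC)); apply H; auto using deg_le_pdx, deg_le_pdy.
Qed.

(** * Germs of holomorphic functions *)

Section HoloNear.
Context {U V W : NormedModule C_AbsRing}.
Implicit Type p : U.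

Lemma holo_near_hol (f : U -> V) p : holo_near f p -> hol f p.
Proof. intros H. exact (locally_singleton p _ H). Qed.

Lemma hol_holo_near (f : U -> V) p : (forall z, hol f z) -> holo_near f p.
Proof. intros H. unfold holo_near. apply filter_forall. exact H. Qed.

Lemma holo_near_cont (f : U -> V) p : holo_near f p -> filterlim f (locally p) (locally (f p)).
Proof. intros H. apply (filterdiff_continuous f p), holo_near_hol, H. Qed.

Lemma holo_near_comp (f : U -> V) (g : V -> W) p : holo_near f p -> holo_near g (f p) ->
  holo_near (fun z => g (f z)) p.
Proof.
  intros Hf Hg. pose proof (holo_near_cont f p Hf _ Hg) as Hc. unfold filtermap in Hc.
  generalize (filter_and _ _ Hf Hc). unfold holo_near. apply filter_imp. intros z [H1 H2]. exact (hol_comp f g z H1 H2).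
Qed.

Lemma holo_near_ext (f g : U -> V) p : locally p (fun z => f z = g z) -> holo_near f p -> holo_near g p.
Proof.
  intros E Hf. apply locally_locally in E. generalize (filter_and _ _ E Hf). unfold holo_near. apply filter_imp.
  intros z [Ez [l Hl]]. exists l. apply (filterdiff_ext_locally f); auto.
Qed.

Lemma holo_near_pair (f : U -> V) (g : U -> W) p : holo_near f p -> holo_near g p ->
  holo_near (V := prod_NormedModule C_AbsRing V W) (fun z => (f z, g z)) p.
Proof.
  intros Hf Hg. generalize (filter_and _ _ Hf Hg). unfold holo_near. apply filter_imp. intros z [[lf H1] [lg H2]].
  eexists. apply filterdiff_pair; eassumption.
Qed.

Lemma holo_near_linear (l : U -> V) p : is_linear l -> holo_near l p.
Proof. intros H. apply hol_holo_near. intros z. now apply hol_linear. Qed.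

Lemma holo_near_const (c : V) p : holo_near (fun _ => c) p.
Proof. apply hol_holo_near. intros z. apply hol_const. Qed.
End HoloNear.

Notation holoC f p := (holo_near (V := CN) f p).

Section HoloNearC.
Context {U : NormedModule C_AbsRing}.
Implicit Types (f g : U -> C) (p : U).

Lemma holo_near_plus f g p : holoC f p -> holoC g p -> holoC (fun z => f z + g z) p.
Proof.
  intros Hf Hg. generalize (filter_and _ _ Hf Hg). unfold holo_near. apply filter_imp. intros z [H1 H2]. now apply hol_plus.
Qed.

Lemma holo_near_minus f g p : holoC f p -> holoC g p -> holoC (fun z => f z - g z) p.
Proof.
  intros Hf Hg. generalize (filter_and _ _ Hf Hg). unfold holo_near. apply filter_imp. intros z [H1 H2]. now apply hol_minus.
Qed.

Lemma holo_near_mult f g p : holoC f p -> holoC g p -> holoC (fun z => f z * g z) p.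
Proof.
  intros Hf Hg. generalize (filter_and _ _ Hf Hg). unfold holo_near. apply filter_imp. intros z [H1 H2]. now apply hol_mult.
Qed.

Lemma filterdiff_unique_C f p l l' : diffC f p l ->
  diffC f p l' -> forall v, l v = l' v.
Proof.
  intros H H' v.
  assert (E0 : plus p (scal (RtoC 0) v) = p).
  { rewrite (scal_zero_l (K := C_Ring) v : scal (RtoC 0) v = zero). apply plus_zero_r. }
  apply (approx_unique (fun t => f (plus p (scal t v))) 0); apply filterdiff_line; rewrite E0; auto.
Qed.

Lemma holo_near_neq_0 f p : holoC f p -> f p <> 0 -> locally p (fun z => f z <> 0).
Proof.
  intros Hf H0. assert (P : (0 < Cmod (f p))%R) by now apply Cmod_gt_0.
  pose proof (proj1 (filterlim_locally_ball_norm (U := CN) f (f p)) (holo_near_cont _ _ Hf) (mkposreal _ P)) as H.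
  revert H. unfold holo_near. apply filter_imp. intros z Hz E. unfold ball_norm in Hz. simpl in Hz. rewrite E in Hz.
  change (Cmod (0 - f p) < Cmod (f p))%R in Hz. rewrite Cmod_minus_sym in Hz.
  replace (f p - 0) with (f p) in Hz by ring. lra.
Qed.

Lemma holo_near_inv f p : f p <> 0 -> holoC f p -> holoC (fun z => / f z) p.
Proof.
  intros H0 Hf. generalize (filter_and _ _ Hf (holo_near_neq_0 f p Hf H0)). unfold holo_near. apply filter_imp.
  intros z [H1 H2]. now apply hol_inv.
Qed.
End HoloNearC.

Lemma holo_near_fst {U V W : NormedModule C_AbsRing} (f : U -> prod_NormedModule C_AbsRing V W) p :
  holo_near f p -> holo_near (fun z => fst (f z)) p.
Proof.
  intros H. apply (holo_near_comp f fst); auto. apply holo_near_linear, is_linear_fst.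
Qed.

Lemma holo_near_snd {U V W : NormedModule C_AbsRing} (f : U -> prod_NormedModule C_AbsRing V W) p :
  holo_near f p -> holo_near (fun z => snd (f z)) p.
Proof.
  intros H. apply (holo_near_comp f snd); auto. apply holo_near_linear, is_linear_snd.
Qed.

(** * Holomorphic square roots *)

Lemma Csqrt_exists (u : C) : exists z : C, z * z = u.
Proof.
  destruct u as [x y]. set (m := sqrt (x ^ 2 + y ^ 2)).
  assert (Hq : (0 <= x ^ 2 + y ^ 2)%R) by nra.
  assert (Hm : (m * m = x ^ 2 + y ^ 2)%R) by (apply sqrt_sqrt; auto).
  assert (Hm0 : (0 <= m)%R) by apply sqrt_pos.
  assert (Hx : (Rabs x <= m)%R) by (rewrite <- sqrt_Rsqr_abs; apply sqrt_le_1_alt; unfold Rsqr; nra).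
  pose proof (Rle_abs x). pose proof (Rle_abs (- x)). rewrite Rabs_Ropp in H0.
  set (s := sqrt ((m + x) / 2)). set (t := sqrt ((m - x) / 2)).
  assert (Hs : (s * s = (m + x) / 2)%R) by (apply sqrt_sqrt; lra).
  assert (Ht : (t * t = (m - x) / 2)%R) by (apply sqrt_sqrt; lra).
  assert (Hst : (s * t = Rabs y / 2)%R).
  { unfold s, t. rewrite <- sqrt_mult by lra.
    replace ((m + x) / 2 * ((m - x) / 2))%R with ((Rabs y / 2) * (Rabs y / 2))%R.
    - apply sqrt_square. pose proof (Rabs_pos y). lra.
    - replace (Rabs y / 2 * (Rabs y / 2))%R with ((Rabs y) ^ 2 / 4)%R by field. rewrite pow2_abs. nra. }
  destruct (Rle_dec 0 y).
  - exists (s, t). unfold Cmult; simpl. rewrite Rabs_pos_eq in Hst by auto. f_equal; lra.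
  - exists (s, - t)%R. unfold Cmult; simpl. rewrite Rabs_left in Hst by lra. f_equal; lra.
Qed.

Lemma CC_eq_origin (v : C2) : fst v = 0 -> snd v = 0 -> v = origin.
Proof. intros H1 H2. apply injective_projections; auto. Qed.

(** A one-dimensional inverse is read off from the two-dimensional theorem: [fold1] is locally
    invertible at (z0, 0) when z0^2 = u0 is nonzero, and the first coordinate of its inverse at (u,
    0) is a square root of [u]. *)
Lemma holo_sqrt (u0 : C) : u0 <> 0 -> exists sg : C -> C,
  holo_near (U := CN) (V := CN) sg u0 /\
  locally (u0 : CN) (fun u => sg u * sg u = u).
Proof.
  intros H0. destruct (Csqrt_exists u0) as [z0 Hz0].
  assert (Hz : z0 <> 0) by (intros E; apply H0; rewrite <- Hz0, E; ring).
  set (p := (z0, RtoC 0) : CC).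
  assert (Hx : forall z : CC, diffC (fun y => fst y) z (fun v => fst v)).
  { intros z. apply filterdiff_linear, (is_linear_fst (U := CN) (V := CN)). }
  assert (Hy : forall z : CC, diffC (fun y => snd y) z (fun v => snd v)).
  { intros z. apply filterdiff_linear, (is_linear_snd (U := CN) (V := CN)). }
  assert (Hd : forall z : CC, filterdiff (U := CC) (V := CC) fold1 (locally z) (fun v => (fst v * fst z + fst z * fst v, snd v))).
  { intros z. apply (filterdiff_pair (U := CC) (V := CN) (W := CN)); [|apply Hy].
    apply (filterdiff_cmult (U := CC)); apply Hx. }
  destruct (inverse_function fold1 p _ (hol_holo_near (U := CC) (V := CC) fold1 p (fun z => ex_intro _ _ (Hd z))) (Hd p)) as [_ [_ [G [_ [HG [_ HFG]]]]]].
  { intros v Hv. pose proof (f_equal fst Hv : fst v * z0 + z0 * fst v = RtoC 0) as H1.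
    pose proof (f_equal snd Hv : snd v = RtoC 0) as H2.
    apply CC_eq_origin; [|exact H2].
    assert (Kz : forall x : C, x * z0 + z0 * x = 0 -> x = 0).
    { intros x Ex. replace x with (/ (RtoC 2 * z0) * (x * z0 + z0 * x)).
      - rewrite Ex. ring.
      - field. auto. }
    apply Kz. exact H1. }
  assert (Ep : fold1 p = (u0, RtoC 0)) by (unfold fold1, p; cbn [fst snd]; now rewrite Hz0).
  rewrite Ep in HG, HFG.
  assert (Hi : holo_near (U := CN) (V := CC) (fun u : C => (u, RtoC 0)) u0).
  { apply (holo_near_pair (U := CN) (V := CN) (W := CN)).
    - apply hol_holo_near. intros z. apply hol_id.
    - apply holo_near_const. }
  exists (fun u => fst (G (u, RtoC 0))). split.
  - apply (holo_near_fst (U := CN) (V := CN) (W := CN)).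
    exact (holo_near_comp (U := CN) (V := CC) (W := CC) _ G u0 Hi HG).
  - pose proof (holo_near_cont (U := CN) (V := CC) _ _ Hi _ HFG) as Hc. unfold filtermap in Hc.
    revert Hc. unfold holo_near. apply filter_imp. intros u E. exact (f_equal fst E).
Qed.

(** * Normal form of a fold *)

Lemma det2_comp (A T : CC -> CC) : is_linear A -> det2 (fun v => A (T v)) = det2 A * det2 T.
Proof.
  intros HA. unfold det2. rewrite (linear_CC_coord A HA (T e1)), (linear_CC_coord A HA (T e2)). cbn [fst snd].
  refine (_ : @eq C _ _). ring.
Qed.

Lemma norm_e1 : (norm e1 <= 1)%R.
Proof. eapply Rle_trans; [apply norm_CC_le|]. unfold e1; cbn [fst snd]. rewrite Cmod_1, Cmod_0. lra. Qed.

Lemma norm_e2 : (norm e2 <= 1)%R.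
Proof. eapply Rle_trans; [apply norm_CC_le|]. unfold e2; cbn [fst snd]. rewrite Cmod_1, Cmod_0. lra. Qed.

Lemma det2_bound (L : CC -> CC) (B : R) : (forall v, (Cmod (fst (L v)) <= B * norm v)%R) ->
  (forall v, (Cmod (snd (L v)) <= B * norm v)%R) -> (0 <= B)%R -> (Cmod (det2 L) <= 2 * B ^ 2)%R.
Proof.
  intros H1 H2 HB.
  assert (K : forall (x y : C), (Cmod x <= B)%R -> (Cmod y <= B)%R -> (Cmod (x * y) <= B ^ 2)%R).
  { intros x y Hx Hy. rewrite Cmod_mult. replace (B ^ 2)%R with (B * B)%R by ring.
    apply Rmult_le_compat; auto using Cmod_ge_0. }
  assert (N : forall v : CC, (norm v <= 1)%R -> (Cmod (fst (L v)) <= B)%R /\ (Cmod (snd (L v)) <= B)%R).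
  { intros v Hv. specialize (H1 v). specialize (H2 v).
    assert (B * norm v <= B)%R by (rewrite <- (Rmult_1_r B) at 2; apply Rmult_le_compat_l; auto). split; lra. }
  unfold det2. destruct (N e1 norm_e1), (N e2 norm_e2).
  eapply Rle_trans; [apply Cmod_minus_le|].
  pose proof (K (fst (L e1)) (snd (L e2)) ltac:(auto) ltac:(auto)).
  pose proof (K (fst (L e2)) (snd (L e1)) ltac:(auto) ltac:(auto)). lra.
Qed.

Lemma det2_deriv_bound (F : CC -> CC) (p : CC) : holo_near F p ->
  exists B : R, (0 < B)%R /\ locally p (fun z => forall L, filterdiff F (locally z) L -> (Cmod (det2 L) <= B)%R).
Proof.
  intros HF.
  destruct (holo_near_deriv_bounded _ _ (holo_near_fst (V := CN) (W := CN) F p HF)) as [d1 [B1 [Hd1 [HB1 K1]]]].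
  destruct (holo_near_deriv_bounded _ _ (holo_near_snd (V := CN) (W := CN) F p HF)) as [d2 [B2 [Hd2 [HB2 K2]]]].
  set (B := (B1 + B2)%R). assert (HB : (0 < B)%R) by (unfold B; lra).
  exists (2 * B ^ 2)%R. split; [apply Rmult_lt_0_compat; [lra|apply pow_lt; auto]|].
  apply locally_norm_iff. exists (Rmin d1 d2). split; [now apply Rmin_pos|].
  intros z Hz LF HLF. apply lt_Rmin in Hz. destruct Hz as [Hn1 Hn2].
  assert (forall x v, (x <= B1 * @norm _ CC v \/ x <= B2 * @norm _ CC v)%R -> (x <= B * @norm _ CC v)%R).
  { intros x v H. pose proof (norm_ge_0 v). unfold B. nra. }
  apply det2_bound; [| |lra]; intros v; apply H.
  - left. exact (K1 z _ Hn1 (filterdiff_fst _ _ _ HLF) v).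
  - right. exact (K2 z _ Hn2 (filterdiff_snd _ _ _ HLF) v).
Qed.

Lemma filterdiff_unique_det2 (F : CC -> CC) p L L' : filterdiff F (locally p) L -> filterdiff F (locally p) L' ->
  det2 L = det2 L'.
Proof.
  intros H H'.
  pose proof (filterdiff_unique_C _ _ _ _ (filterdiff_fst _ _ _ H) (filterdiff_fst _ _ _ H')) as E1.
  pose proof (filterdiff_unique_C _ _ _ _ (filterdiff_snd _ _ _ H) (filterdiff_snd _ _ _ H')) as E2.
  cbv beta in E1, E2. unfold det2. now rewrite !E1, !E2.
Qed.

(* The derivative of the map itself is locally bounded, so the determinant of
   the derivative of a local inverse stays away from [0]. *)
Lemma det2_inverse_bound (F T : CC -> CC) (p q : CC) : holo_near F p -> T q = p -> holo_near T q ->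
  locally q (fun w => F (T w) = w) ->
  exists c : R, (0 < c)%R /\ locally q (fun w => forall Tw, filterdiff T (locally w) Tw -> (c <= Cmod (det2 Tw))%R).
Proof.
  intros HF Ep HT Hid. destruct (det2_deriv_bound F p HF) as [B [PB HB]].
  exists (/ B)%R. split; [now apply Rinv_0_lt_compat|].
  pose proof (holo_near_cont T q HT) as Hc. rewrite Ep in Hc.
  specialize (Hc _ (filter_and _ _ HB HF)). unfold filtermap in Hc.
  apply locally_locally in Hid.
  generalize (filter_and _ _ Hc Hid). apply filter_imp. intros w [[Hb [LF HLF]] Hw] Tw HTw.
  pose proof (filterdiff_comp' T F w Tw LF HTw HLF) as HC.
  assert (Hid' : filterdiff (fun y : CC => y) (locally w) (fun v => LF (Tw v))).
  { apply (filterdiff_ext_locally (fun y => F (T y))); auto. }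
  assert (ED : det2 LF * det2 Tw = 1).
  { rewrite <- (det2_comp LF Tw (proj1 HLF)).
    rewrite (filterdiff_unique_det2 _ _ _ _ Hid' (filterdiff_id (locally w))).
    unfold det2, e1, e2; cbn [fst snd]. ring. }
  apply (f_equal Cmod) in ED. rewrite Cmod_mult, Cmod_1 in ED.
  apply (Rmult_le_reg_l B); auto. rewrite Rinv_r by lra. rewrite <- ED.
  apply Rmult_le_compat_r; [apply Cmod_ge_0|auto].
Qed.

Section Fold.
Variables (f g J : CC -> C) (a : CC) (lJ lg : CC -> C) (kap : C).
Hypothesis Hf : holoC f a.
Hypothesis Hg : holoC g a.
Hypothesis HJ : holoC J a.
Hypotheses (f0 : f a = 0) (g0 : g a = 0) (J0 : J a = 0).
Hypothesis HlJ : diffC J a lJ.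
Hypothesis Hlg : diffC g a lg.
Hypothesis df0 : forall l : CC -> C, diffC f a l -> forall v, l v = 0.
Hypothesis inj : forall v, lJ v = 0 -> lg v = 0 -> v = origin.
Hypothesis kap0 : kap <> 0.
Hypothesis Hdet : locally a (fun z => forall lf lg : CC -> C, diffC f z lf ->
   diffC g z lg -> lf e1 * lg e2 - lf e2 * lg e1 = kap * J z).

Let O : CC := origin.

(** [al] describes the image of the fold curve: f = al(g) where J = 0. Its derivative at 0 vanishes
    because [f] is critical at [a]; this is what later keeps the linear part of the target
    coordinates unchanged. *)
Lemma fold_normal_form : exists (al : C -> C) (rho : CC -> C),
  holo_near (U := CN) (V := CN) al (RtoC 0) /\ al (RtoC 0) = 0 /\
  filterdiff (U := CN) (V := CN) al (locally (RtoC 0 : CN)) (fun _ => RtoC 0) /\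
  holoC rho a /\ rho a <> 0 /\
  locally a (fun z => f z - al (g z) = (J z * rho z) * (J z * rho z)).
Proof.
  set (Phi := fun z => (J z, g z) : CC).
  assert (HPhi : holo_near Phi a) by (apply (holo_near_pair (V := CN) (W := CN)); auto).
  assert (Pa : Phi a = O) by (unfold Phi; rewrite J0, g0; reflexivity).
  destruct (inverse_function Phi a _ HPhi (filterdiff_pair (V := CN) (W := CN) _ _ _ _ _ HlJ Hlg))
    as [_ [_ [Th [ThO [HTh [HThPhi HPhiTh]]]]]].
  { intros v Hv. apply inj; [exact (f_equal fst Hv)|exact (f_equal snd Hv)]. }
  rewrite Pa in ThO, HTh, HPhiTh.
  set (pi2 := fun w : CC => (RtoC 0, snd w) : CC).
  assert (Lpi : is_linear pi2).
  { apply (is_linear_prod (T := CC) (U := CN) (V := CN)).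
    - apply (is_linear_zero (U := CC) (V := CN)).
    - apply (is_linear_snd (U := CN) (V := CN)). }
  assert (piO : pi2 O = O) by reflexivity.
  set (f1 := fun w : CC => f (Th w)).
  assert (Hf1 : holoC f1 O) by (apply (holo_near_comp Th f); auto; now rewrite ThO).
  assert (Hf1pi : holoC (fun w => f1 (pi2 w)) O).
  { apply (holo_near_comp pi2 f1); [now apply holo_near_linear|now rewrite piO]. }
  set (h := fun w : CC => f1 w - f1 (pi2 w)).
  assert (Hh : holoC h O) by (apply holo_near_minus; auto).
  assert (Lfst : is_linear (U := CC) (V := CN) (fun w => fst w)) by apply (is_linear_fst (U := CN) (V := CN)).
  assert (Dfst : forall w : CC, diffC (fun w : CC => fst w) w (fun v => fst v)).
  { intros w. apply filterdiff_linear, Lfst. }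
  (* Determinants are multiplicative for (f, g) composed with [Th]. The second component of the
     composite is the coordinate [snd], so its determinant is the derivative of [f1] along [e1],
     which is that of [h]; the other side is kap J(Th w) det T with J(Th w) = fst w. *)
  assert (hA : locally O (fun w => forall Lh : CC -> C, diffC h w Lh ->
     exists T, filterdiff Th (locally w) T /\ Lh e1 = kap * fst w * det2 T)).
  { pose proof (holo_near_cont Th O HTh) as Hc. rewrite ThO in Hc.
    pose proof (Hc _ (filter_and _ _ Hdet (filter_and _ _ Hf Hg))) as Hc1. unfold filtermap in Hc1.
    apply locally_locally in HPhiTh.
    pose proof (holo_near_cont pi2 O (holo_near_linear pi2 O Lpi)) as Hcpi. rewrite piO in Hcpi.
    pose proof (Hcpi _ Hf1) as Hc2. unfold filtermap in Hc2.
    generalize (filter_and _ _ Hc1 (filter_and _ _ HPhiTh (filter_and _ _ HTh Hc2))). apply filter_imp.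
    intros w [[Hd [[lf Hlf] [lgw Hlgw]]] [Hid [[T HT] [l2 Hl2]]]] Lh HLh. exists T. split; auto.
    specialize (Hd lf lgw Hlf Hlgw).
    assert (EJ : J (Th w) = fst w) by exact (f_equal fst (locally_singleton _ _ Hid)). rewrite EJ in Hd. rewrite <- Hd.
    assert (D1 : diffC h w (fun v => minus (lf (T v)) (l2 (pi2 v)))).
    { apply (filterdiff_minus_fct (V := CN)).
      - exact (filterdiff_comp' Th f w T lf HT Hlf).
      - exact (filterdiff_comp' pi2 f1 w pi2 l2 (filterdiff_linear pi2 Lpi) Hl2). }
    assert (D2 : diffC (fun w : CC => snd w) w (fun v => lgw (T v))).
    { apply (filterdiff_ext_locally (V := CN) (fun w => g (Th w))).
      - revert Hid. apply filter_imp. intros y Hy. exact (f_equal snd Hy).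
      - exact (filterdiff_comp' Th g w T lgw HT Hlgw). }
    assert (D3 : forall v, lgw (T v) = snd v).
    { apply (filterdiff_unique_C (fun w : CC => snd w) w); auto.
      apply filterdiff_linear, (is_linear_snd (U := CN) (V := CN)). }
    rewrite (filterdiff_unique_C _ _ _ _ HLh D1 e1).
    assert (E0 : l2 (pi2 e1) = RtoC 0) by exact (linear_zero l2 (proj1 Hl2)).
    rewrite E0. change (minus (lf (T e1)) (RtoC 0)) with (lf (T e1) - 0).
    pose proof (D3 e1 : lgw (T e1) = RtoC 0) as G1. pose proof (D3 e2 : lgw (T e2) = RtoC 1) as G2.
    pose proof (linear_form_coord lf (proj1 Hlf)) as Cf. pose proof (linear_form_coord lgw (proj1 Hlgw)) as Cg.
    assert (X : (lf e1 * lgw e2 - lf e2 * lgw e1) * det2 T = lf (T e1) * lgw (T e2) - lf (T e2) * lgw (T e1)).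
    { rewrite (Cf (T e1)), (Cf (T e2)), (Cg (T e1)), (Cg (T e2)). unfold det2. ring. }
    rewrite X, G1, G2. ring. }
  destruct (holo_division (fun w : CC => fst w) e1 O h Lfst eq_refl Hh) as [q [Hq hq]].
  { apply filter_forall. intros [w1 w2] E. cbn [fst snd] in E. change (fst O) with (RtoC 0) in E. unfold h, pi2. cbn [fst snd]. subst w1. 
    exact (Cplus_opp_r _). }
  (* On s = 0 the derivative of h = s q along [e1] is [q], and [hA] makes it 0. So [q] can be
     divided by s once more. *)
  assert (q0 : locally O (fun w => fst w = fst O -> q w = 0)).
  { apply locally_locally in hq. generalize (filter_and _ _ hA (filter_and _ _ hq Hq)). apply filter_imp.
    intros w [HA [Hw [lq Hlq]]] Ew. change (fst O) with (RtoC 0) in *.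
    assert (D1 : diffC h w (fun v => plus (fst v) (opp zero) * q w + (fst w - 0) * lq v)).
    { apply (filterdiff_ext_locally (V := CN) (fun w : CC => (fst w - 0) * q w)).
      - revert Hw. apply filter_imp. intros y Hy. symmetry. exact Hy.
      - apply (filterdiff_cmult (U := CC) (fun w : CC => fst w - 0) q); auto.
        apply (filterdiff_minus_fct (V := CN)); [apply Dfst|apply filterdiff_const]. }
    destruct (HA _ D1) as [T [_ E]]. cbv beta in E. rewrite Ew in E.
    assert (E' : (1 - 0) * q w + (0 - 0) * lq e1 = kap * 0 * det2 T) by exact E.
    transitivity ((1 - 0) * q w + (0 - 0) * lq e1); [ring|]. rewrite E'. ring. }
  destruct (holo_division (fun w : CC => fst w) e1 O q Lfst eq_refl Hq q0) as [r [Hr qr]].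
  change (fst O) with (RtoC 0) in *.
  assert (hr : locally O (fun w => h w = fst w * (fst w * r w))).
  { generalize (filter_and _ _ hq qr). apply filter_imp. intros w [E1 E2]. rewrite E1, E2. ring. }
  (* The same computation for h = s^2 r. One factor s is cancelled, which restricts the identity to
     s nonzero. *)
  assert (rA : locally O (fun w => fst w <> RtoC 0 -> forall lr : CC -> C, diffC r w lr ->
     exists T, filterdiff Th (locally w) T /\ RtoC 2 * r w + fst w * lr e1 = kap * det2 T)).
  { pose proof (locally_locally _ _ hr) as hr'. generalize (filter_and _ _ hA hr'). apply filter_imp.
    intros w [HA Hw] Hn lr Hlr.
    assert (D1 : diffC h w (fun v => fst v * (fst w * r w) + fst w * (fst v * r w + fst w * lr v))).
    { apply (filterdiff_ext_locally (V := CN) (fun w : CC => fst w * (fst w * r w))).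
      - revert Hw. apply filter_imp. intros y Hy. symmetry. exact Hy.
      - apply (filterdiff_cmult (U := CC) (fun w : CC => fst w)); [apply Dfst|].
        apply (filterdiff_cmult (U := CC) (fun w : CC => fst w)); [apply Dfst|auto]. }
    destruct (HA _ D1) as [T [HT E]]. exists T. split; auto. cbv beta in E. change (fst e1) with (RtoC 1) in E.
    destruct w as [w1 w2]. cbn [fst snd] in *.
    assert (K : forall x y : C, w1 * x = w1 * y -> x = y).
    { intros x y Exy. replace x with (/ w1 * (w1 * x)) by (field; exact Hn). rewrite Exy. field. exact Hn. }
    apply K. transitivity (1 * (w1 * r (w1, w2)) + w1 * (1 * r (w1, w2) + w1 * lr e1)); [ring|]. rewrite E. ring. }
  destruct (det2_inverse_bound Phi Th a O HPhi ThO HTh HPhiTh) as [c [Pc Hc]].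
  destruct (holo_near_deriv_bounded r O Hr) as [dr [B [Pdr [PB HB]]]].
  (* If [r] vanished at the origin, then at (t, 0) with small t > 0 the left side of [rA] would be
     at most 2 m / 8 + m / 8, whereas the right side is at least m = |kap| c. *)
  assert (r0 : r O <> 0).
  { intros r0. set (m := (Cmod kap * c)%R). assert (Pm : (0 < m)%R) by (apply Rmult_lt_0_compat; auto; now apply Cmod_gt_0).
    assert (Hsmall : locally O (fun w => (Cmod (r w) < m / 8)%R)).
    { pose proof (proj1 (filterlim_locally_ball_norm (U := CN) r (r O)) (holo_near_cont _ _ Hr) (mkposreal (m / 8) ltac:(lra))) as H.
      revert H. apply filter_imp. intros w Hw. unfold ball_norm in Hw. simpl in Hw. rewrite r0 in Hw.
      change (Cmod (r w - 0) < m / 8)%R in Hw. now replace (r w - 0) with (r w) in Hw by ring. }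
    destruct (proj1 (locally_norm_iff _ _) (filter_and _ _ Hsmall (filter_and _ _ rA (filter_and _ _ Hc Hr)))) as [dl [Pdl HH]].
    set (t := (Rmin (Rmin dl dr) (m / (8 * B)) / 2)%R).
    assert (P8 : (0 < m / (8 * B))%R) by (apply Rdiv_lt_0_compat; lra).
    assert (Pmin : (0 < Rmin (Rmin dl dr) (m / (8 * B)))%R) by (repeat apply Rmin_pos; auto).
    assert (Pt : (0 < t)%R) by (unfold t; lra).
    assert (Ht : (t < dl /\ t < dr /\ t < m / (8 * B))%R).
    { assert (Ht : (t < Rmin (Rmin dl dr) (m / (8 * B)))%R) by (unfold t; lra). split_Rmin. auto. }
    set (w := (RtoC t, RtoC 0) : CC).
    assert (Nw : (norm (minus w O) <= t)%R).
    { eapply Rle_trans; [apply norm_CC_le|]. change (Cmod (RtoC t - 0) + Cmod (RtoC 0 - 0) <= t)%R.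
      replace (RtoC t - 0) with (RtoC t) by ring. replace (RtoC 0 - 0) with (RtoC 0) by ring.
      rewrite Cmod_0, Cmod_R, Rabs_pos_eq; lra. }
    destruct (HH w ltac:(lra)) as [S1 [S2 [S3 [lr Hlr]]]].
    assert (Hw0 : fst w <> RtoC 0) by (intros E; unfold w in E; cbn [fst snd] in E; apply RtoC_inj in E; lra).
    destruct (S2 Hw0 lr Hlr) as [T [HT E]]. specialize (S3 T HT).
    pose proof (HB w lr ltac:(lra) Hlr e1) as Bl.
    assert (Bl' : (Cmod (lr e1) <= B)%R).
    { eapply Rle_trans; [exact Bl|]. rewrite <- (Rmult_1_r B) at 2. apply Rmult_le_compat_l; [lra|apply norm_e1]. }
    assert (E2 : (m <= Cmod (RtoC 2 * r w + fst w * lr e1))%R).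
    { rewrite E, Cmod_mult. apply Rmult_le_compat_l; [apply Cmod_ge_0|auto]. }
    pose proof (Cmod_triangle (RtoC 2 * r w) (fst w * lr e1)) as E3.
    rewrite !Cmod_mult, Cmod_R in E3. rewrite Rabs_pos_eq in E3 by lra.
    change (fst w) with (RtoC t) in *. rewrite Cmod_R, (Rabs_pos_eq t) in E3 by lra.
    assert (E4 : (t * Cmod (lr e1) <= m / 8)%R).
    { replace (m / 8)%R with (m / (8 * B) * B)%R by (field; lra). apply Rmult_le_compat; try lra. apply Cmod_ge_0. }
    lra. }
  destruct (holo_sqrt (r O) r0) as [sg [Hsg sgE]].
  assert (HrPhi : holoC (fun z => r (Phi z)) a) by (apply (holo_near_comp Phi r); auto; now rewrite Pa).
  assert (sgA : locally a (fun z => sg (r (Phi z)) * sg (r (Phi z)) = r (Phi z))).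
  { pose proof (holo_near_cont (V := CN) _ _ HrPhi) as Hc'. cbv beta in Hc'. rewrite Pa in Hc'. exact (Hc' _ sgE). }
  assert (Hj : holo_near (U := CN) (V := CC) (fun t : C => (RtoC 0, t)) (RtoC 0)).
  { apply (holo_near_pair (U := CN) (V := CN) (W := CN)); [apply holo_near_const|].
    apply hol_holo_near. intros z. apply hol_id. }
  exists (fun t => f1 (RtoC 0, t)), (fun z => sg (r (Phi z))).
  split; [|split; [|split; [|split; [|split]]]].
  - exact (holo_near_comp (U := CN) (V := CC) (W := CN) _ f1 (RtoC 0) Hj Hf1).
  - unfold f1. change (Th (RtoC 0, RtoC 0)) with (Th O). now rewrite ThO.
  - destruct (holo_near_hol _ _ HTh) as [T HT]. destruct (holo_near_hol _ _ Hf) as [lf Hlf].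
    assert (Df1 : diffC f1 O (fun v => lf (T v))).
    { apply (filterdiff_comp' Th f); auto. now rewrite ThO. }
    assert (Lj : is_linear (U := CN) (V := CC) (fun t : C => (RtoC 0, t))).
    { apply (is_linear_prod (T := CN) (U := CN) (V := CN)).
      - apply (is_linear_zero (U := CN) (V := CN)).
      - apply (is_linear_id (V := CN)). }
    pose proof (filterdiff_comp' (U := CN) (V := CC) (W := CN) (fun t : C => (RtoC 0, t)) f1 (RtoC 0) _ _
       (filterdiff_linear (U := CN) (V := CC) _ Lj) Df1) as DD.
    eapply filterdiff_ext_lin; [exact DD|]. intros y. cbv beta. apply (df0 lf Hlf).
  - apply (holo_near_comp (V := CN) (fun z => r (Phi z)) sg); auto. rewrite Pa. exact Hsg.
  - intros E. pose proof (locally_singleton _ _ sgA) as E2. cbv beta in E2, E. rewrite E in E2.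
    apply r0. rewrite <- Pa, <- E2. ring.
  - pose proof (holo_near_cont Phi a HPhi) as Hc'. rewrite Pa in Hc'. specialize (Hc' _ hr). unfold filtermap in Hc'.
    generalize (filter_and _ _ HThPhi (filter_and _ _ Hc' sgA)). apply filter_imp. intros z [E1 [E2 E3]].
    transitivity (h (Phi z)).
    + unfold h, f1. rewrite E1. reflexivity.
    + rewrite E2. change (fst (Phi z)) with (J z).
      transitivity (J z * (J z * (sg (r (Phi z)) * sg (r (Phi z))))); [now rewrite E3|ring].
Qed.
End Fold.

(** * Multiplicity one implies node *)

Notation CC4 := (prod_NormedModule C_AbsRing CC CC).

Section Ideal.
Context {U : NormedModule C_AbsRing}.
Variables (p : U) (hs : list (U -> C)).

Lemma in_ideal_vanish (phi : U -> C) : List.Forall (fun h : U -> C => h p = 0) hs -> in_ideal p hs phi -> phi p = 0.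
Proof.
  intros H0 [as_ [_ [_ Hg]]]. pose proof (locally_singleton _ _ Hg) as E. cbv beta in E. rewrite E. clear E Hg.
  revert as_. induction hs as [|h l IH]; intros [|a as_]; try reflexivity.
  inversion H0 as [|? ? Hh Hl]; subst. specialize (IH Hl as_).
  etransitivity; [exact (f_equal2 Cplus (f_equal (Cmult (a p)) Hh) IH)|ring].
Qed.

(** By the product rule the derivative of each summand a h along [v] is da(v) h(p) + a(p) dh(v) =
    0. *)
Lemma in_ideal_derivative (phi : U -> C) (l : U -> C) (v : U) :
  List.Forall (fun h : U -> C => h p = 0 /\ exists lh : U -> C, diffC h p lh /\ lh v = 0) hs ->
  in_ideal p hs phi -> diffC phi p l -> l v = 0.
Proof.
  intros H0 [as_ [_ [Ha Hg]]] Hl.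
  assert (K : exists l' : U -> C, filterdiff (V := CN)
     (fun z => sumC (map (fun ah => fst ah z * snd ah z) (combine as_ hs))) (locally p) l' /\ l' v = 0).
  { clear Hg Hl l phi. revert as_ Ha. induction hs as [|h l IH]; intros [|a as_] Ha;
      try (exists (fun _ => RtoC 0); split; [exact (filterdiff_const (V := CN) (RtoC 0))|reflexivity]).
    inversion H0 as [|? ? Hh Hl]; subst. inversion Ha as [|? ? Ha1 Ha2]; subst.
    destruct (IH Hl as_ Ha2) as [l' [Hl' Ev]]. destruct Hh as [Hh0 [lh [Hlh Elh]]].
    destruct (holo_near_hol _ _ Ha1) as [la Hla].
    eexists. split.
    - exact (filterdiff_plus_fct (V := CN) _ _ _ _ (filterdiff_cmult _ _ _ _ _ Hla Hlh) Hl').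
    - cbv beta. rewrite Ev, Elh, Hh0. change (la v * 0 + a p * 0 + 0 = 0). ring. }
  destruct K as [l' [Hl' Ev]]. rewrite <- Ev. apply (filterdiff_unique_C phi p); auto.
  apply (filterdiff_ext_locally (V := CN) _ _ _ _ (filter_imp _ _ (fun z E => eq_sym E) Hg) Hl').
Qed.

(** Let e0 span the quotient. As 1 - c1 e0 lies in the ideal, evaluation at [p] gives c1 e0(p) = 1;
    as phi - c e0 does too, c e0(p) = 0. Hence c = 0, and phi itself lies in the ideal. *)
Lemma quot_dim_1_maximal : List.Forall (fun h : U -> C => h p = 0) hs -> quot_dim p hs 1 ->
  forall phi : U -> C, holoC phi p -> phi p = 0 -> in_ideal p hs phi.
Proof.
  intros H0 [e [_ [He _]]] phi Hphi Hp.
  assert (S1 : forall (c : nat -> C) z, sum_lt 1 (fun k => c k * e k z) = c 0%nat * e 0%nat z).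
  { intros c z. change (c 0%nat * e 0%nat z + 0 = c 0%nat * e 0%nat z). ring. }
  destruct (He phi Hphi) as [c Hc]. destruct (He (fun _ => 1) (holo_near_const (V := CN) _ p)) as [c1 Hc1].
  pose proof (in_ideal_vanish _ H0 Hc1) as E1. cbv beta in E1. rewrite S1 in E1.
  pose proof (in_ideal_vanish _ H0 Hc) as E2. cbv beta in E2. rewrite S1, Hp in E2.
  assert (Ec : c 0%nat = 0).
  { replace (c 0%nat) with (c 0%nat * (1 - c1 0%nat * e 0%nat p) - c1 0%nat * (0 - c 0%nat * e 0%nat p)) by ring.
    rewrite E1, E2. ring. }
  destruct Hc as [as_ [A1 [A2 A3]]]. exists as_. split; [auto|split; [auto|]].
  revert A3. unfold germ_eq. apply filter_imp. intros z Hz. rewrite <- Hz, S1, Ec. refine (_ : @eq C _ _); ring.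
Qed.
End Ideal.

Lemma filterdiff_comp_fst {V : NormedModule C_AbsRing} (h : CC -> V) (p : CC4) l :
  filterdiff h (locally (fst p)) l -> filterdiff (fun xy : CC4 => h (fst xy)) (locally p) (fun v => l (fst v)).
Proof.
  intros H. apply (filterdiff_comp' (fst : CC4 -> CC) h p); auto.
  apply filterdiff_linear, (is_linear_fst (U := CC) (V := CC)).
Qed.

Lemma filterdiff_comp_snd {V : NormedModule C_AbsRing} (h : CC -> V) (p : CC4) l :
  filterdiff h (locally (snd p)) l -> filterdiff (fun xy : CC4 => h (snd xy)) (locally p) (fun v => l (snd v)).
Proof.
  intros H. apply (filterdiff_comp' (snd : CC4 -> CC) h p); auto.
  apply filterdiff_linear, (is_linear_snd (U := CC) (V := CC)).
Qed.

Section Converse.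
Variables (d1 d2 : nat) (cf cg : nat -> nat -> C) (a b : C2).
Hypotheses (Hcf : deg_le d1 cf) (Hcg : deg_le d2 cg).
Let F := pmap d1 d2 cf cg.
Let J := jac d1 d2 cf cg.
Let dF := dpmap d1 d2 cf cg.
Hypotheses (Ja0 : J a = 0) (Jb0 : J b = 0) (Fab : F a = F b).

Lemma node_ideal_vanish : List.Forall (fun h : CC4 -> C => h (a, b) = 0) (node_ideal d1 d2 cf cg).
Proof.
  unfold node_ideal. fold F J. repeat constructor; cbn [fst snd]; auto; rewrite Fab; ring.
Qed.

Lemma nu_1_kernel (lJa lJb : CC -> C) :
  diffC J (a : CC) lJa ->
  diffC J (b : CC) lJb ->
  nu_eq d1 d2 cf cg a b 1 ->
  forall v w : C2, lJa v = 0 -> lJb w = 0 -> dF a v = dF b w -> v = origin /\ w = origin.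
Proof.
  intros HJa HJb Hnu v w Hv Hw HF.
  pose proof (quot_dim_1_maximal (U := CC4) _ _ node_ideal_vanish Hnu) as Hmax.
  set (p := (a, b) : CC4) in *. set (vw := (v, w) : CC4).
  assert (Hder : List.Forall (fun h : CC4 -> C => h p = 0 /\ exists lh : CC4 -> C,
     diffC h p lh /\ lh vw = 0) (node_ideal d1 d2 cf cg)).
  { pose proof (filterdiff_pmap d1 d2 cf cg a Hcf Hcg) as DFa.
    pose proof (filterdiff_pmap d1 d2 cf cg b Hcf Hcg) as DFb.
    pose proof node_ideal_vanish as NV. unfold node_ideal in *. fold F J in NV, DFa, DFb |- *. fold dF in DFa, DFb.
    apply List.Forall_cons_iff in NV. destruct NV as [N1 NV]. apply List.Forall_cons_iff in NV. destruct NV as [N2 NV].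
    apply List.Forall_cons_iff in NV. destruct NV as [N3 NV]. apply List.Forall_cons_iff in NV. destruct NV as [N4 _].
    repeat apply List.Forall_cons; [split; [exact N1|]|split; [exact N2|]|split; [exact N3|]|split; [exact N4|]|apply List.Forall_nil].
    - exists (fun x => lJa (fst x)). split; [|exact Hv]. exact (filterdiff_comp_fst (V := CN) J p lJa HJa).
    - exists (fun x => lJb (snd x)). split; [|exact Hw]. exact (filterdiff_comp_snd (V := CN) J p lJb HJb).
    - exists (fun x => minus (fst (dF a (fst x)) : CN) (fst (dF b (snd x)))). split.
      + exact (filterdiff_minus_fct (U := CC4) (V := CN) _ _ _ _
          (filterdiff_comp_fst (V := CN) (fun z => fst (F z)) p _ (filterdiff_fst _ _ _ DFa))
          (filterdiff_comp_snd (V := CN) (fun z => fst (F z)) p _ (filterdiff_fst _ _ _ DFb))).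
      + change (fst (dF a v) - fst (dF b w) = 0). rewrite HF. ring.
    - exists (fun x => minus (snd (dF a (fst x)) : CN) (snd (dF b (snd x)))). split.
      + exact (filterdiff_minus_fct (U := CC4) (V := CN) _ _ _ _
          (filterdiff_comp_fst (V := CN) (fun z => snd (F z)) p _ (filterdiff_snd _ _ _ DFa))
          (filterdiff_comp_snd (V := CN) (fun z => snd (F z)) p _ (filterdiff_snd _ _ _ DFb))).
      + change (snd (dF a v) - snd (dF b w) = 0). rewrite HF. ring. }
  (* l - l(p) vanishes at [p], so it lies in the ideal, and differentials of members kill [vw].
     Applied to the four coordinates this gives v = w = 0. *)
  assert (K : forall l : CC4 -> C, is_linear (V := CN) l -> l vw = 0).
  { intros l Hl.
    assert (Dl : diffC (fun z => minus (l z : CN) (l p)) p (fun x => minus (l x : CN) zero)).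
    { apply (filterdiff_minus_fct (V := CN)); [now apply filterdiff_linear|].
      apply (filterdiff_const (V := CN)). }
    pose proof (in_ideal_derivative p (node_ideal d1 d2 cf cg) _ _ vw Hder (Hmax (fun z => l z - l p)
      (holo_near_minus _ _ _ (holo_near_linear _ _ Hl) (holo_near_const (V := CN) _ _)) ltac:(cbv beta; ring)) Dl) as E.
    replace (l vw) with (l vw - 0) by ring. exact E. }
  pose proof (is_linear_fst (U := CC) (V := CC)) as L1. pose proof (is_linear_snd (U := CC) (V := CC)) as L2.
  pose proof (is_linear_fst (U := CN) (V := CN)) as M1.
  pose proof (is_linear_snd (U := CN) (V := CN)) as M2.
  split; apply CC_eq_origin.
  - exact (K _ (is_linear_comp _ _ L1 M1)).
  - exact (K _ (is_linear_comp _ _ L1 M2)).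
  - exact (K _ (is_linear_comp _ _ L2 M1)).
  - exact (K _ (is_linear_comp _ _ L2 M2)).
Qed.

Lemma linear_form_kernel (l : CC -> C) : is_linear (V := CN) l ->
  exists u : C2, u <> origin /\ l u = 0.
Proof.
  intros Hl. pose proof (linear_form_coord l Hl) as E.
  destruct (excluded_middle_informative (l e1 = 0)) as [H1|H1].
  - exists e1. split; auto. intros H. apply (f_equal (fun z : C2 => fst (fst z))) in H. simpl in H. lra.
  - exists (- l e2, l e1). split.
    + intros H. apply (f_equal snd) in H. exact (H1 H).
    + rewrite E. cbn [fst snd]. ring.
Qed.

Lemma is_node_of_nu_1 : nu_eq d1 d2 cf cg a b 1 -> is_node F a b.
Proof.
  intros Hnu. destruct (hol_jac d1 d2 cf cg a Hcf Hcg) as [lJa HJa]. fold J in HJa.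
  destruct (hol_jac d1 d2 cf cg b Hcf Hcg) as [lJb HJb]. fold J in HJb.
  pose proof (nu_1_kernel lJa lJb HJa HJb Hnu) as Ker.
  assert (Lc : forall z (x : C) (v : C2), dF z (x * fst v, x * snd v) = (x * fst (dF z v), x * snd (dF z v))).
  { intros z x v. unfold dF, dpmap. cbn [fst snd]. f_equal; ring. }
  assert (Lz : forall z, dF z origin = origin).
  { intros z. unfold dF, dpmap, origin. cbn [fst snd]. f_equal; ring. }
  assert (JaC : forall (x : C) (v : C2), lJa v = RtoC 0 -> lJa (x * fst v, x * snd v) = RtoC 0).
  { intros x v Hv. transitivity (x * lJa v); [exact (linear_scal lJa (proj1 HJa) x v)|]. rewrite Hv. cring. }
  assert (JbC : forall (x : C) (v : C2), lJb v = RtoC 0 -> lJb (x * fst v, x * snd v) = RtoC 0).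
  { intros x v Hv. transitivity (x * lJb v); [exact (linear_scal lJb (proj1 HJb) x v)|]. rewrite Hv. cring. }
  destruct (linear_form_kernel lJa (proj1 HJa)) as [u [Hu Hlu]].
  destruct (linear_form_kernel lJb (proj1 HJb)) as [u' [Hu' Hlu']].
  assert (scal0 : forall (x : C) (v : C2), (x * fst v, x * snd v) = origin -> v <> origin -> x = 0).
  { intros x v E Hv. destruct (excluded_middle_informative (x = 0)) as [|Hx]; auto. exfalso. apply Hv.
    pose proof (f_equal fst E : x * fst v = 0) as E1. pose proof (f_equal snd E : x * snd v = 0) as E2.
    apply CC_eq_origin.
    - replace (fst v) with (/ x * (x * fst v)) by (field; auto). rewrite E1. ring.
    - replace (snd v) with (/ x * (x * snd v)) by (field; auto). rewrite E2. ring. }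
  (* If a = b, the pair (u, u) would be a nonzero solution of the equations in [Ker]. *)
  assert (Hab : a <> b).
  { intros Eab. apply Hu. apply (Ker u u); auto.
    - rewrite <- Hlu. assert (HJ' : diffC J (b : CC) lJa) by (rewrite <- Eab; exact HJa).
      exact (filterdiff_unique_C _ _ _ _ HJb HJ' u).
    - now rewrite Eab. }
  set (P := dF a u). set (Q := dF b u'). set (De := fst P * snd Q - snd P * fst Q).
  (* Since dJ(a) kills [u] and dJ(b) kills [u'], an equality s P = t Q makes (s u, t u') a solution
     of the equations in [Ker]. *)
  assert (Hcomb : forall s t : C, (s * fst P, s * snd P) = (t * fst Q, t * snd Q) -> s = 0 /\ t = 0).
  { intros s t E. destruct (Ker (s * fst u, s * snd u) (t * fst u', t * snd u')) as [K1 K2].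
    - now apply JaC. - now apply JbC. - rewrite !Lc. exact E.
    - split; [apply (scal0 s u)|apply (scal0 t u')]; auto. }
  (* If [De] vanished, then Q1 P = P1 Q and Q2 P = P2 Q, so by [Hcomb] all coordinates of [P] and
     [Q] are 0; but then 1 P = 0 Q contradicts [Hcomb]. *)
  assert (HDe : De <> 0).
  { intros E. unfold De in E.
    destruct (Hcomb (fst Q) (fst P)) as [Q1 P1].
    { f_equal; [ring|]. replace (fst Q * snd P) with (fst P * snd Q - (fst P * snd Q - snd P * fst Q)) by ring. rewrite E. ring. }
    destruct (Hcomb (snd Q) (snd P)) as [Q2 P2].
    { f_equal; [|ring]. replace (snd Q * fst P) with (snd P * fst Q + (fst P * snd Q - snd P * fst Q)) by ring. rewrite E. ring. }
    assert (C11 : RtoC 1 = 0).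
    { apply (Hcomb 1 0). rewrite P1, P2. f_equal; ring. }
    apply RtoC_inj in C11. lra. }
  (* Linear coordinates on the target in which [dF a u] and [dF b u'] are the unit vectors. *)
  set (c := F a).
  set (lam := fun y : C2 => - snd P / De * fst y + fst P / De * snd y).
  set (mu := fun y : C2 => snd Q / De * fst y + - fst Q / De * snd y).
  assert (Llam : is_linear (U := CC) (V := CN) lam) by apply is_linear_form.
  assert (Lmu : is_linear (U := CC) (V := CN) mu) by apply is_linear_form.
  assert (lam_mu : forall y, lam y = 0 -> mu y = 0 -> y = origin).
  { intros y H1 H2. apply CC_eq_origin.
    - transitivity (fst P * mu y + fst Q * lam y); [|rewrite H1, H2; ring]. unfold lam, mu, De. field. exact HDe.
    - transitivity (snd P * mu y + snd Q * lam y); [|rewrite H1, H2; ring]. unfold lam, mu, De. field. exact HDe. }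
  (* At a critical point [dF] has rank at most 1, so its image at [a] is parallel to [P] and at [b]
     to [Q]; [lam] and [mu] kill these directions. *)
  assert (degen : forall z v w, J z = 0 -> fst (dF z v) * snd (dF z w) - snd (dF z v) * fst (dF z w) = 0).
  { intros z v w Hz. unfold dF, dpmap. cbn [fst snd].
    transitivity (J z * (fst v * snd w - snd v * fst w)); [unfold J, jac; ring|]. rewrite Hz. ring. }
  assert (lam_a : forall v, lam (dF a v) = 0).
  { intros v. pose proof (degen a u v Ja0) as E. fold P in E. unfold lam.
    transitivity (/ De * (fst P * snd (dF a v) - snd P * fst (dF a v))); [field; auto|]. rewrite E. ring. }
  assert (mu_b : forall w, mu (dF b w) = 0).
  { intros w. pose proof (degen b u' w Jb0) as E. fold Q in E. unfold mu.
    transitivity (- / De * (fst Q * snd (dF b w) - snd Q * fst (dF b w))); [field; auto|]. rewrite E. ring. }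
  set (f := fun z : CC => lam (F z) - lam c). set (g := fun z : CC => mu (F z) - mu c).
  assert (DF : forall z : CC, filterdiff F (locally z) (dF z)) by (intros z; apply filterdiff_pmap; auto).
  assert (Df : forall z : CC, diffC f z (fun v => lam (dF z v))).
  { intros z. eapply filterdiff_ext_lin; [apply (filterdiff_minus_fct (V := CN))|].
    - exact (filterdiff_comp' F lam z _ _ (DF z) (filterdiff_linear _ Llam)).
    - apply (filterdiff_const (V := CN)).
    - intros v. cbv beta. change (lam (dF z v) - 0 = lam (dF z v)). ring. }
  assert (Dg : forall z : CC, diffC g z (fun v => mu (dF z v))).
  { intros z. eapply filterdiff_ext_lin; [apply (filterdiff_minus_fct (V := CN))|].
    - exact (filterdiff_comp' F mu z _ _ (DF z) (filterdiff_linear _ Lmu)).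
    - apply (filterdiff_const (V := CN)).
    - intros v. cbv beta. change (mu (dF z v) - 0 = mu (dF z v)). ring. }
  assert (Hhf : forall z : CC, holoC f z) by (intros z; apply hol_holo_near; intros y; eexists; apply Df).
  assert (Hhg : forall z : CC, holoC g z) by (intros z; apply hol_holo_near; intros y; eexists; apply Dg).
  assert (HhJ : forall z : CC, holoC J z) by (intros z; apply hol_holo_near; intros y; now apply hol_jac).
  assert (fa0 : f a = 0) by (unfold f, c; ring). assert (ga0 : g a = 0) by (unfold g, c; ring).
  assert (fb0 : f b = 0) by (unfold f, c; rewrite Fab; ring). assert (gb0 : g b = 0) by (unfold g, c; rewrite Fab; ring).
  assert (inja : forall v, lJa v = RtoC 0 -> mu (dF a v) = 0 -> v = origin).
  { intros v H1 H2. destruct (Ker v origin) as [K _]; auto.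
    - exact (linear_zero lJb (proj1 HJb)). - rewrite Lz. apply lam_mu; auto. }
  assert (injb : forall v, lJb v = RtoC 0 -> lam (dF b v) = 0 -> v = origin).
  { intros v H1 H2. destruct (Ker origin v) as [_ K]; auto.
    - exact (linear_zero lJa (proj1 HJa)). - rewrite Lz. symmetry. apply lam_mu; auto. }
  (* -1 / De is the determinant of (lam, mu). It serves as [kap] at [a]; at [b] the roles of [f] and
     [g] are exchanged, which changes the sign. *)
  assert (detfg : forall z, lam (dF z e1) * mu (dF z e2) - lam (dF z e2) * mu (dF z e1) = - / De * J z).
  { intros z. unfold lam, mu, dF, dpmap, e1, e2, J, jac. cbn [fst snd]. unfold De. field. exact HDe. }
  assert (iDe : / De <> 0) by (apply Cmod_gt_0; rewrite Cmod_inv by auto; apply Rinv_0_lt_compat; now apply Cmod_gt_0).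
  destruct (fold_normal_form f g J a lJa (fun v => mu (dF a v)) (- / De)) as [al [rho [Hal [al0 [Dal [Hrho [rho0 Ea]]]]]]]; auto.
  { intros l Hl v. rewrite (filterdiff_unique_C _ _ _ _ Hl (Df a) v). apply lam_a. }
  { intros E. apply iDe, Copp_eq_0, E. }
  { apply filter_forall. intros z lf lg Hlf Hlg.
    rewrite !(filterdiff_unique_C _ _ _ _ Hlf (Df z)), !(filterdiff_unique_C _ _ _ _ Hlg (Dg z)). apply detfg. }
  destruct (fold_normal_form g f J b lJb (fun v => lam (dF b v)) (/ De)) as [be [rho' [Hbe [be0 [Dbe [Hrho' [rho0' Eb]]]]]]]; auto.
  { intros l Hl v. rewrite (filterdiff_unique_C _ _ _ _ Hl (Dg b) v). apply mu_b. }
  { apply filter_forall. intros z lg lf Hlg Hlf.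
    rewrite !(filterdiff_unique_C _ _ _ _ Hlf (Df z)), !(filterdiff_unique_C _ _ _ _ Hlg (Dg z)).
    transitivity (- (lam (dF z e1) * mu (dF z e2) - lam (dF z e2) * mu (dF z e1))); [ring|]. rewrite detfg. ring. }
  assert (hcomp : forall (h : CC -> C) (k : C -> C) (z : CC), holoC h z -> h z = 0 ->
     holo_near (U := CN) (V := CN) k (RtoC 0) -> holoC (fun y => k (h y)) z).
  { intros h k z Hh Hh0 Hk. apply (holo_near_comp (V := CN) h k); auto. now rewrite Hh0. }
  assert (dcomp : forall (h : CC -> C) (k : C -> C) (z : CC) lh, diffC h z lh -> h z = 0 ->
     filterdiff (U := CN) (V := CN) k (locally (RtoC 0 : CN)) (fun _ => RtoC 0) ->
     diffC (fun y => k (h y)) z (fun _ => RtoC 0)).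
  { intros h k z lh Hh Hh0 Hk. apply (filterdiff_comp' (V := CN) h k z lh (fun _ => RtoC 0)); auto. now rewrite Hh0. }
  split; [exact Hab|split; [exact Fab|left]].
  (* As [al] and [be] have derivative 0 at 0, the linear parts are (lam, mu) for [psi], (rho(a) dJ,
     dg) for [phi1] and (df, rho'(b) dJ) for [phi2]; all three are injective. *)
  set (psi := fun y : C2 => ((lam y - lam c) - al (mu y - mu c), (mu y - mu c) - be (lam y - lam c)) : C2).
  set (phi1 := fun z : C2 => (J z * rho z, g z - be (f z)) : C2).
  set (phi2 := fun z : C2 => (f z - al (g z), J z * rho' z) : C2).
  exists phi1, phi2, psi.
  assert (X1 : biholo_germ (U := CC) (V := CC) phi1 a origin).
  { assert (E : phi1 a = origin) by (unfold phi1, origin; rewrite Ja0, fa0, ga0, be0; f_equal; ring).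
    rewrite <- E. eapply inverse_function.
    - apply (holo_near_pair (V := CN) (W := CN)).
      + apply holo_near_mult; auto.
      + apply holo_near_minus; auto.
    - apply (filterdiff_pair (V := CN) (W := CN)).
      + destruct (holo_near_hol _ _ Hrho) as [lr Hlr]. 
        eapply filterdiff_ext_lin; [exact (filterdiff_cmult J rho a lJa lr HJa Hlr)|].
        intros v. cbv beta. rewrite Ja0. instantiate (1 := fun v => lJa v * rho a). change (lJa v * rho a + 0 * lr v = lJa v * rho a). ring.
      + apply (filterdiff_minus_fct (V := CN)); [apply Dg|exact (dcomp f be a _ (Df a) fa0 Dbe)].
    - intros v Hv. pose proof (f_equal fst Hv : lJa v * rho a = 0) as E1.
      pose proof (f_equal snd Hv : mu (dF a v) - 0 = 0) as E2. apply inja.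
      + transitivity (/ rho a * (lJa v * rho a)); [symmetry; refine (_ : @eq C _ _); field; auto|]. rewrite E1. cring.
      + rewrite <- E2. ring. }
  assert (X2 : biholo_germ (U := CC) (V := CC) phi2 b origin).
  { assert (E : phi2 b = origin) by (unfold phi2, origin; rewrite Jb0, fb0, gb0, al0; f_equal; ring).
    rewrite <- E. eapply inverse_function.
    - apply (holo_near_pair (V := CN) (W := CN)).
      + apply holo_near_minus; auto.
      + apply holo_near_mult; auto.
    - apply (filterdiff_pair (V := CN) (W := CN)).
      + apply (filterdiff_minus_fct (V := CN)); [apply Df|exact (dcomp g al b _ (Dg b) gb0 Dal)].
      + destruct (holo_near_hol _ _ Hrho') as [lr Hlr].
        eapply filterdiff_ext_lin; [exact (filterdiff_cmult J rho' b lJb lr HJb Hlr)|].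
        intros v. cbv beta. rewrite Jb0. instantiate (1 := fun v => lJb v * rho' b). change (lJb v * rho' b + 0 * lr v = lJb v * rho' b). ring.
    - intros v Hv. pose proof (f_equal snd Hv : lJb v * rho' b = 0) as E1.
      pose proof (f_equal fst Hv : lam (dF b v) - 0 = 0) as E2. apply injb.
      + transitivity (/ rho' b * (lJb v * rho' b)); [symmetry; refine (_ : @eq C _ _); field; auto|]. rewrite E1. cring.
      + rewrite <- E2. ring. }
  assert (X3 : biholo_germ (U := CC) (V := CC) psi (F a) origin).
  { assert (E : psi (F a) = origin).
    { unfold psi, origin. fold c. replace (lam c - lam c) with (RtoC 0) by ring. replace (mu c - mu c) with (RtoC 0) by ring.
      rewrite al0, be0. f_equal; ring. }
    rewrite <- E. fold c.
    set (lam' := fun y : CC => lam y - lam c). set (mu' := fun y : CC => mu y - mu c).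
    assert (Dl : diffC lam' (c : CC) (fun v => minus (lam v : CN) zero)).
    { apply (filterdiff_minus_fct (V := CN)); [now apply filterdiff_linear|apply (filterdiff_const (V := CN))]. }
    assert (Dm : diffC mu' (c : CC) (fun v => minus (mu v : CN) zero)).
    { apply (filterdiff_minus_fct (V := CN)); [now apply filterdiff_linear|apply (filterdiff_const (V := CN))]. }
    assert (Hl : holoC lam' (c : CC)) by (apply holo_near_minus; [now apply holo_near_linear|apply (holo_near_const (V := CN))]).
    assert (Hm : holoC mu' (c : CC)) by (apply holo_near_minus; [now apply holo_near_linear|apply (holo_near_const (V := CN))]).
    assert (l0 : lam' c = 0) by (unfold lam'; ring). assert (m0 : mu' c = 0) by (unfold mu'; ring).
    eapply inverse_function.
    - apply (holo_near_pair (V := CN) (W := CN)).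
      + apply holo_near_minus; [exact Hl|exact (hcomp mu' al c Hm m0 Hal)].
      + apply holo_near_minus; [exact Hm|exact (hcomp lam' be c Hl l0 Hbe)].
    - apply (filterdiff_pair (V := CN) (W := CN)).
      + apply (filterdiff_minus_fct (V := CN)); [exact Dl|exact (dcomp mu' al c _ Dm m0 Dal)].
      + apply (filterdiff_minus_fct (V := CN)); [exact Dm|exact (dcomp lam' be c _ Dl l0 Dbe)].
    - intros v Hv. pose proof (f_equal fst Hv : lam v - 0 - 0 = 0) as E1.
      pose proof (f_equal snd Hv : mu v - 0 - 0 = 0) as E2. apply lam_mu.
      + rewrite <- E1. ring.
      + rewrite <- E2. ring. }
  split; [exact X1|split; [exact X2|split; [exact X3|split]]].
  - unfold germ_eq. revert Ea. apply filter_imp. intros z Ez. unfold psi, fold1, phi1. cbn [fst snd]. fold (f z) (g z).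
    apply injective_projections; cbn [fst snd]; [exact Ez|reflexivity].
  - unfold germ_eq. revert Eb. apply filter_imp. intros z Ez. unfold psi, fold2, phi2. cbn [fst snd]. fold (f z) (g z).
    apply injective_projections; cbn [fst snd]; [reflexivity|exact Ez].
Qed.
End Converse.

(** * Node implies multiplicity one *)

(** Since psi F phi' = N, the determinants satisfy det(dpsi) J(phi') det(dphi') = 2 l. The outer
    factors are bounded and bounded away from 0, so J(phi') vanishes on l = 0 and its quotient by
    [l] is a unit. [N] and [l] stay general in order to cover both folds. *)
Lemma jacobian_factor (F : CC -> CC) (DF : CC -> CC -> CC) (a : CC) (phi psi N : CC -> CC) (dN : CC -> CC -> CC)
  (l : CC -> C) (e : CC) :
  (forall z, filterdiff F (locally z) (DF z)) -> holoC (fun z => det2 (DF z)) a ->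
  (forall w, filterdiff N (locally w) (dN w)) -> (forall w, det2 (dN w) = RtoC 2 * l w) ->
  is_linear (V := CN) l -> l e = 1 ->
  biholo_germ phi a origin -> biholo_germ psi (F a) origin ->
  locally a (fun z => psi (F z) = N (phi z)) ->
  exists u : CC -> C, holoC u a /\ u a <> 0 /\ locally a (fun z => det2 (DF z) = l (phi z) * u z).
Proof.
  intros HDF HJ HN HdN Ll Le [phia [Hphi [phi' [phi'0 [Hphi' [inv1 inv2]]]]]] [psia [Hpsi [psi' [psi'0 [Hpsi' [inv3 inv4]]]]]] Hgerm.
  set (O := origin : CC) in *.
  destruct (det2_inverse_bound phi phi' a O Hphi phi'0 Hphi' inv2) as [c1 [Pc1 Hc1]].
  destruct (det2_inverse_bound psi' psi O (F a) Hpsi' psia Hpsi inv3) as [c2 [Pc2 Hc2]].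
  destruct (det2_deriv_bound phi' O Hphi') as [B1 [PB1 HB1]].
  destruct (det2_deriv_bound psi (F a) Hpsi) as [B2 [PB2 HB2]].
  set (J := fun z => det2 (DF z)) in *.
  pose proof (holo_near_cont phi' O Hphi') as cphi'. rewrite phi'0 in cphi'.
  assert (cF : filterlim F (locally a) (locally (F a))).
  { apply (filterdiff_continuous F a). eexists. apply HDF. }
  assert (Hj : holoC (fun w => J (phi' w)) O).
  { apply (holo_near_comp phi' J); auto. now rewrite phi'0. }
  (* [x] and [y] are the determinants of the derivatives of [phi'] at [w] and of [psi] at F(phi'
     w). *)
  assert (Main : locally O (fun w => exists x y : C, (Cmod x <= B1)%R /\ (Cmod y <= B2)%R /\ (c1 <= Cmod x)%R /\ (c2 <= Cmod y)%R /\
      y * (J (phi' w) * x) = RtoC 2 * l w)).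
  { pose proof (filter_and _ _ Hpsi (filter_and _ _ Hc2 HB2)) as Q1.
    pose proof (cphi' _ (cF _ Q1)) as Q2. unfold filtermap in Q2.
    pose proof (cphi' _ (locally_locally _ _ Hgerm)) as Q3. unfold filtermap in Q3.
    generalize (filter_and _ _ Q2 (filter_and _ _ Q3 (filter_and _ _ (locally_locally _ _ inv2) (filter_and _ _ Hphi' (filter_and _ _ Hc1 HB1))))).
    apply filter_imp. intros w [[[Lpsi HLpsi] [K2 K2']] [Hg [Hi [[Lphi HLphi] [K1 K1']]]]].
    exists (det2 Lphi), (det2 Lpsi).
    split; [now apply K1'|split; [now apply K2'|split; [now apply K1|split; [now apply K2|]]]].
    pose proof (filterdiff_comp' phi' F w _ _ HLphi (HDF (phi' w))) as D1.
    pose proof (filterdiff_comp' (fun w => F (phi' w)) psi w _ _ D1 HLpsi) as D2.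
    assert (cw : filterlim phi' (locally w) (locally (phi' w))).
    { apply (filterdiff_continuous phi' w). eexists. exact HLphi. }
    assert (D3 : filterdiff N (locally w) (fun v => Lpsi (DF (phi' w) (Lphi v)))).
    { refine (filterdiff_ext_locally _ _ _ _ _ D2).
      pose proof (cw _ Hg) as Hg'. unfold filtermap in Hg'.
      generalize (filter_and _ _ Hg' Hi). apply filter_imp. intros y [E1 E2].
      etransitivity; [exact E1|]. now rewrite E2. }
    rewrite <- HdN, <- (filterdiff_unique_det2 N w _ _ D3 (HN w)).
    rewrite (det2_comp Lpsi (fun v => DF (phi' w) (Lphi v)) (proj1 HLpsi)).
    rewrite (det2_comp (DF (phi' w)) Lphi (proj1 (HDF _))). reflexivity. }
  assert (lO : l O = 0) by exact (linear_zero l Ll).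
  destruct (holo_division l e O (fun w => J (phi' w)) Ll Le Hj) as [u1 [Hu1 Eu1]].
  { revert Main. apply filter_imp. intros w [x [y [_ [_ [X [Y E]]]]]] Hw. rewrite lO in Hw. rewrite Hw in E.
    assert (x <> 0) by (apply Cmod_gt_0; lra). assert (y <> 0) by (apply Cmod_gt_0; lra).
    transitivity (/ y * / x * (y * (J (phi' w) * x))); [field; auto|]. rewrite E. ring. }
  rewrite lO in Eu1.
  (* Off l = 0 the quotient satisfies y x u1 = 2 with |y x| <= B1 B2, so |u1| cannot fall below m =
     1 / (B1 B2). The test point is a small multiple of [e], where [l] is nonzero. *)
  assert (u10 : u1 O <> 0).
  { intros E0. set (m := (/ (B1 * B2))%R). assert (PBB : (0 < B1 * B2)%R) by now apply Rmult_lt_0_compat.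
    assert (Pm : (0 < m)%R) by now apply Rinv_0_lt_compat.
    assert (Hsmall : locally O (fun w => (Cmod (u1 w) < m)%R)).
    { pose proof (proj1 (filterlim_locally_ball_norm (U := CN) u1 (u1 O)) (holo_near_cont _ _ Hu1) (mkposreal m Pm)) as H.
      revert H. apply filter_imp. intros w Hw. unfold ball_norm in Hw. simpl in Hw. rewrite E0 in Hw.
      change (Cmod (u1 w - 0) < m)%R in Hw. now replace (u1 w - 0) with (u1 w) in Hw by ring. }
    destruct (proj1 (locally_norm_iff _ _) (filter_and _ _ Hsmall (filter_and _ _ Main Eu1))) as [dl [Pdl HH]].
    pose proof (norm_ge_0 e) as Pe. set (t := (dl / 2 / (norm e + 1))%R).
    assert (Pt : (0 < t)%R) by (unfold t; repeat apply Rdiv_lt_0_compat; lra).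
    set (w := scal (RtoC t) e : CC).
    assert (lw : l w = RtoC t).
    { transitivity (RtoC t * l e); [exact (linear_scal l Ll (RtoC t) e)|]. rewrite Le. ring. }
    destruct (HH w) as [S1 [[x [y [X1 [Y1 [_ [_ E]]]]]] S3]].
    { assert (E : minus w O = w) by exact (minus_zero_r (G := NormedModule.AbelianGroup C_AbsRing CC) w).
      rewrite E. eapply Rle_lt_trans; [apply norm_scal_C|]. rewrite Cmod_R, Rabs_pos_eq by lra.
      apply Rle_lt_trans with (t * (norm e + 1))%R; [apply Rmult_le_compat_l; lra|].
      unfold t. replace (dl / 2 / (norm e + 1) * (norm e + 1))%R with (dl / 2)%R by (field; lra). lra. }
    rewrite S3, lw in E.
    assert (Ht0 : RtoC t <> 0) by (intros Et; apply RtoC_inj in Et; lra).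
    assert (E2 : y * x * u1 w = RtoC 2).
    { transitivity (/ RtoC t * (y * ((RtoC t - 0) * u1 w * x))); [field; auto|]. rewrite E. field; auto. }
    apply (f_equal Cmod) in E2. rewrite !Cmod_mult, Cmod_R, Rabs_pos_eq in E2 by lra.
    assert (E3 : (Cmod y * Cmod x <= B1 * B2)%R).
    { rewrite (Rmult_comm B1). apply Rmult_le_compat; auto using Cmod_ge_0. }
    assert (E4 : (Cmod y * Cmod x * Cmod (u1 w) <= B1 * B2 * m)%R).
    { apply Rmult_le_compat; auto using Cmod_ge_0; [|lra]. apply Rmult_le_pos; apply Cmod_ge_0. }
    replace (B1 * B2 * m)%R with 1%R in E4 by (unfold m; field; lra). lra. }
  exists (fun z => u1 (phi z)). split; [|split].
  - apply (holo_near_comp phi u1); auto. now rewrite phia.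
  - now rewrite phia.
  - pose proof (holo_near_cont phi a Hphi) as cphi. rewrite phia in cphi. specialize (cphi _ Eu1). unfold filtermap in cphi.
    generalize (filter_and _ _ cphi inv1). apply filter_imp. intros z [E1 E2]. rewrite E2 in E1. fold (J z). rewrite E1. ring.
Qed.

(** * Hadamard lemmas with holomorphic coefficients *)

(** [pr] fixes the zero set of [l] pointwise, so the difference vanishes there and can be divided by
    [l]. *)
Lemma division_step {U : NormedModule C_AbsRing} (l : U -> C) (e p : U) (pr : U -> U) (k : U -> C) :
  is_linear (V := CN) l -> l e = 1 -> is_linear pr -> l p = 0 -> pr p = p ->
  (forall z, l z = 0 -> pr z = z) -> holoC k p ->
  exists c : U -> C, holoC c p /\ locally p (fun z => k z - k (pr z) = l z * c z).
Proof.
  intros Ll Le Lpr lp prp Hpr Hk.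
  destruct (holo_division l e p (fun z => k z - k (pr z)) Ll Le) as [c [Hc E]].
  - apply holo_near_minus; auto. apply (holo_near_comp pr k); [now apply holo_near_linear|now rewrite prp].
  - apply filter_forall. intros z Hz. rewrite Hpr; [ring|congruence].
  - exists c. split; auto. revert E. apply filter_imp. intros z ->. rewrite lp. ring.
Qed.

Definition x1 (z : CC4) : C := fst (fst z).
Definition x2 (z : CC4) : C := snd (fst z).
Definition y1 (z : CC4) : C := fst (snd z).
Definition y2 (z : CC4) : C := snd (snd z).

Lemma is_linear_x1 : is_linear (V := CN) x1.
Proof. exact (is_linear_comp _ _ (is_linear_fst (U := CC) (V := CC)) (is_linear_fst (U := CN) (V := CN))). Qed.
Lemma is_linear_x2 : is_linear (V := CN) x2.
Proof. exact (is_linear_comp _ _ (is_linear_fst (U := CC) (V := CC)) (is_linear_snd (U := CN) (V := CN))). Qed.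
Lemma is_linear_y1 : is_linear (V := CN) y1.
Proof. exact (is_linear_comp _ _ (is_linear_snd (U := CC) (V := CC)) (is_linear_fst (U := CN) (V := CN))). Qed.
Lemma is_linear_y2 : is_linear (V := CN) y2.
Proof. exact (is_linear_comp _ _ (is_linear_snd (U := CC) (V := CC)) (is_linear_snd (U := CN) (V := CN))). Qed.

Lemma is_linear_CC4 (l1 l2 l3 l4 : CC4 -> C) :
  is_linear (V := CN) l1 -> is_linear (V := CN) l2 ->
  is_linear (V := CN) l3 -> is_linear (V := CN) l4 ->
  is_linear (V := CC4) (fun z => ((l1 z, l2 z), (l3 z, l4 z))).
Proof.
  intros H1 H2 H3 H4. apply (is_linear_prod (T := CC4) (U := CC) (V := CC));
    apply (is_linear_prod (T := CC4) (U := CN) (V := CN)); auto.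
Qed.

Lemma is_linear_diff {U : NormedModule C_AbsRing} (l1 l2 : U -> C) :
  is_linear (V := CN) l1 -> is_linear (V := CN) l2 ->
  is_linear (V := CN) (fun z => l1 z - l2 z).
Proof.
  intros H1 H2.
  apply (is_linear_ext (V := CN) (fun z => plus (l1 z : CN) (opp (l2 z : CN)))); [reflexivity|].
  exact (is_linear_comp (V := prod_NormedModule C_AbsRing CN CN) (W := CN) (fun z => (l1 z : CN, opp (l2 z : CN))) _
    (is_linear_prod (U := CN) (V := CN) _ _ H1 (is_linear_comp (V := CN) (W := CN) _ _ H2 (is_linear_opp (V := CN)))) (is_linear_plus (V := CN))).
Qed.

Lemma is_linear_0 : is_linear (U := CC4) (V := CN) (fun _ => RtoC 0).
Proof. exact (is_linear_zero (U := CC4) (V := CN)). Qed.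

Lemma CC4_eq (z w : CC4) : x1 z = x1 w -> x2 z = x2 w -> y1 z = y1 w -> y2 z = y2 w -> z = w.
Proof. intros. apply injective_projections; apply injective_projections; auto. Qed.

Definition origin4 : CC4 := (origin, origin).

(** The coordinates are set to 0 one after another. The change made by each step is divisible by its
    coordinate, and the changes telescope to k(z) - k(0). *)
Lemma hadamard4 (k : CC4 -> C) : holoC k origin4 -> k origin4 = 0 ->
  exists k1 k2 k3 k4 : CC4 -> C, holoC k1 origin4 /\ holoC k2 origin4 /\ holoC k3 origin4 /\ holoC k4 origin4 /\
    locally origin4 (fun z => k z = x1 z * k1 z + x2 z * k2 z + y1 z * k3 z + y2 z * k4 z).
Proof.
  intros Hk k0.
  pose (p1 := fun z : CC4 => ((RtoC 0, x2 z), (y1 z, y2 z)) : CC4).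
  pose (p2 := fun z : CC4 => ((x1 z, RtoC 0), (y1 z, y2 z)) : CC4).
  pose (p3 := fun z : CC4 => ((x1 z, x2 z), (RtoC 0, y2 z)) : CC4).
  pose (p4 := fun z : CC4 => ((x1 z, x2 z), (y1 z, RtoC 0)) : CC4).
  pose proof is_linear_x1 as L1. pose proof is_linear_x2 as L2. pose proof is_linear_y1 as L3. pose proof is_linear_y2 as L4.
  assert (Lp1 : is_linear p1) by (apply is_linear_CC4; auto using is_linear_0).
  assert (Lp2 : is_linear p2) by (apply is_linear_CC4; auto using is_linear_0).
  assert (Lp3 : is_linear p3) by (apply is_linear_CC4; auto using is_linear_0).
  assert (Lp4 : is_linear p4) by (apply is_linear_CC4; auto using is_linear_0).
  assert (comp : forall (k : CC4 -> C) pr, is_linear pr -> pr origin4 = origin4 -> holoC k origin4 -> holoC (fun z => k (pr z)) origin4).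
  { intros k' pr Hpr E Hk'. apply (holo_near_comp pr k'); [now apply holo_near_linear|now rewrite E]. }
  destruct (division_step x1 (((RtoC 1, RtoC 0), (RtoC 0, RtoC 0)) : CC4) origin4 p1 k L1 eq_refl Lp1 eq_refl eq_refl) as [k1 [H1 E1]]; auto.
  { intros z Hz. apply CC4_eq; try reflexivity. now rewrite Hz. }
  assert (Hk1 : holoC (fun z => k (p1 z)) origin4) by (apply comp; auto).
  destruct (division_step x2 (((RtoC 0, RtoC 1), (RtoC 0, RtoC 0)) : CC4) origin4 p2 (fun z => k (p1 z)) L2 eq_refl Lp2 eq_refl eq_refl) as [k2 [H2 E2]]; auto.
  { intros z Hz. apply CC4_eq; try reflexivity. now rewrite Hz. }
  assert (Hk2 : holoC (fun z => k (p1 (p2 z))) origin4) by (apply (comp (fun z => k (p1 z)) p2); auto).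
  destruct (division_step y1 (((RtoC 0, RtoC 0), (RtoC 1, RtoC 0)) : CC4) origin4 p3 (fun z => k (p1 (p2 z))) L3 eq_refl Lp3 eq_refl eq_refl) as [k3 [H3 E3]]; auto.
  { intros z Hz. apply CC4_eq; try reflexivity. now rewrite Hz. }
  assert (Hk3 : holoC (fun z => k (p1 (p2 (p3 z)))) origin4) by (apply (comp (fun z => k (p1 (p2 z))) p3); auto).
  destruct (division_step y2 (((RtoC 0, RtoC 0), (RtoC 0, RtoC 1)) : CC4) origin4 p4 (fun z => k (p1 (p2 (p3 z)))) L4 eq_refl Lp4 eq_refl eq_refl) as [k4 [H4 E4]]; auto.
  { intros z Hz. apply CC4_eq; try reflexivity. now rewrite Hz. }
  exists k1, k2, k3, k4. repeat (split; [assumption|]).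
  generalize (filter_and _ _ E1 (filter_and _ _ E2 (filter_and _ _ E3 E4))). apply filter_imp.
  intros z [A1 [A2 [A3 A4]]]. rewrite <- A1, <- A2, <- A3, <- A4.
  change (p1 (p2 (p3 (p4 z)))) with origin4. rewrite k0. ring.
Qed.

(** The first point is moved to the second one coordinate at a time, and each move is divisible by
    the difference of the two coordinates. Composed with F at both points, this puts k(F x) - k(F y)
    into the ideal of the component differences. *)
Lemma hadamard_two_point (k : CC -> C) (c : CC) : holoC k c ->
  exists k1 k2 : CC4 -> C, holoC k1 (c, c) /\ holoC k2 (c, c) /\
    locally ((c, c) : CC4) (fun z => k (fst z) - k (snd z) = (x1 z - y1 z) * k1 z + (x2 z - y2 z) * k2 z).
Proof.
  intros Hk.
  pose (p1 := fun z : CC4 => ((y1 z, x2 z), (y1 z, y2 z)) : CC4).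
  pose (p2 := fun z : CC4 => ((x1 z, y2 z), (y1 z, y2 z)) : CC4).
  pose proof is_linear_x1 as L1. pose proof is_linear_x2 as L2. pose proof is_linear_y1 as L3. pose proof is_linear_y2 as L4.
  assert (Lp1 : is_linear p1) by (apply is_linear_CC4; auto).
  assert (Lp2 : is_linear p2) by (apply is_linear_CC4; auto).
  set (p := (c, c) : CC4).
  assert (P1 : p1 p = p) by (apply CC4_eq; reflexivity). assert (P2 : p2 p = p) by (apply CC4_eq; reflexivity).
  assert (Hk0 : holoC (fun z : CC4 => k (fst z)) p).
  { apply (holo_near_comp (fst : CC4 -> CC) k); auto. apply holo_near_linear, (is_linear_fst (U := CC) (V := CC)). }
  destruct (division_step (fun z => x1 z - y1 z) (((RtoC 1, RtoC 0), (RtoC 0, RtoC 0)) : CC4) p p1 (fun z => k (fst z)) (is_linear_diff _ _ L1 L3)) as [k1 [H1 E1]]; auto.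
  { unfold x1, y1; cbn [fst snd]. ring. } { unfold p, x1, y1; cbn [fst snd]. cring. }
  { intros z Hz. apply CC4_eq; try reflexivity. change (y1 z = x1 z).
    replace (x1 z) with (y1 z + (x1 z - y1 z)) by ring. rewrite Hz. ring. }
  assert (Hk1 : holoC (fun z : CC4 => k (fst (p1 z))) p).
  { apply (holo_near_comp p1 (fun z : CC4 => k (fst z))); [now apply holo_near_linear|now rewrite P1]. }
  destruct (division_step (fun z => x2 z - y2 z) (((RtoC 0, RtoC 1), (RtoC 0, RtoC 0)) : CC4) p p2 (fun z => k (fst (p1 z))) (is_linear_diff _ _ L2 L4)) as [k2 [H2 E2]]; auto.
  { unfold x2, y2; cbn [fst snd]. ring. } { unfold p, x2, y2; cbn [fst snd]. cring. }
  { intros z Hz. apply CC4_eq; try reflexivity. change (y2 z = x2 z).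
    replace (x2 z) with (y2 z + (x2 z - y2 z)) by ring. rewrite Hz. ring. }
  exists k1, k2. split; [auto|split; [auto|]].
  generalize (filter_and _ _ E1 E2). apply filter_imp. intros z [A1 A2]. rewrite <- A1, <- A2.
  assert (E : fst (p1 (p2 z)) = snd z) by (apply injective_projections; reflexivity).
  rewrite E. ring.
Qed.

(** * Ideals with four generators *)

Section FourGenerators.
Context {U : NormedModule C_AbsRing}.
Variables (p : U) (h1 h2 h3 h4 : U -> C).

Lemma in_ideal4 (phi : U -> C) : in_ideal p [h1; h2; h3; h4] phi <->
  exists c1 c2 c3 c4 : U -> C, holoC c1 p /\ holoC c2 p /\ holoC c3 p /\ holoC c4 p /\
    locally p (fun z => phi z = c1 z * h1 z + c2 z * h2 z + c3 z * h3 z + c4 z * h4 z).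
Proof.
  split.
  - intros [as_ [Hl [Ha Hg]]]. destruct as_ as [|c1 [|c2 [|c3 [|c4 [|]]]]]; try discriminate Hl.
    apply List.Forall_cons_iff in Ha. destruct Ha as [A1 Ha]. apply List.Forall_cons_iff in Ha. destruct Ha as [A2 Ha].
    apply List.Forall_cons_iff in Ha. destruct Ha as [A3 Ha]. apply List.Forall_cons_iff in Ha. destruct Ha as [A4 _].
    exists c1, c2, c3, c4. repeat (split; [assumption|]). revert Hg. unfold germ_eq. apply filter_imp. intros z Hz.
    etransitivity; [exact Hz|].
    change (c1 z * h1 z + (c2 z * h2 z + (c3 z * h3 z + (c4 z * h4 z + 0))) = c1 z * h1 z + c2 z * h2 z + c3 z * h3 z + c4 z * h4 z). ring.
  - intros [c1 [c2 [c3 [c4 [A1 [A2 [A3 [A4 Hg]]]]]]]]. exists [c1; c2; c3; c4].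
    split; [reflexivity|split; [repeat apply List.Forall_cons; auto; apply List.Forall_nil|]].
    revert Hg. unfold germ_eq. apply filter_imp. intros z Hz. etransitivity; [exact Hz|].
    change (c1 z * h1 z + c2 z * h2 z + c3 z * h3 z + c4 z * h4 z = c1 z * h1 z + (c2 z * h2 z + (c3 z * h3 z + (c4 z * h4 z + 0)))). ring.
Qed.

Let I := in_ideal p [h1; h2; h3; h4].

Lemma ideal4_ext (f g : U -> C) : locally p (fun z => f z = g z) -> I f -> I g.
Proof.
  unfold I. rewrite !in_ideal4. intros E [c1 [c2 [c3 [c4 [A1 [A2 [A3 [A4 Hg]]]]]]]]. exists c1, c2, c3, c4.
  repeat (split; [assumption|]). generalize (filter_and _ _ E Hg). apply filter_imp. intros z [E1 E2]. congruence.
Qed.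

Lemma ideal4_plus (f g : U -> C) : I f -> I g -> I (fun z => f z + g z).
Proof.
  unfold I. rewrite !in_ideal4. intros [c1 [c2 [c3 [c4 [A1 [A2 [A3 [A4 Hf]]]]]]]] [e1 [e2 [e3 [e4 [B1 [B2 [B3 [B4 Hg]]]]]]]].
  exists (fun z => c1 z + e1 z), (fun z => c2 z + e2 z), (fun z => c3 z + e3 z), (fun z => c4 z + e4 z).
  repeat (split; [now apply holo_near_plus|]). generalize (filter_and _ _ Hf Hg). apply filter_imp.
  intros z [-> ->]. ring.
Qed.

Lemma ideal4_mult (f g : U -> C) : I f -> holoC g p -> I (fun z => f z * g z).
Proof.
  unfold I. rewrite !in_ideal4. intros [c1 [c2 [c3 [c4 [A1 [A2 [A3 [A4 Hf]]]]]]]] Hg.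
  exists (fun z => c1 z * g z), (fun z => c2 z * g z), (fun z => c3 z * g z), (fun z => c4 z * g z).
  repeat (split; [now apply holo_near_mult|]). revert Hf. apply filter_imp. intros z ->. ring.
Qed.

Lemma ideal4_generators : I h1 /\ I h2 /\ I h3 /\ I h4.
Proof.
  assert (K : forall c1 c2 c3 c4 : C, I (fun z => c1 * h1 z + c2 * h2 z + c3 * h3 z + c4 * h4 z)).
  { intros c1 c2 c3 c4. apply in_ideal4. exists (fun _ => c1), (fun _ => c2), (fun _ => c3), (fun _ => c4).
    repeat (split; [apply (holo_near_const (V := CN))|]). now apply filter_forall. }
  repeat split.
  - refine (ideal4_ext _ _ _ (K 1 0 0 0)). apply filter_forall. intros z. ring.
  - refine (ideal4_ext _ _ _ (K 0 1 0 0)). apply filter_forall. intros z. ring.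
  - refine (ideal4_ext _ _ _ (K 0 0 1 0)). apply filter_forall. intros z. ring.
  - refine (ideal4_ext _ _ _ (K 0 0 0 1)). apply filter_forall. intros z. ring.
Qed.
End FourGenerators.

Lemma locally_fst (a b : CC) (P : CC -> Prop) : locally a P -> locally ((a, b) : CC4) (fun z => P (fst z)).
Proof. intros H. exact (linear_cont _ ((a, b) : CC4) (is_linear_fst (U := CC) (V := CC)) _ H). Qed.

Lemma locally_snd (a b : CC) (P : CC -> Prop) : locally b P -> locally ((a, b) : CC4) (fun z => P (snd z)).
Proof. intros H. exact (linear_cont _ ((a, b) : CC4) (is_linear_snd (U := CC) (V := CC)) _ H). Qed.

Lemma holo_near_comp_fst {V : NormedModule C_AbsRing} (f : CC -> V) (a b : CC) : holo_near f a ->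
  holo_near (fun z : CC4 => f (fst z)) ((a, b) : CC4).
Proof. intros H. apply (holo_near_comp (fst : CC4 -> CC) f); auto. apply holo_near_linear, (is_linear_fst (U := CC) (V := CC)). Qed.

Lemma holo_near_comp_snd {V : NormedModule C_AbsRing} (f : CC -> V) (a b : CC) : holo_near f b ->
  holo_near (fun z : CC4 => f (snd z)) ((a, b) : CC4).
Proof. intros H. apply (holo_near_comp (snd : CC4 -> CC) f); auto. apply holo_near_linear, (is_linear_snd (U := CC) (V := CC)). Qed.

Lemma filterdiff_CC_fst (z : CC) : diffC (fun y : CC => fst y) z (fun v => fst v).
Proof. apply filterdiff_linear, (is_linear_fst (U := CN) (V := CN)). Qed.

Lemma filterdiff_CC_snd (z : CC) : diffC (fun y : CC => snd y) z (fun v => snd v).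
Proof. apply filterdiff_linear, (is_linear_snd (U := CN) (V := CN)). Qed.

(** * The ideal of a pair of folds *)

Section Direct.
Variables (d1 d2 : nat) (cf cg : nat -> nat -> C).
Hypotheses (Hcf : deg_le d1 cf) (Hcg : deg_le d2 cg).
Let F := pmap d1 d2 cf cg.
Let J := jac d1 d2 cf cg.

Lemma folds_ideal_maximal (a b : C2) : F a = F b -> bigerm_folds F a b ->
  forall phi : CC4 -> C, holoC phi ((a, b) : CC4) -> phi (a, b) = 0 ->
  in_ideal (U := CC4) (a, b) (node_ideal d1 d2 cf cg) phi.
Proof.
  intros Fab [phi1 [phi2 [psi [B1 [B2 [B3 [G1 G2]]]]]]] phi Hphi phi0.
  set (p := (a, b) : CC4) in *.
  assert (DF : forall z : CC, filterdiff F (locally z) (dpmap d1 d2 cf cg z)) by (intros z; now apply filterdiff_pmap).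
  assert (HF : forall z : CC, holo_near F z) by (intros z; apply hol_holo_near; intros y; eexists; apply DF).
  assert (HJ : forall z : CC, holoC (fun y => det2 (dpmap d1 d2 cf cg y)) z).
  { intros z. apply (holo_near_ext (V := CN) J).
    - apply filter_forall. intros y. symmetry. apply det2_dpmap.
    - apply hol_holo_near. intros y. now apply hol_jac. }
  destruct (jacobian_factor F _ a phi1 psi fold1 (fun w v => (fst v * fst w + fst w * fst v, snd v)) (fun w => fst w) e1
    DF (HJ a)) as [u [Hu [u0 Eu]]]; auto.
  { intros w. apply (filterdiff_pair (V := CN) (W := CN)); [|apply filterdiff_CC_snd].
    apply (filterdiff_cmult (U := CC)); apply filterdiff_CC_fst. }
  { intros w. unfold det2, e1, e2; cbn [fst snd]. refine (_ : @eq C _ _). ring. }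
  { apply (is_linear_fst (U := CN) (V := CN)). }
  destruct (jacobian_factor F _ b phi2 psi fold2 (fun w v => (fst v, snd v * snd w + snd w * snd v)) (fun w => snd w) e2
    DF (HJ b)) as [u' [Hu' [u0' Eu']]]; auto.
  { intros w. apply (filterdiff_pair (V := CN) (W := CN)); [apply filterdiff_CC_fst|].
    apply (filterdiff_cmult (U := CC)); apply filterdiff_CC_snd. }
  { intros w. unfold det2, e1, e2; cbn [fst snd]. refine (_ : @eq C _ _). ring. }
  { apply (is_linear_snd (U := CN) (V := CN)). }
  { now rewrite <- Fab. }
  destruct B1 as [phi1a [Hphi1 [phi1' [phi1'0 [Hphi1' [inv1 _]]]]]].
  destruct B2 as [phi2b [Hphi2 [phi2' [phi2'0 [Hphi2' [inv2 _]]]]]].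
  destruct B3 as [_ [Hpsi _]].
  unfold node_ideal. fold F J.
  set (h1 := fun xy : C4 => J (fst xy)). set (h2 := fun xy : C4 => J (snd xy)).
  set (h3 := fun xy : C4 => fst (F (fst xy)) - fst (F (snd xy))).
  set (h4 := fun xy : C4 => snd (F (fst xy)) - snd (F (snd xy))).
  pose proof (ideal4_ext (U := CC4) p h1 h2 h3 h4) as Iext.
  pose proof (ideal4_plus (U := CC4) p h1 h2 h3 h4) as Iplus.
  pose proof (ideal4_mult (U := CC4) p h1 h2 h3 h4) as Imult.
  destruct (ideal4_generators (U := CC4) p h1 h2 h3 h4) as [I1 [I2 [I3 I4]]].
  set (I := in_ideal (U := CC4) p [h1; h2; h3; h4]) in *. cbv zeta in Iext, Iplus, Imult.
  assert (IX1 : I (fun z => fst (phi1 (fst z)))).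
  { apply (Iext (fun z => h1 z * / u (fst z))).
    - pose proof (holo_near_neq_0 u a Hu u0) as N. generalize (locally_fst a b _ (filter_and _ _ N Eu)). apply filter_imp.
      intros z [Nz Ez]. assert (Ez' : h1 z = fst (phi1 (fst z)) * u (fst z)).
      { etransitivity; [symmetry; exact (det2_dpmap d1 d2 cf cg (fst z))|exact Ez]. }
      rewrite Ez'.
      refine (_ : @eq C _ _). field. exact Nz.
    - apply Imult; auto. apply (holo_near_comp_fst (V := CN) (fun y => / u y) a b). now apply holo_near_inv. }
  assert (IY2 : I (fun z => snd (phi2 (snd z)))).
  { apply (Iext (fun z => h2 z * / u' (snd z))).
    - pose proof (holo_near_neq_0 u' b Hu' u0') as N. generalize (locally_snd a b _ (filter_and _ _ N Eu')). apply filter_imp.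
      intros z [Nz Ez]. assert (Ez' : h2 z = snd (phi2 (snd z)) * u' (snd z)).
      { etransitivity; [symmetry; exact (det2_dpmap d1 d2 cf cg (snd z))|exact Ez]. }
      rewrite Ez'.
      refine (_ : @eq C _ _). field. exact Nz.
    - apply Imult; auto. apply (holo_near_comp_snd (V := CN) (fun y => / u' y) a b). now apply holo_near_inv. }
  set (FF := fun z : CC4 => (F (fst z), F (snd z)) : CC4).
  assert (HFF : holo_near FF p).
  { apply (holo_near_pair (V := CC) (W := CC)); [apply (holo_near_comp_fst F a b)|apply (holo_near_comp_snd F a b)]; apply HF. }
  assert (EFF : FF p = (F a, F a)).
  { unfold FF, p. cbn [fst snd]. now rewrite Fab. }
  (* As F(a) = F(b), both arguments of [k] are near the same target point, so the two-point lemma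
     applies at (c, c) and is pulled back along [FF]. *)
  assert (Idiff : forall k : CC -> C, holoC k (F a) -> I (fun z => k (F (fst z)) - k (F (snd z)))).
  { intros k Hk. destruct (hadamard_two_point k (F a) Hk) as [k1 [k2 [H1 [H2 E]]]].
    apply (Iext (fun z : CC4 => h3 z * k1 (FF z) + h4 z * k2 (FF z))).
    - pose proof (holo_near_cont (V := CC4) _ p HFF) as Hc. rewrite EFF in Hc. specialize (Hc _ E). unfold filtermap in Hc.
      revert Hc. apply filter_imp. intros z Ez. symmetry. exact Ez.
    - apply Iplus; apply Imult; auto.
      + apply (holo_near_comp (V := CC4) FF k1); auto. now rewrite EFF.
      + apply (holo_near_comp (V := CC4) FF k2); auto. now rewrite EFF. }
  pose proof (locally_fst a b _ G1) as L1. pose proof (locally_snd a b _ G2) as L2.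
  assert (neg : forall f, I f -> I (fun z => - f z)).
  { intros f Hf. apply (Iext (fun z => f z * - (1))); [apply filter_forall; intros z; ring|].
    apply Imult; auto. apply (holo_near_const (V := CN)). }
  (* The difference of the first components of psi F at the two points is X1^2 - Y1, which together
     with X1 yields Y1; [IX2] obtains X2 from the second components in the same way. *)
  assert (IY1 : I (fun z => fst (phi2 (snd z)))).
  { apply (Iext (fun z => fst (phi1 (fst z)) * fst (phi1 (fst z)) + - (fst (psi (F (fst z))) - fst (psi (F (snd z)))))).
    - generalize (filter_and _ _ L1 L2). apply filter_imp. intros z [E1 E2]. rewrite E1, E2. unfold fold1, fold2; cbn [fst snd]. ring.
    - apply Iplus.
      + apply Imult; auto. apply (holo_near_comp_fst (V := CN) (fun y => fst (phi1 y)) a b).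
        exact (holo_near_fst (V := CN) (W := CN) phi1 a Hphi1).
      + apply neg, (Idiff (fun y => fst (psi y))). exact (holo_near_fst (V := CN) (W := CN) psi (F a) Hpsi). }
  assert (IX2 : I (fun z => snd (phi1 (fst z)))).
  { apply (Iext (fun z => (snd (psi (F (fst z))) - snd (psi (F (snd z)))) + snd (phi2 (snd z)) * snd (phi2 (snd z)))).
    - generalize (filter_and _ _ L1 L2). apply filter_imp. intros z [E1 E2]. rewrite E1, E2. unfold fold1, fold2; cbn [fst snd]. ring.
    - apply Iplus.
      + apply (Idiff (fun y => snd (psi y))). exact (holo_near_snd (V := CN) (W := CN) psi (F a) Hpsi).
      + apply Imult; auto. apply (holo_near_comp_snd (V := CN) (fun y => snd (phi2 y)) a b).
        exact (holo_near_snd (V := CN) (W := CN) phi2 b Hphi2). }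
  set (Psi := fun z : CC4 => (phi1 (fst z), phi2 (snd z)) : CC4).
  assert (HPsi : holo_near Psi p).
  { apply (holo_near_pair (V := CC) (W := CC)); [exact (holo_near_comp_fst phi1 a b Hphi1)|exact (holo_near_comp_snd phi2 a b Hphi2)]. }
  assert (Psip : Psi p = origin4) by (unfold Psi, p, origin4; cbn [fst snd]; now rewrite phi1a, phi2b).
  (* [Xi] is the local inverse of [Psi]: phi is expanded in the source coordinates, and the
     expansion is pulled back along [Psi]. *)
  set (Xi := fun z : CC4 => (phi1' (fst z), phi2' (snd z)) : CC4).
  assert (HXi : holo_near Xi origin4).
  { apply (holo_near_pair (V := CC) (W := CC));
      [exact (holo_near_comp_fst phi1' origin origin Hphi1')|exact (holo_near_comp_snd phi2' origin origin Hphi2')]. }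
  assert (Xi0 : Xi origin4 = p) by (unfold Xi, p, origin4; cbn [fst snd]; now rewrite phi1'0, phi2'0).
  destruct (hadamard4 (fun z => phi (Xi z))) as [k1 [k2 [k3 [k4 [H1 [H2 [H3 [H4 E]]]]]]]].
  { apply (holo_near_comp Xi phi); auto. now rewrite Xi0. }
  { now rewrite Xi0. }
  assert (Hk : forall k, holoC k origin4 -> holoC (fun z => k (Psi z)) p).
  { intros k Hk. apply (holo_near_comp Psi k); auto. now rewrite Psip. }
  apply (Iext (fun z => fst (phi1 (fst z)) * k1 (Psi z) + snd (phi1 (fst z)) * k2 (Psi z)
     + fst (phi2 (snd z)) * k3 (Psi z) + snd (phi2 (snd z)) * k4 (Psi z))).
  - pose proof (holo_near_cont Psi p HPsi) as Hc. rewrite Psip in Hc. specialize (Hc _ E). unfold filtermap in Hc.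
    generalize (filter_and _ _ Hc (filter_and _ _ (locally_fst a b _ inv1) (locally_snd a b _ inv2))). apply filter_imp.
    intros z [E1 [E2 E3]].
    assert (EX : Xi (Psi z) = z) by (apply injective_projections; [exact E2|exact E3]).
    rewrite EX in E1. symmetry. exact E1.
  - repeat apply Iplus; apply Imult; auto.
Qed.

(** A node is an unordered pair, while the ideal lives at an ordered one. The swap exchanges the
    first two generators and changes the sign of the last two, whence the negated coefficients. *)
Lemma node_ideal_swap (a b : C2) (phi : CC4 -> C) :
  in_ideal (U := CC4) (b, a) (node_ideal d1 d2 cf cg) phi ->
  in_ideal (U := CC4) (a, b) (node_ideal d1 d2 cf cg) (fun z => phi (snd z, fst z)).
Proof.
  unfold node_ideal. rewrite !in_ideal4. intros [c1 [c2 [c3 [c4 [A1 [A2 [A3 [A4 E]]]]]]]].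
  set (sw := fun z : CC4 => (snd z, fst z) : CC4).
  assert (Lsw : is_linear sw).
  { apply (is_linear_prod (T := CC4) (U := CC) (V := CC)); [apply (is_linear_snd (U := CC) (V := CC))|apply (is_linear_fst (U := CC) (V := CC))]. }
  assert (Hc : forall c, holoC c ((b, a) : CC4) -> holoC (fun z => c (sw z)) ((a, b) : CC4)).
  { intros c Hc. apply (holo_near_comp sw c); auto. now apply holo_near_linear. }
  assert (Hn : forall c : CC4 -> C, holoC c ((b, a) : CC4) -> holoC (fun z => 0 - c (sw z)) ((a, b) : CC4)).
  { intros c Hc'. apply holo_near_minus; auto. apply (holo_near_const (V := CN)). }
  exists (fun z => c2 (sw z)), (fun z => c1 (sw z)), (fun z => 0 - c3 (sw z)), (fun z => 0 - c4 (sw z)).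
  repeat (split; [auto|]).
  pose proof (linear_cont sw ((a, b) : CC4) Lsw _ E) as E'. unfold filtermap in E'. revert E'. apply filter_imp.
  intros [x y] Ez. etransitivity; [exact Ez|]. unfold sw. cbn [fst snd]. ring.
Qed.

Lemma nu_1_of_is_node (a b : C2) : J a = 0 -> J b = 0 -> is_node F a b -> nu_eq d1 d2 cf cg a b 1.
Proof.
  intros Ja Jb [_ [Fab HB]].
  assert (Hmax : forall phi : CC4 -> C, holoC phi ((a, b) : CC4) -> phi (a, b) = 0 ->
     in_ideal (U := CC4) (a, b) (node_ideal d1 d2 cf cg) phi).
  { destruct HB as [HB|HB]; [now apply folds_ideal_maximal|]. intros phi Hphi phi0.
    pose proof (folds_ideal_maximal b a (eq_sym Fab) HB (fun z => phi (snd z, fst z))) as H.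
    apply (ideal4_ext (U := CC4) (a, b) _ _ _ _ (fun z => phi (fst z, snd z))).
    { apply filter_forall. intros [x y]. reflexivity. }
    apply (node_ideal_swap a b (fun z => phi (snd z, fst z))). apply H; [|exact phi0].
    apply (holo_near_comp (V := CC4) (fun z : CC4 => (snd z, fst z)) phi); [|exact Hphi].
    apply holo_near_linear, (is_linear_prod (T := CC4) (U := CC) (V := CC));
      [apply (is_linear_snd (U := CC) (V := CC))|apply (is_linear_fst (U := CC) (V := CC))]. }
  assert (S1 : forall (c : nat -> C), sum_lt 1 (fun k => c k * 1) = c 0%nat).
  { intros c. change (c 0%nat * 1 + 0 = c 0%nat). ring. }
  (* The quotient is spanned by the constant 1, the class of phi being its value at (a, b); a
     constant in the ideal is 0 because the generators vanish there. *)
  exists (fun _ _ => 1). split; [|split].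
  - intros k _. apply (holo_near_const (V := CN)).
  - intros phi Hphi. exists (fun _ => phi (a, b)). apply Hmax.
    + apply holo_near_minus; auto. apply (holo_near_const (V := CN)).
    + cbv beta. rewrite (S1 (fun _ => phi (a, b))). ring.
  - intros c Hc k Hk. replace k with 0%nat by lia. rewrite <- (S1 c).
    exact (in_ideal_vanish (U := CC4) _ _ _ (node_ideal_vanish d1 d2 cf cg a b Ja Jb Fab) Hc).
Qed.
End Direct.

Theorem theorem2p17 (d1 d2 : nat) (cf cg : nat -> nat -> C) (a b c : C2) :
  (0 < d1)%nat -> (0 < d2)%nat ->
  deg_le d1 cf -> deg_le d2 cg ->
  proper_map (pmap d1 d2 cf cg) ->
  generalized_node d1 d2 cf cg a b ->
  pmap d1 d2 cf cg a = c -> pmap d1 d2 cf cg b = c ->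
  (is_node (pmap d1 d2 cf cg) a b <-> nu_eq d1 d2 cf cg a b 1).
Proof.
  intros _ _ Hcf Hcg _ [Ja [Jb [Fab _]]] _ _. split.
  - now apply nu_1_of_is_node.
  - now apply is_node_of_nu_1.
Qed.
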